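(* Let $\nu$ be a symmetric Lévy measure on $\mathbb{R}^d\setminus\{0\}$, let $\mathcal{L}=\mathcal{L}_\nu$, and let $T\in(0,\infty)$. Assume that $\mathcal{L}_\nu$ has an associated heat kernel $P$ with $P_t\in C(\mathbb{R}^d)$ and $P_t>0$ for all $t>0$, and that there are a function $\phi\in C^2(\mathbb{R}^d)$ and a constant $c>1$ such that $$c^{-1}P_1\le\phi\le cP_1,\qquad|\mathcal{L}_\nu\phi|\le c\,\phi,\qquad|B_\nu(\psi,\phi)|\le c\max\{\|\psi\|_\infty,\|\nabla\psi\|_\infty\}\,\phi\quad\text{for all }\psi\in C_c^\infty(\mathbb{R}^d).$$ If $u\in L^1_{\rm loc}((0,T);L^1_{P_1})$ is a nonnegative very weak solution to $\partial_tu+\mathcal{L}u=0$ in $\mathbb{R}^d\times(0,T)$, then there is a nonnegative Radon measure $\mu_0$ on $\mathbb{R}^d$ such that $$\operatorname*{ess\,lim}_{t\to0^+}\int_{\mathbb{R}^d}\psi(x)u(x,t)\,dx=\int_{\mathbb{R}^d}\psi\,d\mu_0\quad\text{for all }\psi\in C_c(\mathbb{R}^d),$$ that is, $\mu_0$ is the initial trace of $u$. Moreover, $\int_{\mathbb{R}^d}P_1\,d\mu_0<\infty$.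
   Context: Symmetric Lévy measure: a nonnegative Radon measure $\nu$ on $\mathbb{R}^d\setminus\{0\}$ with $\nu(B)=\nu(-B)$ for all Borel $B$ and $\int\min\{1,|y|^2\}\,d\nu(y)<\infty$. Operator (acting in the $x$ variable): $\mathcal{L}_\nu u(x)=\int_{\mathbb{R}^d}\Big(u(x)-\frac{u(x+y)+u(x-y)}2\Big)d\nu(y)$. Bilinear form: $B_\nu(u,v)(x)=\int_{\mathbb{R}^d}(u(x)-u(x-y))(v(x)-v(x-y))\,d\nu(y)$. Heat kernel: with $m(\xi)=\int_{\mathbb{R}^d}(1-\cos\langle\xi,y\rangle)\,d\nu(y)$, for each $t>0$ let $p_t$ be the law at time $t$ of the Lévy process with characteristic exponent $m$, i.e. the probability measure with $\int e^{i\langle\xi,x\rangle}p_t(dx)=e^{-tm(\xi)}$. $\mathcal{L}_\nu$ has an associated heat kernel $P(x,t)=P_t(x)$ if $p_t(dx)=P_t(x)\,dx$ with $P_t\in L^1(\mathbb{R}^d)$ for all $t>0$. $L^1_{P_1}=\{v\in L^1_{\rm loc}(\mathbb{R}^d):\int_{\mathbb{R}^d}|v|P_1\,dx<\infty\}$; $u\in L^1_{\rm loc}((0,T);L^1_{P_1})$ means $\int_{\varepsilon}^{T'}\int_{\mathbb{R}^d}|u(x,t)|P_1(x)\,dx\,dt<\infty$ for all $0<\varepsilon<T'<T$. Very weak solution: $u\in L^1_{\rm loc}(\mathbb{R}^d\times(0,T))$ such that, for all $\theta\in C_c^\infty(\mathbb{R}^d\times(0,T))$, $\int_0^T\int_{\mathbb{R}^d}|u||\mathcal{L}\theta|\,dx\,dt<\infty$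 and $\int_0^T\int_{\mathbb{R}^d}u(\partial_t\theta-\mathcal{L}\theta)\,dx\,dt=0$. *)

(* Defs.v *)
From HB Require Import structures.
From mathcomp Require Import all_boot all_order all_algebra.
From mathcomp Require Import all_classical all_reals all_analysis measurable_realfun.
From mathcomp Require Import complex.

Set Implicit Arguments.
Unset Strict Implicit.
Unset Printing Implicit Defensive.

Import Order.TTheory GRing.Theory Num.Theory.
Import numFieldNormedType.Exports.

Local Open Scope classical_set_scope.
Local Open Scope ring_scope.

Section borel_matrix.
Variables (R : realType) (m n : nat).

Definition borel_mx : set (set 'M[R]_(m, n)) := <<s open >>.

Let borel_mx0 : borel_mx set0.
Proof. exact: sigma_algebra0. Qed.

Let borel_mxC A : borel_mx A -> borel_mx (~` A).
Proof. exact: sigma_algebraC. Qed.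

Let borel_mx_bigcup (F : (set 'M[R]_(m, n))^nat) :
  (forall i, borel_mx (F i)) -> borel_mx (\bigcup_i F i).
Proof. exact: sigma_algebra_bigcup. Qed.

HB.instance Definition _ := @isMeasurable.Build default_measure_display
  'M[R]_(m, n) borel_mx borel_mx0 borel_mxC borel_mx_bigcup.

Lemma open_measurable_mx (A : set 'M[R]_(m, n)) : open A -> measurable A.
Proof. by move=> oA; apply: sub_sigma_algebra. Qed.

End borel_matrix.

Section sigma_finite_of.
Context d (T : measurableType d) (R : realType) (m : {measure set T -> \bar R}).
Hypothesis m_sf : sigma_finite setT m.

Definition sigma_finite_of of sigma_finite setT m : set T -> \bar R := m.

Local Notation sfm := (sigma_finite_of m_sf).

HB.instance Definition _ := Measure.on sfm.
HB.instance Definition _ := Measure_isSigmaFinite.Build _ _ _ sfm m_sf.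

End sigma_finite_of.

Section lebesgue_rV.
Variable R : realType.

Definition cons_rV n (p : R * 'rV[R]_n) : 'rV[R]_n.+1 := row_mx p.1%:M p.2.

(* R^0 is a point; then Tonelli recursion on the dimension. *)
Fixpoint lebesgue_rV n : set 'rV[R]_n -> \bar R :=
  match n with
  | 0 => fun A => \d_(0 : 'rV[R]_0) A
  | n'.+1 => fun A => (\int[lebesgue_measure]_x
      lebesgue_rV [set v : 'rV[R]_n' | A (cons_rV (x, v))])%E
  end.

Let uncons n (x : 'rV[R]_n.+1) : R * 'rV[R]_n :=
  (x 0 0, rsubmx (x : 'rV_(1 + n))).

Let consK n : cancel (@cons_rV n) (@uncons n).
Proof.
move=> [a v]; rewrite /uncons /cons_rV row_mxKr; congr pair => /=.
have -> : (0 : 'I_n.+1) = lshift n (0 : 'I_1) by exact/val_inj.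
by rewrite (row_mxEl (a%:M : 'M[R]_1) v 0 0) mxE mulr1n.
Qed.

Let unconsK n : cancel (@uncons n) (@cons_rV n).
Proof.
move=> x; rewrite /uncons /cons_rV /=; apply/rowP => i.
case: (split_ordP (i : 'I_(1 + n))) => j ->.
  rewrite (row_mxEl (_ : 'M[R]_1)) ord1 mxE mulr1n; congr (x _ _).
  exact/val_inj.
by rewrite (row_mxEr (_ : 'M[R]_1)) mxE.
Qed.

Let open_prod_measurable n (U : set (R * 'rV[R]_n)) : open U -> measurable U.
Proof.
move=> oU.
pose bx (i : rat * 'rV[rat]_n * rat) : set (R * 'rV[R]_n) :=
  ball (ratr i.1.1 : R) (ratr i.2) `*`
  ball (map_mx ratr i.1.2 : 'rV[R]_n) (ratr i.2).
have -> : U = \bigcup_(i in [set i | bx i `<=` U]) bx i.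
  apply/seteqP; split=> [[a v] Uav|z [i iU]]; last exact: iU.
  have : nbhs (a, v) U by exact: open_nbhs_nbhs.
  rewrite -nbhs_ballE => -[e /= e0 eU].
  have [k] : exists k : rat, 0 < (ratr k : R) < e / 2.
    have /rat_in_itvoo[k] : 0 < e / 2 by rewrite divr_gt0.
    by rewrite in_itv /= => ?; exists k.
  move=> /andP[k0 ke].
  have rd (x : R) : {q : rat | `|ratr q - x| < ratr k}.
    apply: cid.
    have /rat_in_itvoo[q] : x - ratr k < x + ratr k.
      by rewrite ltrBlDr -addrA ltrDl addr_gt0.
    rewrite in_itv /= => /andP[q1 q2]; exists q.
    by rewrite ltr_distl q1 q2.
  exists (sval (rd a), \row_j sval (rd (v 0 j)), k); last first.
    split; rewrite /=.
      by rewrite /ball /= /ball_ /=; case: (rd a).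
    split => // i j; rewrite !mxE ord1 /ball /= /ball_ /=.
    by case: (rd (v 0 j)).
  move=> [b w] [/= ab vw]; apply: eU; split => /=.
    rewrite (splitr e); apply: (@ball_triangle _ _ (ratr (sval (rd a)) : R)).
      rewrite /ball /= /ball_ /= distrC; case: (rd a) => /= q qa.
      exact: lt_trans ke.
    exact: le_ball (ltW ke) _ ab.
  rewrite (splitr e).
  apply: (@ball_triangle _ _ (map_mx ratr (\row_j sval (rd (v 0 j))) : 'rV[R]_n)).
    split=> [|i j]; first by rewrite divr_gt0.
    rewrite !mxE ord1 /ball /= /ball_ /= distrC; case: (rd (v 0 j)) => /= q qa.
    exact: lt_trans ke.
  exact: le_ball (ltW ke) _ vw.
rewrite bigcup_mkcond; apply: countable_bigcupT_measurable => //.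
move=> i; case: ifPn => // _; apply: measurableX.
  by apply: open_measurable; exact: ball_open.
by apply: open_measurable_mx; exact: ball_open.
Qed.

Let continuous_cons n : continuous (@cons_rV n).
Proof.
move=> -[a v] B /nbhs_ballP[e /= e0 eB]; apply/nbhs_ballP; exists e => //.
move=> [b w] [/= ab vw]; apply: eB; split => // i j; rewrite /cons_rV /=.
case: (split_ordP (j : 'I_(1 + n))) => k ->.
  by rewrite !(row_mxEl (_ : 'M[R]_1)) !ord1 !mxE !mulr1n.
by rewrite !(row_mxEr (_ : 'M[R]_1)) ord1; case: vw.
Qed.

Let measurable_cons n : measurable_fun [set: R * 'rV[R]_n] (@cons_rV n).
Proof.
apply: (@measurability _ _ _ _ _ _ (@open 'rV[R]_n.+1)) => //.
move=> _ [A oA <-]; rewrite setTI; apply: open_prod_measurable.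
by move: A oA; apply/continuousP; exact: continuous_cons.
Qed.

Let measurable_uncons n : measurable_fun [set: 'rV[R]_n.+1] (@uncons n).
Proof.
apply: measurable_fun_pair.
  apply: (measurability _ (RGenOpens.measurableE R)) => //.
  move=> _ [_ [a [b ->]] <-]; rewrite setTI; apply: open_measurable_mx.
  have /continuousP := @coord_continuous R 1 n.+1 0 0.
  by apply; exact: interval_open.
apply: (@measurability _ _ _ _ _ _ (@open 'rV[R]_n)) => //.
move=> _ [A oA <-]; rewrite setTI; apply: open_measurable_mx.
move: A oA; apply/continuousP => x B /nbhs_ballP[e /= e0 eB].
apply/nbhs_ballP; exists e => // y [_ xy]; apply: eB.
by split => // i j; rewrite !mxE; exact: xy.
Qed.

Let lebesgue_rV_measure n :
  exists m : {sigma_finite_measure set 'rV[R]_n -> \bar R}, @lebesgue_rV n = m.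
Proof.
elim: n => [|n [m mE]].
  by exists [the {sigma_finite_measure set _ -> \bar R} of \d_(0 : 'rV[R]_0)].
pose pm := (@lebesgue_measure R \x m)%E.
have E : @lebesgue_rV n.+1 = pushforward pm (@cons_rV n).
  apply/funext => A /=; rewrite /pushforward /pm /= /product_measure1 mE.
  apply: eq_integral => x _ /=; congr (m _).
  by apply/seteqP; split => v; rewrite /xsection /= in_setE.
pose f : {measure set 'rV[R]_n.+1 -> \bar R} :=
  measure_function_pushforward__canonical__measure_function_Measure pm
    (@measurable_cons n).
have sf : sigma_finite setT f.
  have /sigma_finiteP[F [FT ndF mF]] := sigma_finiteT (@lebesgue_measure R).
  have /sigma_finiteP[G [GT ndG mG]] := sigma_finiteT m.
  have mFG k : measurable (F k `*` G k).
    by apply: measurableX; [case: (mF k)|case: (mG k)].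
  exists (fun k => @uncons n @^-1` (F k `*` G k)).
    apply/esym; rewrite -subTset => x _.
    have [i _ Fi] : (\bigcup_i F i) (uncons x).1 by rewrite -FT.
    have [j _ Gj] : (\bigcup_i G i) (uncons x).2 by rewrite -GT.
    exists (maxn i j) => //; split => /=.
      by move: Fi; exact/subsetPset/ndF/leq_maxl.
    by move: Gj; exact/subsetPset/ndG/leq_maxr.
  move=> k; split.
    by rewrite -[X in measurable X]setTI; apply: measurable_uncons; [exact: measurableT|exact: mFG].
  rewrite /f /= /pushforward -comp_preimage.
  have -> : @uncons n \o @cons_rV n = id by apply/funext; exact: consK.
  rewrite preimage_id /pm product_measure1E; [|exact: (mF k).1|exact: (mG k).1].
  have Fk := (mF k).2; have Gk := (mG k).2.
  by rewrite lte_mul_pinfty// ge0_fin_numE.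
by exists (sigma_finite_of sf); rewrite E.
Qed.

Let lebesgue_rV0 n : @lebesgue_rV n set0 = 0%E.
Proof. by have [m ->] := lebesgue_rV_measure n; rewrite measure0. Qed.

Let lebesgue_rV_ge0 n A : (0 <= @lebesgue_rV n A)%E.
Proof. by have [m ->] := lebesgue_rV_measure n; exact: measure_ge0. Qed.

Let lebesgue_rV_sigma_additive n : semi_sigma_additive (@lebesgue_rV n).
Proof.
by have [m ->] := lebesgue_rV_measure n; exact: measure_semi_sigma_additive.
Qed.

HB.instance Definition _ n := isMeasure.Build _ _ _ (@lebesgue_rV n)
  (@lebesgue_rV0 n) (@lebesgue_rV_ge0 n) (@lebesgue_rV_sigma_additive n).

Let lebesgue_rV_sigma_finite n : sigma_finite setT (@lebesgue_rV n).
Proof. by have [m ->] := lebesgue_rV_measure n; exact: sigma_finiteT. Qed.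

HB.instance Definition _ n := Measure_isSigmaFinite.Build _ _ _
  (@lebesgue_rV n) (@lebesgue_rV_sigma_finite n).

Lemma lebesgue_rV_box n (a b : 'rV[R]_n) : (forall i, a 0 i <= b 0 i) ->
  lebesgue_rV [set x | forall i, a 0 i <= x 0 i <= b 0 i] =
  (\prod_i (b 0 i - a 0 i))%:E.
Proof.
elim: n a b => [|n IH] a b ab.
  by rewrite big_ord0 /= diracE mem_set// => -[].
rewrite big_ord_recl /=; pose l := lift (0 : 'I_n.+1).
pose c := \prod_i (b 0 (l i) - a 0 (l i)).
transitivity (\int[@lebesgue_measure R]_(x in `[a 0%R 0%R, b 0%R 0%R]) c%:E)%E; last first.
  rewrite integral_cst//= lebesgue_measure_itv /= lte_fin.
  case: ltgtP (ab 0) => // [_ _|-> _]; first by rewrite -EFinB -EFinM mulrC.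
  by rewrite subrr mul0r mule0.
rewrite [RHS]integral_mkcond; apply: eq_integral => x _ /=.
have cons0 v : cons_rV (x, v) 0 0 = x by have [] := consK (x, v).
have consl v i : cons_rV (x, v) 0 (l i) = v 0 i.
  have -> : l i = rshift 1 i :> 'I_(1 + n) by exact/val_inj.
  by rewrite /cons_rV (row_mxEr (_ : 'M[R]_1)).
rewrite patchE; case: ifPn => [|/negP xab]; last first.
  rewrite (_ : [set v | _] = set0) ?measure0//.
  apply/seteqP; split => v //= /(_ 0); rewrite cons0 => h.
  by apply: xab; rewrite inE /= in_itv.
rewrite inE /= in_itv /= => xab.
have := IH (\row_i a 0 (l i)) (\row_i b 0 (l i)).
rewrite (_ : (\prod_i _) = c); last by apply: eq_bigr => i _; rewrite !mxE.
move=> <-; last by move=> i; rewrite !mxE.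
congr (lebesgue_rV _); apply/seteqP; split => v /= h i.
  by have := h (l i); rewrite consl !mxE.
have [j ->|->] := unliftP 0 i; last by rewrite cons0.
by rewrite consl; have := h j; rewrite !mxE.
Qed.

End lebesgue_rV.

Section smooth_functions.
Variables (R : realType).

(* On a finite-dimensional V this is the usual C^k: all iterated directional
   derivatives of order at most k exist everywhere and are continuous. *)
Fixpoint class_C (V : normedModType R) (k : nat) (f : V -> R) : Prop :=
  match k with
  | 0 => continuous f
  | k'.+1 => continuous f /\
      forall v : V, (forall x, derivable f x v) /\ class_C k' ('D_v f)
  end.

Definition supp (V : topologicalType) (f : V -> R) : set V :=
  closure [set x | f x != 0].

Definition Cc (V : normedModType R) (f : V -> R) : Prop :=
  continuous f /\ compact (supp f).

(* C_c^oo(Omega), each element being extended by zero outside Omega *)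
Definition Cc_infty (V : normedModType R) (Omega : set V) (f : V -> R) : Prop :=
  [/\ forall k, class_C k f, compact (supp f) & supp f `<=` Omega].

End smooth_functions.

Section euclidean.
Variables (R : realType) (d : nat).
Implicit Types x y : 'rV[R]_d.

Definition inner x y : R := \sum_i x 0 i * y 0 i.

(* [`|x|] is the sup norm on 'rV[R]_d. *)
Definition enorm x : R := Num.sqrt (inner x x).

Definition grad (f : 'rV[R]_d -> R) x : 'rV[R]_d :=
  \row_i 'D_(delta_mx 0 i) f x.

Definition sup_norm (f : 'rV[R]_d -> R) : R := sup [set `|f x| | x in setT].

Definition grad_sup_norm (f : 'rV[R]_d -> R) : R :=
  sup [set enorm (grad f x) | x in setT].

End euclidean.

Section radon.
Variables (R : realType) (d : nat).

(* On an open subset of R^d a Borel measure that is finite on compact sets is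
   automatically regular. *)
Definition radon_on (Omega : set 'rV[R]_d)
    (mu : {measure set 'rV[R]_d -> \bar R}) : Prop :=
  forall K, compact K -> K `<=` Omega -> (mu K < +oo)%E.

End radon.

Section levy.
Variables (R : realType) (d : nat).
Variable nu : {measure set 'rV[R]_d -> \bar R}.

(* A measure on R^d \ {0} is identified with its extension by zero, that is,
   with a measure on R^d which does not charge the origin. *)
Definition symmetric_levy_measure : Prop :=
  [/\ nu [set 0] = 0%E,
      radon_on [set~ 0] nu,
      forall B, measurable B -> nu B = nu (-%R @` B) &
      (\int[nu]_y (Num.min 1 (enorm y ^+ 2))%:E < +oo)%E].

Definition levy_op (v : 'rV[R]_d -> R) (x : 'rV[R]_d) : R :=
  \int[nu]_y (v x - (v (x + y) + v (x - y)) / 2).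

Definition levy_form (v w : 'rV[R]_d -> R) (x : 'rV[R]_d) : R :=
  \int[nu]_y ((v x - v (x - y)) * (w x - w (x - y))).

Definition levy_exponent (xi : 'rV[R]_d) : R :=
  \int[nu]_y (1 - cos (inner xi y)).

Definition char_fun (p : probability 'rV[R]_d R) (xi : 'rV[R]_d) : R[i] :=
  ((\int[p]_x cos (inner xi x)) +i* (\int[p]_x sin (inner xi x)))%C.

Definition levy_law (t : R) (p : probability 'rV[R]_d R) : Prop :=
  forall xi, char_fun p xi = (expR (- (t * levy_exponent xi)))%:C%C.

Definition heat_kernel (P : R -> 'rV[R]_d -> R) : Prop :=
  forall t, 0 < t ->
    (@lebesgue_rV R d).-integrable setT (EFin \o P t) /\
    exists2 p : probability 'rV[R]_d R, levy_law t p &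
      forall A, measurable A ->
        p A = (\int[@lebesgue_rV R d]_(x in A) (P t x)%:E)%E.

End levy.

Section very_weak_solutions.
Variables (R : realType) (d : nat).
Implicit Types u : 'rV[R]_d * R -> R.

Notation leb := (@lebesgue_rV R d).

Definition space_time_measure : set ('rV[R]_d * measurableTypeR R) -> \bar R :=
  (leb \x @lebesgue_measure R)%E.

Definition cylinder (T : R) : set ('rV[R]_d * R) := setT `*` `]0, T[.

Definition L1loc (T : R) u : Prop :=
  forall K : set ('rV[R]_d * R), compact K -> K `<=` cylinder T ->
    space_time_measure.-integrable K (EFin \o u).

Definition L1loc_weighted (w : 'rV[R]_d -> R) (T : R) u : Prop :=
  forall e T', 0 < e -> e < T' -> T' < T ->
    (\int[@lebesgue_measure R]_(t in `[e, T']) \int[leb]_x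
       (`|u (x, t)| * w x)%:E < +oo)%E.

Definition very_weak_solution (nu : {measure set 'rV[R]_d -> \bar R}) (T : R)
    u : Prop :=
  L1loc T u /\
  forall theta : 'rV[R]_d * R -> R, Cc_infty (cylinder T) theta ->
    let Ltheta x t := levy_op nu (fun z => theta (z, t)) x in
    let dt_theta x t := derive1 (fun s => theta (x, s)) t in
    (\int[@lebesgue_measure R]_(t in `]0%R, T[) \int[leb]_x
       (`|u (x, t)| * `|Ltheta x t|)%:E < +oo)%E /\
    (\int[@lebesgue_measure R]_(t in `]0%R, T[) \int[leb]_x
       (u (x, t) * (dt_theta x t - Ltheta x t))%:E = 0)%E.

Definition ae_nonneg (T : R) u : Prop :=
  {ae space_time_measure, forall z, cylinder T z -> 0 <= u z}.

(* ess lim_{t -> 0+} g(t) = l: convergence away from some null set of times *)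
Definition ess_lim0 (g : R -> \bar R) (l : \bar R) : Prop :=
  exists2 N : set (measurableTypeR R), (@lebesgue_measure R).-negligible N &
    g @ within (~` N) 0^'+ --> l.

Definition initial_trace u (mu0 : {measure set 'rV[R]_d -> \bar R}) : Prop :=
  forall psi : 'rV[R]_d -> R, Cc psi ->
    ess_lim0 (fun t => \int[leb]_x (psi x * u (x, t))%:E)%E
             (\int[mu0]_x (psi x)%:E)%E.

End very_weak_solutions.

(* Main.v *)
Require Import Defs.
From HB Require Import structures.
From mathcomp Require Import all_boot all_order all_algebra.
From mathcomp Require Import all_classical all_reals all_analysis.
From mathcomp Require Import measurable_realfun ring lra.

Set Implicit Arguments.
Unset Strict Implicit.
Unset Printing Implicit Defensive.

Import Order.TTheory GRing.Theory Num.Theory.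
Import numFieldNormedType.Exports.

Local Open Scope classical_set_scope.
Local Open Scope ring_scope.

(** Write [a f t] for the integral of [f(x) u(x, t)] over [x]. Testing the equation
    with products [f(x) eta(t)] gives, for smooth [f] with compact support, the weak
    identity [(a f)' = - a (L f)], hence the increments
    [a f s - a f t = int_s^t a (L f)] for almost all [s < t]
    ([weak_formulation_pairing], [weak_derivative_increment]). Everything rests on
    bounding [a f] near time zero, and the weight [phi] is made for that: if
    [|L f| <= C phi], the right-hand side is at most [C] times the integral of the
    mass [m = a phi].

    The mass itself is reached through the truncations [chi_n phi], where [chi_n] is
    a smooth cutoff dilated by [n]. By the product rule
    [L (chi phi) = chi L phi + phi L chi - B(chi, phi)], the hypotheses on [L phi]
    and on [B] give [|L (chi_n phi)| <= C phi] with [C] independent of [n]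
    ([levy_op_cutoff_bound]), so that [m s <= m t + C int_s^t m]
    ([mass_increment]). On a time interval of length at most [1 / (2 C)] this
    inequality absorbs the integral, and [m] is essentially bounded near zero
    ([mass_bounded]).

    For a compactly supported [f] of class C^2, [L f] is also dominated by [phi],
    although it decays only as fast as the tail of [nu]: away from the support,
    [L f(x)] is an average of [f(x + y)] over jumps [y] that are not small, and the
    average of [phi] over such jumps is bounded by a multiple of [phi(x)], which is
    the bound on [B] tested with bumps vanishing near [x] ([far_average],
    [levy_op_dominated]). With bounded mass, [a f] is then Lipschitz near time zero
    for smooth [f], and has an essential limit; uniform approximation extends this to
    all continuous [f] with compact support. Since [phi] is merely C^2, the increments
    are first extended from smooth functions by mollification ([pairing_increment]),
    which preserves the bounds on second differences through which the Lévy operator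
    is controlled ([second_diff_bound], [levy_op_cvg]).

    The essential limits define a positive linear functional, represented by a Radon
    measure ([riesz_representation]); testing it with [chi_n phi] and letting [n] grow
    bounds the integral of [phi], hence that of [P 1 <= c phi], by the bound on the
    mass. *)

(** * Differential calculus of the classes C^k *)

Section class_C_calculus.
Variable R : realType.
Implicit Types V W : normedModType R.

Lemma class_C_cont V k (f : V -> R) : class_C k f -> continuous f.
Proof. by case: k => //= k []. Qed.

Lemma class_CS V k (f : V -> R) : class_C k.+1 f -> class_C k f.
Proof.
elim: k f => [f [] //|k IH f [cf df]]; split => // v.
by have [dv] := df v; split => //; exact: IH.
Qed.

Lemma class_C_cst V k (a : R) : class_C k (cst a : V -> R).
Proof.
elim: k a => [|k IH] a /=; first exact: cst_continuous.
split => [|v]; first exact: cst_continuous.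
split => [x|]; first exact: derivable_cst.
rewrite (_ : 'D_v _ = cst 0) //.
by apply/funext => x; rewrite derive_cst.
Qed.

Lemma class_CD V k (f g : V -> R) :
  class_C k f -> class_C k g -> class_C k (fun x => f x + g x).
Proof.
elim: k f g => [|k IH] f g /=.
  by move=> cf cg x; apply: cvgD; [exact: cf|exact: cg].
move=> [cf df] [cg dg]; split => [x|v].
  by apply: cvgD; [exact: cf|exact: cg].
have [dfv Cf] := df v; have [dgv Cg] := dg v.
split => [x|]; first exact: derivableD.
rewrite (_ : 'D_v _ = fun x => 'D_v f x + 'D_v g x); first exact: IH.
by apply/funext => x; rewrite -deriveD.
Qed.

Lemma class_CM V k (f g : V -> R) :
  class_C k f -> class_C k g -> class_C k (fun x => f x * g x).
Proof.
elim: k f g => [|k IH] f g.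
  by move=> cf cg x; apply: cvgM; [exact: cf|exact: cg].
move=> Cf0 Cg0; have [cf df] := Cf0; have [cg dg] := Cg0.
split => [x|v]; first by apply: cvgM; [exact: cf|exact: cg].
have [dfv Cf] := df v; have [dgv Cg] := dg v.
split => [x|]; first exact: derivableM.
rewrite (_ : 'D_v _ = fun x => f x * 'D_v g x + g x * 'D_v f x).
  by apply: class_CD; apply: IH => //; exact: class_CS.
by apply/funext => x; rewrite deriveM.
Qed.

Lemma class_CV V k (f : V -> R) : (forall x, f x != 0) ->
  class_C k f -> class_C k (fun x => (f x)^-1).
Proof.
move=> f0; have cV : continuous f -> continuous (fun x => (f x)^-1).
  by move=> cf x; apply: cvgV => //; exact: cf.
elim: k => [|k IH]; first exact: cV.
move=> Cf; have [cf df] := Cf; split => [|v]; first exact: cV.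
have [dfv Cfv] := df v.
split => [x|]; first exact: derivableV.
have CV := IH (class_CS Cf).
rewrite (_ : 'D_v _ = fun x => -1 * ((f x)^-1 * (f x)^-1 * 'D_v f x)).
  apply: class_CM; first exact: class_C_cst.
  by apply: class_CM => //; exact: class_CM.
apply/funext => x; rewrite deriveV//= /GRing.scale /= mulN1r mulNr.
by rewrite -exprVn expr2.
Qed.

(** No chain rule is involved: the difference quotients of [f \o L] along [v] are
    those of [f] along [L' v]. *)
Lemma class_C_affine V W k (f : W -> R) (L : V -> W) (L' : V -> W) :
  continuous L -> (forall x v h, L (h *: v + x) = h *: L' v + L x) ->
  class_C k f -> class_C k (f \o L).
Proof.
move=> cL LE; elim: k f => [|k IH] f.
  by move=> cf x; apply: continuous_comp; [exact: cL|exact: cf].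
move=> [cf df]; split => [x|v]; first by apply: continuous_comp; [exact: cL|exact: cf].
have [dfv Cfv] := df (L' v).
have E x : (fun h : R => h^-1 *: ((f \o L) (h *: v + x) - (f \o L) x)) =
           (fun h : R => h^-1 *: (f (h *: L' v + L x) - f (L x))).
  by apply/funext => h /=; rewrite LE.
split => [x|].
  have := dfv (L x); rewrite /derivable /=.
  by rewrite -E.
rewrite (_ : 'D_v _ = 'D_(L' v) f \o L); first exact: IH.
by apply/funext => x; rewrite /derive /= -E.
Qed.

Lemma class_C_prod V k (I : Type) (s : seq I) (F : I -> V -> R) :
  (forall i, class_C k (F i)) -> class_C k (fun x => \prod_(i <- s) F i x).
Proof.
move=> CF; elim: s => [|i s IH].
  have -> : (fun x => \prod_(i <- [::]) F i x) = cst 1.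
    by apply/funext => x; rewrite big_nil.
  exact: class_C_cst.
have -> : (fun x => \prod_(j <- i :: s) F j x) =
          fun x => F i x * \prod_(j <- s) F j x.
  by apply/funext => x; rewrite big_cons.
exact: class_CM.
Qed.

End class_C_calculus.

(** * Compactly supported functions on R^d *)

Section row_norm.
Variables (R : realType) (d : nat).
Implicit Types x y : 'rV[R]_d.

Lemma coord_le_norm x i : `|x 0 i| <= `|x|.
Proof.
rewrite [leRHS]/Num.norm /= mx_normrE; apply/bigmax_geP; right => /=.
by exists (0, i).
Qed.

Lemma norm_le_coord x (r : R) : 0 <= r -> (forall i, `|x 0 i| <= r) -> `|x| <= r.
Proof.
move=> r0 h; rewrite [leLHS]/Num.norm /= mx_normrE; apply/bigmax_leP; split => //.
by move=> [i j] _ /=; rewrite ord1.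
Qed.

Lemma norm_gt_coord x (r : R) : 0 <= r -> r < `|x| -> exists i, r < `|x 0 i|.
Proof.
move=> r0; apply: contraPP => /forallNP h; apply/negP; rewrite -leNgt.
by apply: norm_le_coord => // i; rewrite leNgt; apply/negP.
Qed.

Lemma coord_le_enorm x i : `|x 0 i| <= enorm x.
Proof.
rewrite /enorm -sqrtr_sqr ler_wsqrtr// /inner (bigD1 i)//= expr2 lerDl.
by apply: sumr_ge0 => j _; rewrite -expr2 sqr_ge0.
Qed.

Lemma enorm_ge0 x : 0 <= enorm x. Proof. exact: sqrtr_ge0. Qed.

Lemma norm_le_enorm x : `|x| <= enorm x.
Proof. by apply: norm_le_coord => [|i]; [exact: enorm_ge0|exact: coord_le_enorm]. Qed.

Lemma enorm_le_bound x (K : R) : 0 <= K -> (forall i, `|x 0 i| <= K) ->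
  enorm x <= d%:R * K.
Proof.
move=> K0 xK; have dK0 : 0 <= d%:R * K by rewrite mulr_ge0.
rewrite -[leRHS]ger0_norm// -sqrtr_sqr ler_wsqrtr//.
have : inner x x <= d%:R * K ^+ 2.
  rewrite -[d in leRHS]card_ord mulr_natl -sumr_const.
  apply: ler_sum => i _; rewrite -expr2 -real_normK ?num_real//.
  by rewrite lerXn2r// nnegrE.
move=> /le_trans; apply; rewrite exprMn ler_wpM2r ?sqr_ge0//.
by rewrite -natrX ler_nat; case: (d) => // n; rewrite -mulnn leq_pmull.
Qed.

(** The function against which a Lévy measure is finite. *)
Definition levy_weight (y : 'rV[R]_d) : R := Num.min 1 (enorm y ^+ 2).

Lemma levy_weight_ge0 y : 0 <= levy_weight y.
Proof. by rewrite /levy_weight le_min ler01 sqr_ge0. Qed.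

Lemma levy_weight_far y : 1 <= `|y| -> levy_weight y = 1.
Proof.
move=> y1; apply/min_idPl; rewrite expr_ge1//; last exact: enorm_ge0.
exact: le_trans (norm_le_enorm _).
Qed.

Lemma levy_weight_near y (r : R) : 1 <= r -> `|y| <= r ->
  `|y| ^+ 2 <= r ^+ 2 * levy_weight y.
Proof.
move=> r1 yr; have r0 : 0 <= r by exact: le_trans r1.
rewrite /levy_weight; case: (leP 1 (enorm y ^+ 2)) => [_|_].
  by rewrite mulr1 lerXn2r// nnegrE.
apply: (@le_trans _ _ (enorm y ^+ 2)).
  by rewrite lerXn2r ?nnegrE ?enorm_ge0// norm_le_enorm.
by rewrite ler_peMl ?sqr_ge0// expr_ge1.
Qed.

Lemma levy_weight_le_sqr y (K : R) : 0 <= K ->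
  forall a : R, a <= K -> a <= K * `|y| ^+ 2 -> a <= K * levy_weight y.
Proof.
move=> K0 a aK aKy; rewrite /levy_weight minEle.
case: ifP => _; first by rewrite mulr1.
apply: (le_trans aKy); rewrite ler_wpM2l//.
by rewrite lerXn2r ?nnegrE ?enorm_ge0// norm_le_enorm.
Qed.

End row_norm.

Section compact_support.
Variables (R : realType).

(** Compact support with an explicit radius, which convolution and dilation
    transform in a controlled way. *)
Definition vanishes_off (V : normedModType R) (r : R) (f : V -> R) :=
  forall x, r < `|x| -> f x = 0.

Lemma vanishes_offM (V : normedModType R) r (f g : V -> R) :
  vanishes_off r f -> vanishes_off r (fun x => f x * g x).
Proof. by move=> f0 x /f0 ->; rewrite mul0r. Qed.

Lemma vanishes_off_derive (V : normedModType R) r (f : V -> R) v :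
  vanishes_off r f -> vanishes_off r ('D_v f).
Proof.
move=> f0 x rx; rewrite -[RHS](derive_cst (0 : R) x v).
apply: near_eq_derive.
have : `|x| \in `]r, +oo[ by rewrite in_itv /= rx.
move=> /(@near_in_itvoy R r) h.
have /= cn := @norm_continuous R V x.
have := cn _ h; rewrite /nbhs /=.
by apply: filterS => y /=; rewrite in_itv /= andbT => /f0.
Qed.

Lemma Cc_vanishes_off (V : normedModType R) (f : V -> R) :
  compact (supp f) -> exists2 r : R, 0 <= r & vanishes_off r f.
Proof.
move=> /compact_bounded[M [_ h]].
exists (`|M| + 1) => [|x xM]; first by rewrite addr_ge0.
apply/eqP/negPn/negP => fx0.
have : `|x| <= `|M| + 1.
  apply: (h (`|M| + 1)); first by rewrite (le_lt_trans (ler_norm _)) ?ltrDl.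
  exact: subset_closure.
by rewrite leNgt xM.
Qed.

Lemma closed_ball_norm (V : normedModType R) (r : R) : closed [set x : V | `|x| <= r].
Proof.
apply: (@closed_comp V R (fun x => `|x|) [set s | s <= r]).
  by move=> x _; exact: norm_continuous.
exact: closed_le.
Qed.

Lemma vanishes_off_supp (V : normedModType R) (f : V -> R) (r : R) :
  vanishes_off r f -> supp f `<=` [set x | `|x| <= r].
Proof.
move=> f0; have := @closed_ball_norm V r; rewrite closure_id => ->.
apply: closure_subset => x /=; apply: contraNT; rewrite -ltNge => /f0 ->.
by rewrite eqxx.
Qed.

Lemma compact_ball_rV (d : nat) (r : R) : compact [set x : 'rV[R]_d | `|x| <= r].
Proof.
apply: bounded_closed_compact; last exact: closed_ball_norm.
exists r; split; first exact: num_real.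
by move=> M rM x /= xr; apply: (le_trans xr); exact: ltW.
Qed.

Lemma vanishes_off_compact (d : nat) (f : 'rV[R]_d -> R) (r : R) :
  vanishes_off r f -> compact (supp f).
Proof.
move=> f0; apply: subclosed_compact (@compact_ball_rV d r) _.
  exact: closed_closure.
exact: vanishes_off_supp.
Qed.

Lemma vanishes_off_bounded (d : nat) (f : 'rV[R]_d -> R) (r : R) :
  continuous f -> vanishes_off r f ->
  exists2 M : R, 0 <= M & forall x, `|f x| <= M.
Proof.
move=> cf f0.
have : bounded_set (f @` [set x | `|x| <= r]).
  apply: compact_bounded; apply: continuous_compact (@compact_ball_rV d r).
  exact: continuous_subspaceT.
move=> [M [_ h]]; exists (`|M| + 1) => [|x]; first by rewrite addr_ge0.
have [rx|xr] := ltP r `|x|; first by rewrite f0// normr0 addr_ge0.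
by apply: (h (`|M| + 1)); [rewrite (le_lt_trans (ler_norm _)) ?ltrDl|exists x].
Qed.

End compact_support.

Section lipschitz.
Variables (R : realType).

Lemma derivable_line (V : normedModType R) (f : V -> R) p v (s : R) :
  derivable f (s *: v + p) v ->
  is_derive s 1 (fun t => f (t *: v + p)) ('D_v f (s *: v + p)).
Proof.
have E : (fun h : R => h^-1 *: (f ((h *: 1 + s) *: v + p) - f (s *: v + p))) =
         (fun h : R => h^-1 *: (f (h *: v + (s *: v + p)) - f (s *: v + p))).
  by apply/funext => h /=; rewrite scalerDl -addrA /GRing.scale /= mulr1.
move=> df; apply: DeriveDef.
  by rewrite /derivable /= E.
by rewrite /derive /= E.
Qed.

Lemma line_mvt (V : normedModType R) (f : V -> R) p v (a : R) :
  (forall x, derivable f x v) ->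
  exists2 c : R, `|c| <= `|a| & f (a *: v + p) - f p = 'D_v f (c *: v + p) * a.
Proof.
move=> df; pose g t := f (t *: v + p).
have dg (t : R) : is_derive t (1 : R) g ('D_v f (t *: v + p)).
  exact: derivable_line.
have cg : continuous g.
  by move=> t; apply/differentiable_continuous/derivable1_diffP; case: (dg t).
have g0 : f p = g 0 by rewrite /g scale0r add0r.
have [a0|a0] := leP 0 a.
  have [c] := MVT_segment a0 (fun x _ => dg x) (continuous_subspaceT cg).
  rewrite in_itv /= subr0 => /andP[c0 ca] E; exists c.
    by rewrite !ger0_norm.
  by rewrite g0 -E.
have [c] := MVT_segment (ltW a0) (fun x _ => dg x) (continuous_subspaceT cg).
rewrite in_itv /= sub0r => /andP[c0 ca] E; exists c.
  by rewrite !ler0_norm ?lerN2// ltW.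
by rewrite g0 -[LHS]opprB E mulrN opprK.
Qed.

(** Moving one coordinate at a time, only the partial derivatives matter. *)
Lemma partials_lipschitz (d : nat) (f : 'rV[R]_d -> R) (K : R) : 0 <= K ->
  (forall i x, derivable f x (delta_mx 0 i)) ->
  (forall i x, `|'D_(delta_mx 0 i) f x| <= K) ->
  forall x y, `|f x - f y| <= d%:R * K * `|x - y|.
Proof.
move=> K0 df Df x y.
pose P k : 'rV[R]_d := \row_i (if (i < k)%N then x 0 i else y 0 i).
have P0 : P 0%N = y by apply/rowP => i; rewrite mxE.
have Pd : P d = x by apply/rowP => i; rewrite mxE ltn_ord.
suff h k : (k <= d)%N -> `|f (P k) - f (P 0%N)| <= k%:R * K * `|x - y|.
  by have := h d (leqnn _); rewrite Pd P0.
elim: k => [|k IH] kd; first by rewrite subrr normr0 !mul0r.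
have -> : f (P k.+1) - f (P 0%N) =
  (f (P k.+1) - f (P k)) + (f (P k) - f (P 0%N)) by ring.
apply: (le_trans (ler_normD _ _)).
have -> : k.+1%:R * K * `|x - y| = K * `|x - y| + k%:R * K * `|x - y|.
  by rewrite -natr1; ring.
apply: lerD; last exact: (IH (ltnW kd)).
pose i := Ordinal kd.
have -> : P k.+1 = (x 0 i - y 0 i) *: delta_mx 0 i + P k.
  apply/rowP => j; rewrite !mxE eqxx /=.
  have [->|ji] := eqVneq j i; first by rewrite ltnS leqnn ltnn mulr1 subrK.
  rewrite mulr0 add0r ltnS leq_eqVlt (_ : (nat_of_ord j == k) = false)//.
  by apply/negbTE; apply: contra ji => /eqP jk; apply/eqP/val_inj.
have [c _ ->] := line_mvt (P k) (x 0 i - y 0 i) (df i).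
rewrite normrM ler_pM//.
by have := coord_le_norm (x - y) i; rewrite !mxE.
Qed.

Lemma C1_lipschitz (d : nat) (f : 'rV[R]_d -> R) (r : R) :
  class_C 1 f -> vanishes_off r f ->
  exists2 K : R, 0 <= K & forall x y, `|f x - f y| <= K * `|x - y|.
Proof.
move=> [cf df] f0.
have /choice[M hM] (i : 'I_d) : exists M : R,
    0 <= M /\ forall x, `|'D_(delta_mx 0 i) f x| <= M.
  have [_ cD] := df (delta_mx 0 i).
  have [M M0 h] := vanishes_off_bounded cD (vanishes_off_derive _ f0).
  by exists M.
have S0 : 0 <= \sum_i M i by apply: sumr_ge0 => i _; case: (hM i).
exists (d%:R * \sum_i M i) => [|x y]; first by rewrite mulr_ge0.
apply: partials_lipschitz => // [i z|i z]; first by case: (df (delta_mx 0 i)).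
apply: (le_trans ((hM i).2 z)); rewrite (bigD1 i)//= lerDl.
by apply: sumr_ge0 => j _; case: (hM j).
Qed.

Definition second_diff (d : nat) (f : 'rV[R]_d -> R) (x y : 'rV[R]_d) : R :=
  f x - (f (x + y) + f (x - y)) / 2.

(** The size of a function as seen by a Lévy operator: this bound is what
    mollification and dilation preserve. *)
Definition second_diff_bound (d : nat) (M : R) (f : 'rV[R]_d -> R) :=
  forall x y, `|second_diff f x y| <= M * levy_weight y.

(** Up to sign, the second difference is half of the increment, over the step [y],
    of the function [z |-> f z - f (z - y)], whose partial derivatives are at most a
    multiple of [|y|]. *)
Lemma C2_second_diff_sqr (d : nat) (f : 'rV[R]_d -> R) (r : R) :
  class_C 2 f -> vanishes_off r f ->
  exists2 M : R, 0 <= M & forall x y, `|second_diff f x y| <= M * `|y| ^+ 2.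
Proof.
move=> Cf f0; have [cf df] := Cf.
have /choice[K hK] (i : 'I_d) : exists K : R, 0 <= K /\ forall x y,
    `|'D_(delta_mx 0 i) f x - 'D_(delta_mx 0 i) f y| <= K * `|x - y|.
  have [_ C1] := df (delta_mx 0 i).
  have [K K0 h] := C1_lipschitz C1 (vanishes_off_derive _ f0).
  by exists K.
pose S := \sum_i K i.
have S0 : 0 <= S by apply: sumr_ge0 => i _; case: (hK i).
exists (d%:R * S) => [|x y]; first by rewrite mulr_ge0.
pose G z := f z - f (z - y).
have dsh i z : derivable (fun z => f (z - y)) z (delta_mx 0 i) /\
    'D_(delta_mx 0 i) (fun z => f (z - y)) z = 'D_(delta_mx 0 i) f (z - y).
  have E : (fun h : R => h^-1 *: (f (h *: delta_mx 0 i + z - y) - f (z - y))) =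
           (fun h : R => h^-1 *: (f (h *: delta_mx 0 i + (z - y)) - f (z - y))).
    by apply/funext => h; rewrite addrA.
  have [+ _] := df (delta_mx 0 i) => /(_ (z - y)) D; split.
    by rewrite /derivable /= E.
  by rewrite /derive /= E.
have dG i z : derivable G z (delta_mx 0 i).
  by apply: derivableB; [case: (df (delta_mx 0 i))|case: (dsh i z)].
have DG i z : `|'D_(delta_mx 0 i) G z| <= S * `|y|.
  rewrite deriveB; [|by case: (df (delta_mx 0 i))|by case: (dsh i z)].
  rewrite (dsh i z).2; apply: (le_trans ((hK i).2 _ _)).
  rewrite opprB addrC subrK ler_wpM2r// /S (bigD1 i)//= lerDl.
  by apply: sumr_ge0 => j _; case: (hK j).
have := partials_lipschitz (mulr_ge0 S0 (normr_ge0 y)) dG DG (x + y) x.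
rewrite [x + y - x]addrAC subrr add0r /G addrK => h.
have -> : second_diff f x y = - ((f (x + y) - f x - (f x - f (x - y))) / 2).
  by rewrite /second_diff; field.
rewrite normrN normrM [`|2^-1|]ger0_norm ?invr_ge0//.
rewrite ler_pdivrMr//; apply: (le_trans h).
have -> : d%:R * (S * `|y|) * `|y| = d%:R * S * `|y| ^+ 2 by ring.
by rewrite ler_peMr ?mulr_ge0// ler1n.
Qed.

Lemma second_diff_le (d : nat) (f : 'rV[R]_d -> R) M :
  (forall x, `|f x| <= M) -> forall x y, `|second_diff f x y| <= 2 * M.
Proof.
move=> fM x y; rewrite /second_diff; have := fM x; have := fM (x + y).
have := fM (x - y); rewrite !ler_norml => /andP[? ?] /andP[? ?] /andP[? ?].
by apply/andP; split; lra.
Qed.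

Lemma C2_second_diff_bound (d : nat) (f : 'rV[R]_d -> R) (r : R) :
  class_C 2 f -> vanishes_off r f ->
  exists2 M : R, 0 <= M & (forall x, `|f x| <= M) /\ second_diff_bound M f.
Proof.
move=> Cf f0.
have [B B0 hB] := vanishes_off_bounded (class_C_cont Cf) f0.
have [M M0 hM] := C2_second_diff_sqr Cf f0.
exists (M + 2 * B); first by rewrite addr_ge0// mulr_ge0.
split=> [x|x y]; first by apply: (le_trans (hB x)); lra.
apply: levy_weight_le_sqr; first by rewrite addr_ge0// mulr_ge0.
  by apply: (le_trans (second_diff_le hB x y)); lra.
apply: (le_trans (hM x y)); rewrite ler_wpM2r ?sqr_ge0//; lra.
Qed.

End lipschitz.

(** * Smooth cutoffs *)

Section smooth_step.
Variable R : realType.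

(** A quadratic remainder identifies the derivative without any manipulation of
    limits; it serves both at the flat point of [exp_germ] and for convolutions. *)
Lemma is_derive_sqr_bound (V : normedModType R) (f : V -> R) (x v : V) (l C : R) :
  (forall h : R, `|f (h *: v + x) - f x - h * l| <= C * h ^+ 2) ->
  is_derive x v f l.
Proof.
move=> H.
have C0 : 0 <= C.
  by have := H 1; rewrite expr1n mulr1; exact: le_trans.
have C1 : 0 < C + 1 by rewrite ltr_wpDl.
have cvl : h^-1 *: (f (h *: v + x) - f x) @[h --> (0 : R)^'] --> l.
  apply/cvgrPdist_le => e e0; near=> h.
  have h0 : h != 0 by near: h; exact: nbhs_dnbhs_neq.
  have hn0 : 0 < `|h| by rewrite normr_gt0.
  have -> : l - h^-1 *: (f (h *: v + x) - f x) =
            - (h^-1 * (f (h *: v + x) - f x - h * l)).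
    by rewrite /GRing.scale /=; field.
  rewrite normrN normrM normfV ler_pdivrMl//.
  apply: (le_trans (H h)); rewrite -real_normK ?num_real// expr2.
  rewrite mulrCA ler_wpM2l//.
  apply: (@le_trans _ _ ((C + 1) * `|h|)); first by rewrite ler_wpM2r// lerDl.
  rewrite -ler_pdivlMl//; near: h; apply: dnbhs0_le.
  by rewrite mulr_gt0// invr_gt0.
apply: DeriveDef; first by apply/cvg_ex; exists l.
exact: cvg_lim cvl.
Unshelve. all: by end_near. Qed.

Lemma class_C_real k (f f' : R -> R) :
  (forall x : R, is_derive x (1 : R) f (f' x)) -> class_C k f' -> class_C k.+1 f.
Proof.
move=> df Cf'.
have Df x : differentiable f x by apply/derivable1_diffP; case: (df x).
split => [x|v]; first exact: differentiable_continuous.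
split => [x|]; first exact: diff_derivable.
rewrite (_ : 'D_v f = fun x => v * f' x).
  by apply: class_CM => //; exact: class_C_cst.
apply/funext => x; rewrite deriveE// diff1E// derive1E.
by case: (df x) => _ ->.
Qed.

(** The functions [p(1/x) exp(-1/x)], extended by zero: a family stable under
    differentiation, hence consisting of smooth functions. *)
Definition exp_germ (p : {poly R}) (x : R) : R :=
  if 0 < x then p.[x^-1] * expR (- x^-1) else 0.

Lemma poly_expRN_bound (p : {poly R}) :
  exists C : R, forall s, 0 < s -> `|p.[s] * expR (- s)| <= C.
Proof.
exists (\sum_(i < size p) `|p`_i| * i`!%:R) => s s0.
rewrite horner_coef mulr_suml; apply: (le_trans (ler_norm_sum _ _ _)).
apply: ler_sum => i _; rewrite !normrM -mulrA ler_wpM2l//.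
rewrite normrX (ger0_norm (ltW s0)) ger0_norm ?expR_ge0//.
rewrite expRN ler_pdivrMr ?expR_gt0// mulrC -ler_pdivrMr ?ltr0n ?fact_gt0//.
case: (nat_of_ord i) => [|j]; first by rewrite fact0 expr0 divr1 -expR0 ler_expR ltW.
by apply: le_trans (expR_ge1Dxn j (ltW s0)); rewrite lerDr.
Qed.

Lemma is_derive_exp_germ (p : {poly R}) (x : R) :
  is_derive x (1 : R) (exp_germ p) (exp_germ ('X^2 * (p - p^`())) x).
Proof.
have [x0|x0|->] := ltgtP x 0.
- rewrite /exp_germ ltNge ltW//=.
  have : {near x, cst 0 =1 exp_germ p}.
    near=> y; rewrite /exp_germ /= ifF//; apply/negbTE; rewrite -leNgt.
    by near: y; have := lt_nbhsl x0; apply: filterS => z; exact: ltW.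
  by move/near_eq_is_derive; apply; exact: is_derive_cst.
- have : {near x, (fun y => p.[y^-1] * expR (- y^-1)) =1 exp_germ p}.
    by near=> y; rewrite /exp_germ ifT//; near: y; exact: lt_nbhsr.
  move/near_eq_is_derive; apply.
  rewrite /exp_germ x0.
  have x1 : x != 0 by rewrite gt_eqF.
  have dV : is_derive x (1 : R) (fun y => y^-1) (- x ^- 2).
    apply: DeriveDef; first exact: derivableV.
    by rewrite deriveV// derive_id /GRing.scale /= mulr1.
  have d1 : is_derive x (1 : R) (fun y => p.[y^-1]) (p^`().[x^-1] * - x ^- 2).
    apply: (@is_derive1_comp _ (horner p) (fun y => y^-1)) => //.
  have d2 : is_derive x (1 : R) (fun y => expR (- y^-1)) (expR (- x^-1) * x ^- 2).
    apply: (@is_derive1_comp _ expR (fun y => - y^-1)) => //.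
    by rewrite -(opprK (x ^- 2)); exact: is_deriveN.
  apply: is_derive_eq; rewrite /GRing.scale /= hornerM hornerXn hornerD hornerN.
  by field.
- have [C HC] := poly_expRN_bound ('X^2 * p).
  rewrite /exp_germ ltxx; apply: (@is_derive_sqr_bound _ _ _ _ _ C) => h.
  rewrite /GRing.scale /= mulr1 addr0 ltxx mulr0 !subr0; case: ifPn => [h0|_]; last first.
    rewrite normr0 mulr_ge0 ?sqr_ge0//.
    by have := HC 1 ltr01; exact: le_trans.
  have := HC h^-1; rewrite invr_gt0 => /(_ h0) hC.
  rewrite -ler_pdivrMr ?exprn_gt0//; apply: le_trans hC.
  rewrite -[X in _ / X]ger0_norm ?sqr_ge0// -normfV -normrM.
  rewrite hornerM hornerXn exprVn le_eqVlt; apply/orP; left; apply/eqP.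
  by congr `|_|; rewrite mulrC mulrA.
Unshelve. all: by end_near. Qed.

End smooth_step.

Section cutoffs.
Variable R : realType.

Lemma class_C_exp_germ k (p : {poly R}) : class_C k (exp_germ p).
Proof.
elim: k p => [|k IH] p.
  move=> x; apply/differentiable_continuous/derivable1_diffP.
  by case: (is_derive_exp_germ p x).
exact: class_C_real (is_derive_exp_germ p) (IH _).
Qed.

Definition exp_bump (x : R) : R := exp_germ 1 x.

Lemma exp_bump_ge0 x : 0 <= exp_bump x.
Proof.
by rewrite /exp_bump /exp_germ; case: ifP => // _; rewrite hornerC mul1r expR_ge0.
Qed.

Lemma exp_bump_gt0 x : 0 < x -> 0 < exp_bump x.
Proof. by move=> x0; rewrite /exp_bump /exp_germ x0 hornerC mul1r expR_gt0. Qed.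

Lemma exp_bump0 x : x <= 0 -> exp_bump x = 0.
Proof. by move=> x0; rewrite /exp_bump /exp_germ ltNge x0. Qed.

Lemma class_C_exp_bump_affine k (a b : R) :
  class_C k (fun x : R => exp_bump (a * x + b)).
Proof.
apply: (@class_C_affine _ R R k exp_bump (fun x => a * x + b) (fun v => a * v)).
- move=> x; apply: cvgD; last exact: cvg_cst.
  by apply: cvgM; [exact: cvg_cst|exact: cvg_id].
- by move=> x v h; rewrite /GRing.scale /=; ring.
- exact: class_C_exp_germ.
Qed.

(** The classical smooth transition from 0 on negative numbers to 1 after 1. *)
Definition smooth_step (x : R) : R :=
  exp_bump x / (exp_bump x + exp_bump (1 - x)).

Lemma smooth_step_denom_gt0 x : 0 < exp_bump x + exp_bump (1 - x).
Proof.
have [x0|x0] := ltP 0 x.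
  by rewrite ltr_pwDl ?exp_bump_gt0// exp_bump_ge0.
by rewrite ltr_pwDr ?exp_bump_ge0// exp_bump_gt0// subr_gt0 (le_lt_trans x0).
Qed.

Lemma class_C_smooth_step k : class_C k smooth_step.
Proof.
have C1 : class_C k (fun x : R => exp_bump x) by exact: class_C_exp_germ.
apply: class_CM => //; apply: class_CV.
  by move=> x; rewrite gt_eqF// smooth_step_denom_gt0.
apply: class_CD => //.
have -> : (fun x : R => exp_bump (1 - x)) = fun x => exp_bump (-1 * x + 1).
  by apply/funext => x; rewrite mulN1r addrC.
exact: class_C_exp_bump_affine.
Qed.

Lemma smooth_step_ge0 x : 0 <= smooth_step x.
Proof. by rewrite divr_ge0 ?exp_bump_ge0// ltW// smooth_step_denom_gt0. Qed.

Lemma smooth_step_le1 x : smooth_step x <= 1.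
Proof.
by rewrite ler_pdivrMr ?smooth_step_denom_gt0// mul1r lerDl exp_bump_ge0.
Qed.

Lemma smooth_step0 x : x <= 0 -> smooth_step x = 0.
Proof. by move=> x0; rewrite /smooth_step exp_bump0// mul0r. Qed.

Lemma smooth_step1 x : 1 <= x -> smooth_step x = 1.
Proof.
move=> x1; rewrite /smooth_step [exp_bump (1 - x)]exp_bump0 ?subr_le0// addr0.
by rewrite divff// gt_eqF// exp_bump_gt0// (lt_le_trans ltr01).
Qed.

Lemma class_C_smooth_step_affine k (a b : R) :
  class_C k (fun x : R => smooth_step (a * x + b)).
Proof.
apply: (@class_C_affine _ R R k smooth_step (fun x => a * x + b) (fun v => a * v)).
- move=> x; apply: cvgD; last exact: cvg_cst.
  by apply: cvgM; [exact: cvg_cst|exact: cvg_id].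
- by move=> x v h; rewrite /GRing.scale /=; ring.
- exact: class_C_smooth_step.
Qed.

Variable d : nat.

(** A product over the coordinates rather than a function of a norm: the sup norm
    is not smooth. *)
Definition cutoff (x : 'rV[R]_d) : R :=
  \prod_(i < d) (smooth_step (2 + x 0 i) * smooth_step (2 - x 0 i)).

Lemma cutoff_ge0 x : 0 <= cutoff x.
Proof. by apply: prodr_ge0 => i _; rewrite mulr_ge0 ?smooth_step_ge0. Qed.

Lemma cutoff_le1 x : cutoff x <= 1.
Proof.
apply: prodr_ile1 => i _; rewrite mulr_ge0 ?smooth_step_ge0//=.
by rewrite mulr_ile1 ?smooth_step_ge0 ?smooth_step_le1.
Qed.

Lemma cutoff1 x : `|x| <= 1 -> cutoff x = 1.
Proof.
move=> x1; apply: big1 => i _.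
have := le_trans (coord_le_norm x i) x1; rewrite ler_norml => /andP[? ?].
by rewrite !smooth_step1 ?mulr1//; lra.
Qed.

Lemma cutoff0 : vanishes_off 2 cutoff.
Proof.
move=> x x2; have [i] := norm_gt_coord (ler0n _ 2) x2.
rewrite ltNge ler_norml => xi; rewrite /cutoff (bigD1 i)//=.
have [h|h] := leP (2 + x 0 i) 0; first by rewrite smooth_step0// !mul0r.
rewrite [smooth_step (2 - _)]smooth_step0 ?mulr0 ?mul0r//.
rewrite leNgt; apply/negP => h'; move/negP: xi; apply.
by apply/andP; split; lra.
Qed.

Lemma cutoffN x : cutoff (- x) = cutoff x.
Proof. by apply: eq_bigr => i _; rewrite mxE opprK mulrC. Qed.

Lemma class_C_cutoff k : class_C k cutoff.
Proof.
apply: class_C_prod => i.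
have Ca (a : R) : class_C k (fun x : 'rV[R]_d => smooth_step (a * x 0 i + 2)).
  apply: (@class_C_affine R 'rV[R]_d R k (fun s : R => smooth_step (a * s + 2))
    (fun x => x 0 i) (fun x => x 0 i)).
  - exact: coord_continuous.
  - by move=> x v h; rewrite !mxE.
  - exact: class_C_smooth_step_affine.
have := class_CM (Ca 1) (Ca (-1)).
congr class_C; apply/funext => x; congr (smooth_step _ * smooth_step _); ring.
Qed.

Lemma affine_continuous (V : normedModType R) (a : R) (b : V) :
  continuous (fun x : V => a *: x + b).
Proof.
move=> x; apply: (@cvgD _ _ _ _ _ (fun x => a *: x) (fun=> b)).
  exact: scaler_continuous.
exact: cvg_cst.
Qed.

Lemma class_C_rV_affine k (f : 'rV[R]_d -> R) (a : R) (b : 'rV[R]_d) :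
  class_C k f -> class_C k (fun x => f (a *: x + b)).
Proof.
apply: (@class_C_affine R 'rV[R]_d 'rV[R]_d k f (fun x => a *: x + b)
  (fun v => a *: v)).
  exact: affine_continuous.
by move=> x v h; rewrite scalerDr !scalerA mulrC addrA.
Qed.

End cutoffs.

(** * Integrability of real-valued functions *)

Section real_integrability.
Context dd (T : measurableType dd) (R : realType).
Variables (mu : {measure set T -> \bar R}) (D : set T).
Hypothesis mD : measurable D.
Implicit Types f g : T -> R.

Lemma RintD f g : mu.-integrable D (EFin \o f) -> mu.-integrable D (EFin \o g) ->
  mu.-integrable D (EFin \o (fun x => f x + g x)).
Proof. by move=> If Ig; apply: eq_integrable (integrableD mD If Ig). Qed.

Lemma RintB f g : mu.-integrable D (EFin \o f) -> mu.-integrable D (EFin \o g) ->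
  mu.-integrable D (EFin \o (fun x => f x - g x)).
Proof. by move=> If Ig; apply: eq_integrable (integrableB mD If Ig). Qed.

Lemma RintZ (a : R) f : mu.-integrable D (EFin \o f) ->
  mu.-integrable D (EFin \o (fun x => a * f x)).
Proof. by move=> If; apply: eq_integrable (integrableZl mD a If). Qed.

Lemma Rint_measurable f : mu.-integrable D (EFin \o f) -> measurable_fun D f.
Proof. by move=> /measurable_int/measurable_EFinP. Qed.

Lemma Rint_norm f : mu.-integrable D (EFin \o f) ->
  mu.-integrable D (EFin \o (fun x => `|f x|)).
Proof. exact: integrable_norm. Qed.

Lemma Rint_le f g : measurable_fun D f -> (forall x, D x -> `|f x| <= g x) ->
  mu.-integrable D (EFin \o g) -> mu.-integrable D (EFin \o f).
Proof.
move=> mf fg; apply: (le_integrable mD); first exact/measurable_EFinP.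
move=> x Dx /=; rewrite lee_fin; apply: (le_trans (fg x Dx)); exact: ler_norm.
Qed.

Lemma Rintegral_norm_le f g : mu.-integrable D (EFin \o f) ->
  mu.-integrable D (EFin \o g) -> (forall x, D x -> `|f x| <= g x) ->
  `|\int[mu]_(x in D) f x| <= \int[mu]_(x in D) g x.
Proof.
move=> If Ig fg; apply: (le_trans (le_normr_Rintegral mD If)).
by apply: le_Rintegral => //; exact: Rint_norm.
Qed.

Lemma Rdominated_cvg (f_ : nat -> T -> R) f g :
  (forall n, measurable_fun D (f_ n)) -> measurable_fun D f ->
  {ae mu, forall x, D x -> f_ ^~ x @ \oo --> f x} ->
  mu.-integrable D (EFin \o g) ->
  {ae mu, forall x n, D x -> `|f_ n x| <= g x} ->
  mu.-integrable D (EFin \o f) /\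
  (\int[mu]_(x in D) f_ n x) @[n --> \oo] --> \int[mu]_(x in D) f x.
Proof.
move=> mf_ mf f_f Ig f_g.
have [] := @dominated_convergence _ T R mu D mD (fun n => EFin \o f_ n)
  (EFin \o f) (EFin \o g).
- by move=> n; exact/measurable_EFinP.
- exact/measurable_EFinP.
- apply: filterS f_f => x H Dx; apply: cvg_EFin; first exact: nearW.
  exact: H.
- exact: Ig.
- by apply: filterS f_g => x H n Dx /=; rewrite lee_fin; exact: H.
move=> If _ H; split => //.
apply: (@fine_cvg _ _ _ _ (fun n => \int[mu]_(x in D) (f_ n x)%:E)%E).
by rewrite /Rintegral fineK//; exact: integrable_fin_num.
Qed.

Lemma fatou_bound (f_ : nat -> T -> R) f (C : R) :
  (forall n, measurable_fun D (f_ n)) -> (forall n x, D x -> 0 <= f_ n x) ->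
  (forall x, D x -> f_ ^~ x @ \oo --> f x) ->
  (forall n, \int[mu]_(x in D) (f_ n x)%:E <= C%:E)%E ->
  (\int[mu]_(x in D) (f x)%:E <= C%:E)%E.
Proof.
move=> mf_ f0 f_f f_C.
have -> : (\int[mu]_(x in D) (f x)%:E = \int[mu]_(x in D) limn_einf (fun n => (f_ n x)%:E))%E.
  apply: eq_integral => x; rewrite inE => Dx; apply/esym.
  have Hc : (f_ n x)%:E @[n --> \oo] --> (f x)%:E.
    by apply: cvg_EFin; [exact: nearW|exact: f_f].
  exact: (cvg_limn_einf_sup Hc).1.
apply: (@le_trans _ _
    (limn_einf (fun n => \int[mu]_(x in D) (f_ n x)%:E))%E).
  apply: fatou => //; first by move=> n; exact/measurable_EFinP.
rewrite limn_einf_lim; apply: lime_le; first exact: is_cvg_einfs.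
apply: nearW => n; apply: le_trans (f_C n).
by apply: ereal_inf_lbound; exists n => //=.
Qed.

End real_integrability.

Section measure_preserving.
Context dd (T : measurableType dd) (R : realType).
Variables (mu : {measure set T -> \bar R}) (F : T -> T).
Hypothesis mF : measurable_fun setT F.
Hypothesis muF : forall A, measurable A -> mu (F @^-1` A) = mu A.

Lemma Rintegral_preserved (g : T -> R) : mu.-integrable setT (EFin \o g) ->
  mu.-integrable setT (EFin \o (g \o F)) /\
  \int[mu]_z g (F z) = \int[mu]_z g z.
Proof.
move=> ig; have /integrableP[mg fg] := ig.
have ig' : mu.-integrable (F @^-1` setT) ((EFin \o g) \o F).
  apply/integrableP; split; first exact: measurableT_comp mF.
  have := @ge0_integral_pushforward _ _ _ _ R _ mF mu setT (abse \o (EFin \o g))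
    measurableT.
  rewrite /= => <- //; last exact: measurableT_comp.
  by rewrite (@eq_measure_integral _ _ _ _ mu)// => A mA _; exact: muF.
split; first exact: ig'.
congr fine; have := @integral_pushforward _ _ _ _ R _ mF mu setT (EFin \o g) mg ig' measurableT.
by move=> <-; apply: eq_measure_integral => A mA _; exact: muF.
Qed.

End measure_preserving.

(** * Lebesgue measure on R^d under central symmetries, and mollification *)

Section borel_measurability.
Variables (R : realType) (d : nat).

Lemma continuous_measurable_rV (f : 'rV[R]_d -> R) :
  continuous f -> measurable_fun [set: 'rV[R]_d] f.
Proof.
move=> cf; apply: (measurability _ (RGenOpens.measurableE R)) => //.
move=> _ [_ [a [b ->]] <-]; rewrite setTI; apply: open_measurable_mx.
by move/continuousP: cf; apply; exact: interval_open.
Qed.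

Lemma continuous_measurable_rV_rV (f : 'rV[R]_d -> 'rV[R]_d) :
  continuous f -> measurable_fun [set: 'rV[R]_d] f.
Proof.
move=> cf; apply: (@measurability _ _ _ _ _ _ (@open 'rV[R]_d)) => //.
move=> _ [A oA <-]; rewrite setTI; apply: open_measurable_mx.
by move/continuousP: cf; exact.
Qed.

Lemma closed_measurable_rV (A : set 'rV[R]_d) : closed A -> measurable A.
Proof.
move=> cA; rewrite -(setCK A); apply: measurableC; apply: open_measurable_mx.
exact: closed_openC.
Qed.

End borel_measurability.

Section lebesgue_reflection.
Variable R : realType.
Local Notation mu := (@lebesgue_measure R).
Import HBNNSimple.

Lemma lebesgue_measure_reflect (c : R) (A : set (measurableTypeR R)) :
  measurable A ->
  mu ((fun x : R => c - x) @^-1` A) = mu A.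
Proof.
move=> mA.
have mr : measurable_fun [set: measurableTypeR R] (fun x : R => c - x : measurableTypeR R).
  exact: measurable_funB.
apply/esym.
pose m : {measure set (measurableTypeR R) -> \bar R} :=
  measure_function_pushforward__canonical__measure_function_Measure mu mr.
apply: (@lebesgue_measure_unique R m) => // _ [[a b]] _ <-.
rewrite /m /= /pushforward.
have -> : (fun x : R => c - x) @^-1` `]a, b] = `[c - b, c - a[%classic.
  apply/seteqP; split => x /=; rewrite !in_itv /= => /andP[? ?];
    by apply/andP; split; lra.
rewrite !lebesgue_measure_itv/= !lte_fin.
have -> : (c - b < c - a) = (a < b) by rewrite ltrD2l ltrN2.
by case: ifP => // _; rewrite -!EFinB; congr EFin; ring.
Qed.

(** Stated without measurability, so that it applies to the slices in the
    recursive definition of Lebesgue measure on R^d. *)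
Lemma ge0_integral_reflect (c : R) (F : R -> \bar R) :
  (forall x, 0 <= F x)%E ->
  (\int[mu]_x F (c - x)%R = \int[mu]_x F x)%E.
Proof.
have mr : measurable_fun [set: measurableTypeR R]
    (fun x : R => c - x : measurableTypeR R).
  exact: measurable_funB.
have mono (f g : R -> \bar R) : (forall x, 0 <= f x)%E ->
    (forall x, f x <= g x)%E -> (\int[mu]_x f x <= \int[mu]_x g x)%E.
  move=> f0 fg; rewrite !ge0_integralTE//; last first.
    by move=> x; exact: le_trans (fg x).
  apply: ereal_sup_le => _ [h hf <-]; exists h => // x.
  exact: le_trans (hf x) (fg x).
suff H (G : R -> \bar R) : (forall x, 0 <= G x)%E ->
    (\int[mu]_x G x <= \int[mu]_x G (c - x)%R)%E.
  move=> F0; apply/eqP; rewrite eq_le H// andbT.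
  have := H (fun x => F (c - x)) (fun x => F0 _).
  by under [X in (_ <= X)%E]eq_integral do rewrite subKr.
move=> G0; rewrite {1}ge0_integralTE//; apply: ge_ereal_sup => _ [h hG <-].
rewrite -integralT_nnsfun.
have -> : (\int[mu]_x (EFin \o h) x = \int[mu]_x ((EFin \o h) \o (fun x => c - x)%R) x)%E.
  transitivity (\int[pushforward mu (fun x : R => (c - x)%R : measurableTypeR R)]_x
      (EFin \o h) x)%E.
    apply: eq_measure_integral => A mA _.
    exact/esym/lebesgue_measure_reflect.
  apply: (ge0_integral_pushforward mr) => //.
    exact/measurable_EFinP.
  by move=> x _; rewrite lee_fin.
by apply: mono => x; [rewrite lee_fin|exact: hG].
Qed.

Lemma lebesgue_rV_reflect n (c : 'rV[R]_n) (A : set 'rV[R]_n) :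
  lebesgue_rV ((fun x => c - x) @^-1` A) = lebesgue_rV A.
Proof.
elim: n c A => [|n IH] c A /=.
  rewrite (_ : _ @^-1` A = A)//; apply/seteqP.
  by split => x /=; rewrite (thinmx0 (c - x)) (thinmx0 x).
rewrite -[RHS](ge0_integral_reflect (c 0 0)); last by move=> x; exact: measure_ge0.
apply: eq_integral => x _.
rewrite -[RHS](IH (rsubmx (c : 'rV_(1 + n)))); congr (lebesgue_rV _).
apply/seteqP.
suff E v : c - cons_rV (x, v) = cons_rV (c 0 0 - x, rsubmx (c : 'rV_(1 + n)) - v).
  by split => v /=; rewrite E.
rewrite /cons_rV /=; apply/rowP => i.
case: (split_ordP (i : 'I_(1 + n))) => j ->; rewrite !mxE.
  rewrite (unsplitK (inl j)) /= !mxE !ord1 !mulr1n; congr (c _ _ - _).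
  exact/val_inj.
by rewrite (unsplitK (inr j)) /= !mxE.
Qed.

End lebesgue_reflection.

Section compactly_supported_integrable.
Variables (R : realType) (d : nat).
Local Notation leb := (@lebesgue_rV R d).

Definition cube (r : R) : set 'rV[R]_d := [set x | `|x| <= r].

Lemma measurable_cube r : measurable (cube r).
Proof. by apply: closed_measurable_rV; exact: closed_ball_norm. Qed.

Lemma lebesgue_cube (r : R) : 0 <= r -> leb (cube r) = ((2 * r) ^+ d)%:E.
Proof.
move=> r0; have := @lebesgue_rV_box R d (const_mx (- r)) (const_mx r).
set A := (X in leb X); suff -> : A = cube r.
  move=> -> ; last by move=> i; rewrite !mxE; lra.
  congr EFin; rewrite -[in RHS](card_ord d) -prodr_const.
  by apply: eq_bigr => i _; rewrite !mxE; ring.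
rewrite /A; apply/seteqP; split => x /= h; last first.
  by move=> i; rewrite !mxE -ler_norml; exact: le_trans (coord_le_norm x i) h.
by apply: norm_le_coord => // i; have := h i; rewrite !mxE -ler_norml.
Qed.

Lemma lebesgue_cube_lty (r : R) : (leb (cube r) < +oo)%E.
Proof.
have : (leb (cube r) <= leb (cube `|r|))%E.
  apply: le_measure; rewrite ?inE//; [exact: measurable_cube..|].
  by move=> x /= h; apply: (le_trans h); exact: ler_norm.
by move=> /le_lt_trans; apply; rewrite lebesgue_cube// ltry.
Qed.

Lemma vanishes_off_integrable (mu : {measure set 'rV[R]_d -> \bar R})
    (f : 'rV[R]_d -> R) (r : R) :
  (mu (cube r) < +oo)%E ->
  continuous f -> vanishes_off r f -> mu.-integrable setT (EFin \o f).
Proof.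
move=> mur cf f0.
have mB := measurable_cube r.
have [M M0 fM] := vanishes_off_bounded cf f0.
have : mu.-integrable (cube r) (EFin \o f).
  apply: measurable_bounded_integrable => //.
    by apply: measurable_funTS; exact: continuous_measurable_rV.
  exists M; split; first exact: num_real.
  by move=> K MK x _ /=; apply: (le_trans (fM x)); exact: ltW.
move/integrable_mkcond => /(_ mB); apply: eq_integrable => //= x _.
rewrite patchE; case: ifPn => //; rewrite notin_setE /= => /negP; rewrite -ltNge.
by move=> /f0 ->.
Qed.

Lemma Cc_lebesgue_integrable (f : 'rV[R]_d -> R) (r : R) :
  continuous f -> vanishes_off r f -> leb.-integrable setT (EFin \o f).
Proof. by apply: vanishes_off_integrable; exact: lebesgue_cube_lty. Qed.

Lemma Rintegral_rV_reflect (c : 'rV[R]_d) (g : 'rV[R]_d -> R) :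
  leb.-integrable setT (EFin \o g) ->
  \int[leb]_z g (c - z) = \int[leb]_z g z.
Proof.
move=> ig; have mr : measurable_fun [set: 'rV[R]_d] (fun z => c - z).
  apply: continuous_measurable_rV_rV.
  rewrite (_ : (fun z => c - z) = fun z => (-1) *: z + c).
    exact: affine_continuous.
  by apply/funext => z; rewrite scaleN1r addrC.
apply: (Rintegral_preserved mr _ ig).2 => A _.
exact: lebesgue_rV_reflect.
Qed.

End compactly_supported_integrable.

Section uniform_continuity.
Variable R : realType.

Lemma near_shift_continuous (V : normedModType R) (f : V -> R) (x : V) (e : R) :
  continuous f -> 0 < e ->
  \forall x' \near x & h \near (0 : V), `|f (x' + h) - f x'| <= e.
Proof.
move=> cf e0; have e20 : 0 < e / 2 by rewrite divr_gt0.
have /cvgrPdist_lt/(_ _ e20) := cf x.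
move=> /nbhs_ballP[dl /= dl0 H].
have dl20 : 0 < dl / 2 by rewrite divr_gt0.
exists (ball x (dl / 2), ball (0 : V) (dl / 2)) => /=.
  by split; exact: nbhsx_ballx.
move=> [y h] [/=]; rewrite -!ball_normE /= sub0r normrN => xy hd.
have -> : f (y + h) - f y = (f x - f y) - (f x - f (y + h)) by ring.
apply: (le_trans (ler_normB _ _)); rewrite (splitr e) lerD// ltW//.
  apply: H; rewrite -ball_normE /=; apply: (lt_trans xy).
  by rewrite ltr_pdivrMr// ltr_pMr// ltr1n.
apply: H; rewrite -ball_normE /= opprD addrA.
by rewrite (le_lt_trans (ler_normB _ _))// (splitr dl) ltrD.
Qed.

Lemma Cc_uniformly_continuous (d : nat) (f : 'rV[R]_d -> R) (r : R) :
  continuous f -> vanishes_off r f -> forall e : R, 0 < e ->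
  exists2 dl : R, 0 < dl & forall x h, `|h| <= dl -> `|f (x + h) - f x| <= e.
Proof.
move=> cf f0 e e0.
have /compact_near_coveringP ncov := @compact_ball_rV R d (r + 1).
have := ncov _ (nbhs (0 : 'rV[R]_d)) (fun h x => `|f (x + h) - f x| <= e)
  (nbhs_filter (0 : 'rV[R]_d))
  (fun x _ => near_shift_continuous x cf e0).
move=> /nbhs_ballP[dl /= dl0 H].
exists (Num.min (dl / 2) 1); first by rewrite lt_min divr_gt0/=.
move=> x h; rewrite le_min => /andP[hd h1].
have [xr|xr] := leP `|x| (r + 1).
  apply: (H h) => //; rewrite -ball_normE /= sub0r normrN.
  by apply: (le_lt_trans hd); rewrite ltr_pdivrMr// ltr_pMr// ltr1n.
rewrite !f0 ?subrr ?normr0 ?(ltW e0)//.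
  by apply: le_lt_trans xr; rewrite lerDl.
rewrite -(ltrD2r 1); apply: (lt_le_trans xr).
rewrite -{1}(addrK h x); apply: (le_trans (ler_normB _ _)).
by rewrite lerD2l.
Qed.

End uniform_continuity.

Section convolution.
Variables (R : realType) (d : nat).
Local Notation leb := (@lebesgue_rV R d).
Implicit Types f g : 'rV[R]_d -> R.

Lemma lipschitz_continuous (V : normedModType R) (f : V -> R) (K : R) :
  (forall x y, `|f x - f y| <= K * `|x - y|) -> continuous f.
Proof.
move=> H x; apply/cvgrPdist_le => e e0.
have K0 : 0 < `|K| + 1 by rewrite ltr_wpDl.
have eK0 : 0 < e / (`|K| + 1) by rewrite divr_gt0.
apply/nbhs_ballP; exists (e / (`|K| + 1)) => // y.
rewrite -ball_normE /= => xy; apply: (le_trans (H x y)).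
apply: (@le_trans _ _ ((`|K| + 1) * `|x - y|)).
  rewrite ler_wpM2r//; apply: (le_trans (ler_norm K)); rewrite lerDl//.
by rewrite -ler_pdivlMl// mulrC ltW.
Qed.

Lemma contD (T : topologicalType) (f g : T -> R) :
  continuous f -> continuous g -> continuous (fun z => f z + g z).
Proof. by move=> cf cg z; apply: cvgD; [exact: cf|exact: cg]. Qed.

Lemma contB (T : topologicalType) (f g : T -> R) :
  continuous f -> continuous g -> continuous (fun z => f z - g z).
Proof. by move=> cf cg z; apply: cvgB; [exact: cf|exact: cg]. Qed.

Lemma contM (T : topologicalType) (f g : T -> R) :
  continuous f -> continuous g -> continuous (fun z => f z * g z).
Proof. by move=> cf cg z; apply: cvgM; [exact: cf|exact: cg]. Qed.

Lemma contZ (T : topologicalType) (f : T -> R) (a : R) :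
  continuous f -> continuous (fun z => a * f z).
Proof. by move=> cf z; apply: cvgM; [exact: cvg_cst|exact: cf]. Qed.

Lemma cont_affine (V : normedModType R) (f : V -> R) (a : R) (b : V) :
  continuous f -> continuous (fun z => f (a *: z + b)).
Proof.
move=> cf z.
by apply: (continuous_comp (@affine_continuous R V a b z)); exact: cf.
Qed.

Lemma cont_addr (V : normedModType R) (f : V -> R) (b : V) :
  continuous f -> continuous (fun z => f (b + z)).
Proof.
have -> : (fun z : V => f (b + z)) = (fun z : V => f (1 *: z + b)).
  by apply/funext => z; rewrite scale1r addrC.
exact: cont_affine.
Qed.

Lemma cont_subr (V : normedModType R) (f : V -> R) (b : V) :
  continuous f -> continuous (fun z => f (b - z)).
Proof.
have -> : (fun z : V => f (b - z)) = (fun z : V => f ((-1) *: z + b)).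
  by apply/funext => z; rewrite scaleN1r addrC.
exact: cont_affine.
Qed.

Definition convolution f g (x : 'rV[R]_d) : R := \int[leb]_z (f z * g (x - z)).

Let integrable_conv f g r x : continuous f -> vanishes_off r f -> continuous g ->
  leb.-integrable setT (EFin \o (fun z => f z * g (x - z))).
Proof.
move=> cf f0 cg; apply: (@Cc_lebesgue_integrable _ _ _ r).
  by apply: contM => //; exact: cont_subr.
exact: vanishes_offM.
Qed.

Let conv_diff_le f (G : 'rV[R]_d -> R) (r B : R) : continuous f -> vanishes_off r f ->
  continuous G -> (forall z, `|G z| <= B) ->
  `|\int[leb]_z (f z * G z)| <= B * (\int[leb]_z `|f z|).
Proof.
move=> cf f0 cG GB.
have If := Cc_lebesgue_integrable cf f0.
have Ifn : leb.-integrable setT (EFin \o (fun z => `|f z|)) by exact: integrable_norm.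
have IG : leb.-integrable setT (EFin \o (fun z => f z * G z)).
  apply: (@Cc_lebesgue_integrable _ _ _ r); last exact: vanishes_offM.
  exact: contM.
apply: (le_trans (le_normr_Rintegral _ IG)) => //.
rewrite -RintegralZl//; apply: le_Rintegral => //.
- exact: integrable_norm.
- exact: (integrableZl measurableT B Ifn).
- by move=> z _; rewrite normrM mulrC ler_wpM2r.
Qed.

(** Derivatives fall on [g], and since the derivatives of [g] are Lipschitz, the
    first-order Taylor remainder under the integral is quadratic. *)
Lemma class_C_convolution f g (r s : R) :
  continuous f -> vanishes_off r f ->
  (forall k, class_C k g) -> vanishes_off s g ->
  forall k, class_C k (convolution f g).
Proof.
move=> cf f0 Cg g0 k.
have C0 (h : 'rV[R]_d -> R) t : (forall k, class_C k h) -> vanishes_off t h ->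
    continuous (convolution f h).
  move=> Ch h0; have [K K0 hK] := C1_lipschitz (Ch 1%N) h0.
  apply: (@lipschitz_continuous _ _ (K * (\int[leb]_z `|f z|))) => x y.
  have ch := class_C_cont (Ch 0%N).
  rewrite /convolution -RintegralB//; [|exact: (integrable_conv _ cf f0 ch)..].
  under eq_Rintegral do rewrite -mulrBr.
  rewrite mulrAC; apply: (conv_diff_le cf f0).
    by apply: contB; exact: cont_subr.
  by move=> z; apply: (le_trans (hK _ _)); rewrite opprB addrA subrK.
elim: k g s Cg g0 => [|k IH] g s Cg g0; first exact: C0 g0.
have cg := class_C_cont (Cg 0%N).
have D v x : is_derive x v (convolution f g) (convolution f ('D_v g) x).
  have [dgv CDg] := (Cg 1%N).2 v.
  have [_ CDg2] := (Cg 2%N).2 v.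
  have [K K0 gK] := C1_lipschitz CDg2 (vanishes_off_derive v g0).
  apply: (@is_derive_sqr_bound _ _ _ _ _ _ (K * `|v| * (\int[leb]_z `|f z|))) => h.
  rewrite /convolution -RintegralB//; [|exact: (integrable_conv _ cf f0 cg)..].
  rewrite -RintegralZl//; last exact: (integrable_conv _ cf f0 CDg).
  rewrite -RintegralB//.
  - under eq_Rintegral => z _.
      rewrite -mulrBr (_ : h * _ = f z * (h * 'D_v g (x - z))); last by ring.
      rewrite -mulrBr; over.
    rewrite mulrAC; apply: (conv_diff_le cf f0).
      apply: contB; first by apply: contB; exact: cont_subr.
      by apply: contZ; exact: (@cont_subr _ ('D_v g) x CDg).
    move=> z; rewrite -[h *: v + x - z]addrA.
    have [c ch ->] := line_mvt (x - z) h dgv.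
    rewrite (mulrC _ h) -mulrBr normrM.
    have -> : K * `|v| * h ^+ 2 = `|h| * (K * `|v| * `|h|).
      by rewrite -(real_normK (num_real h)); ring.
    rewrite ler_wpM2l//; apply: (le_trans (gK _ _)).
    by rewrite addrK normrZ -mulrA ler_wpM2l// mulrC ler_wpM2l.
  - by apply: RintB => //; exact: (integrable_conv _ cf f0 cg).
  - apply: RintZ => //.
    exact: (integrable_conv _ cf f0 CDg).
split=> [|v]; first exact: C0 g0.
split=> [x|]; first by case: (D v x).
rewrite (_ : 'D_v _ = convolution f ('D_v g)).
  apply: (IH _ s); last exact: vanishes_off_derive.
  by move=> j; have [_] := (Cg j.+1).2 v.
by apply/funext => x; case: (D v x).
Qed.

End convolution.

Section mollification.
Variables (R : realType) (d : nat).
Local Notation leb := (@lebesgue_rV R d).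

Lemma convolutionC (f g : 'rV[R]_d -> R) (r : R) x :
  continuous f -> vanishes_off r f -> continuous g ->
  convolution f g x = \int[leb]_z (f (x - z) * g z).
Proof.
move=> cf f0 cg; rewrite /convolution.
rewrite -(Rintegral_rV_reflect x).
  by apply: eq_Rintegral => z _; rewrite subKr.
apply: (@Cc_lebesgue_integrable _ _ _ r); last exact: vanishes_offM.
by apply: contM => //; exact: cont_subr.
Qed.

Let bump n (z : 'rV[R]_d) : R := cutoff (n.+1%:R *: z + 0).

Let class_C_bump n k : class_C k (bump n).
Proof. exact: class_C_rV_affine (class_C_cutoff _ _ _). Qed.

Let bump0 n : vanishes_off (2 / n.+1%:R) (bump n).
Proof.
move=> z hz; apply: cutoff0.
by rewrite addr0 normrZ ger0_norm// -ltr_pdivrMl// mulrC.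
Qed.

Let bump_ge0 n z : 0 <= bump n z. Proof. exact: cutoff_ge0. Qed.

Let bump_int n : leb.-integrable setT (EFin \o bump n).
Proof. exact: Cc_lebesgue_integrable (class_C_cont (class_C_bump n 0)) (bump0 (n:=n)). Qed.

Let mass n := \int[leb]_z bump n z.

Let mass_gt0 n : 0 < mass n.
Proof.
have n0 : 0 <= n.+1%:R^-1 :> R by rewrite invr_ge0.
have n1 : 0 < n.+1%:R :> R by [].
apply: (@lt_le_trans _ _ ((2 * n.+1%:R^-1) ^+ d)).
  by rewrite exprn_gt0// mulr_gt0// invr_gt0.
rewrite -lee_fin -(lebesgue_cube d n0) /mass /Rintegral fineK; last first.
  by apply: integrable_fin_num => //; exact: bump_int.
rewrite -[leLHS]mul1e -integral_cst ?measurable_cube//.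
have cb : continuous (bump n) := class_C_bump n 0.
have mb := continuous_measurable_rV cb.
apply: (@le_trans _ _ (\int[leb]_(z in cube n.+1%:R^-1) (bump n z)%:E)%E).
  apply: ge0_le_integral => //.
  - exact: measurable_cube.
  - exact/measurable_EFinP/measurable_funTS.
  move=> z; rewrite /cube /= => zn; rewrite lee_fin /bump cutoff1//.
  by rewrite addr0 normrZ ger0_norm// -ler_pdivlMl// mulr1.
apply: ge0_subset_integral => //.
- exact: measurable_cube.
- exact/measurable_EFinP.
- by move=> z _; rewrite lee_fin.
- exact: measurable_cube.
Qed.

(** A standard mollifier, normalised by hand so that no change of variables
    in R^d is needed. *)
Definition mollifier n (z : 'rV[R]_d) : R := (mass n)^-1 * bump n z.

Lemma class_C_mollifier n k : class_C k (mollifier n).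
Proof. by apply: class_CM => //; exact: class_C_cst. Qed.

Lemma mollifier_ge0 n z : 0 <= mollifier n z.
Proof. by apply: mulr_ge0; [rewrite invr_ge0 ltW// mass_gt0|exact: bump_ge0]. Qed.

Lemma mollifier0 n : vanishes_off (2 / n.+1%:R) (mollifier n).
Proof. by move=> z /bump0; rewrite /mollifier => ->; rewrite mulr0. Qed.

Lemma cont_mollifier n : continuous (mollifier n).
Proof. exact: class_C_cont (class_C_mollifier n 0). Qed.

Lemma mollifier_int n : leb.-integrable setT (EFin \o mollifier n).
Proof. exact: Cc_lebesgue_integrable (@cont_mollifier n) (@mollifier0 n). Qed.

Lemma mollifier_mass n : \int[leb]_z mollifier n z = 1.
Proof.
rewrite /mollifier RintegralZl ?bump_int// -/(mass n).
by rewrite mulVf// gt_eqF// mass_gt0.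
Qed.

(** The mollifier has mass one, so that averages inherit the bounds valid on its
    support. *)
Lemma mollifier_average n (G : 'rV[R]_d -> R) (B : R) : continuous G ->
  (forall z, `|z| <= 2 / n.+1%:R -> `|G z| <= B) ->
  `|\int[leb]_z (G z * mollifier n z)| <= B.
Proof.
move=> cG GB.
have IG : leb.-integrable setT (EFin \o (fun z => G z * mollifier n z)).
  apply: (@Cc_lebesgue_integrable _ _ _ (2 / n.+1%:R)).
    by apply: contM => //; exact: cont_mollifier.
  by move=> z hz; rewrite mollifier0 ?mulr0.
apply: (le_trans (le_normr_Rintegral _ IG)) => //.
rewrite -[leRHS]mulr1 -(mollifier_mass n) -RintegralZl//; last exact: mollifier_int.
apply: le_Rintegral => //.
- exact: integrable_norm.
- by apply: RintZ => //; exact: mollifier_int.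
move=> z _; rewrite normrM (ger0_norm (mollifier_ge0 _ _)).
have [hz|hz] := leP `|z| (2 / n.+1%:R).
  by rewrite ler_wpM2r ?mollifier_ge0// GB.
by rewrite mollifier0// !mulr0.
Qed.

Variables (f : 'rV[R]_d -> R) (r : R).
Hypotheses (cf : continuous f) (f0 : vanishes_off r f).

Definition mollify n := convolution f (mollifier n).

Let mollifyE n x : mollify n x = \int[leb]_z (f (x - z) * mollifier n z).
Proof. by apply: convolutionC cf f0 _; exact: cont_mollifier. Qed.

Let int_shift n x : leb.-integrable setT
  (EFin \o (fun z => f (x - z) * mollifier n z)).
Proof.
apply: (@Cc_lebesgue_integrable _ _ _ (2 / n.+1%:R)).
  by apply: contM; [exact: cont_subr|exact: cont_mollifier].
by move=> z hz; rewrite mollifier0 ?mulr0.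
Qed.

Lemma class_C_mollify n k : class_C k (mollify n).
Proof.
apply: class_C_convolution cf f0 _ (@mollifier0 n) k => k.
exact: class_C_mollifier.
Qed.

Lemma vanishes_off_mollify n : vanishes_off (r + 2) (mollify n).
Proof.
move=> x hx; apply/eqP; rewrite -normr_le0 mollifyE; apply: mollifier_average.
  exact: cont_subr.
move=> z hz; rewrite f0 ?normr0//.
have z2 : `|z| <= 2 by apply: (le_trans hz); rewrite ler_pdivrMr// ler_pMr// ler1n.
rewrite -(ltrD2r 2); apply: (lt_le_trans hx).
apply: (@le_trans _ _ (`|x - z| + `|z|)); last by rewrite lerD2l.
by rewrite -{1}(subrK z x) ler_normD.
Qed.

Lemma mollify_bounded n M : (forall x, `|f x| <= M) -> forall x, `|mollify n x| <= M.
Proof.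
move=> fM x; rewrite mollifyE; apply: mollifier_average => //.
exact: cont_subr.
Qed.

(** Second differences commute with translations, hence with convolution: the
    bound survives with the same constant. *)
Lemma mollify_second_diff n M :
  second_diff_bound M f -> second_diff_bound M (mollify n).
Proof.
move=> fM x y.
have -> : second_diff (mollify n) x y =
    \int[leb]_z (second_diff f (x - z) y * mollifier n z).
  rewrite /second_diff !mollifyE -RintegralD//; [|exact: int_shift..].
  have I2 : leb.-integrable setT (EFin \o (fun z =>
      f (x + y - z) * mollifier n z + f (x - y - z) * mollifier n z)).
    by apply: RintD => //; exact: int_shift.
  rewrite -RintegralZr// -RintegralB//; last first.
    have := RintZ measurableT (2^-1) I2.
    by apply: eq_integrable => // z _ /=; rewrite mulrC.
  apply: eq_Rintegral => z _.
  have -> : x - z + y = x + y - z by rewrite addrAC.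
  have -> : x - z - y = x - y - z by rewrite addrAC.
  ring.
apply: mollifier_average => //.
apply: contB; first exact: cont_subr.
have E : (fun z => (f (x - z + y) + f (x - z - y)) / 2) =
    (fun z => 2^-1 * (f (x + y - z) + f (x - y - z))).
  by apply/funext => z; rewrite mulrC; congr (_ * (f _ + f _)); rewrite addrAC.
rewrite E; apply: contZ; apply: contD; exact: cont_subr.
Qed.

Lemma mollify_uniform_cvg (e : R) : 0 < e ->
  exists N, forall n, (N <= n)%N -> forall x, `|mollify n x - f x| <= e.
Proof.
move=> e0; have [dl dl0 H] := Cc_uniformly_continuous cf f0 e0.
have [N HN] : exists N : nat, 2 / dl < N%:R.
  by exists (Num.truncn (2 / dl)).+1; exact: truncnS_gt.
exists N => n Nn x.
have -> : mollify n x - f x = \int[leb]_z ((f (x - z) - f x) * mollifier n z).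
  rewrite mollifyE -[X in _ - X]mulr1 -(mollifier_mass n).
  rewrite -RintegralZl//; last exact: mollifier_int.
  rewrite -RintegralB//; last first.
    by apply: RintZ => //; exact: mollifier_int.
  by apply: eq_Rintegral => z _; rewrite mulrBl.
apply: mollifier_average.
  apply: contB; first exact: cont_subr.
  exact: cst_continuous.
move=> z hz; apply: H; rewrite normrN; apply: (le_trans hz).
rewrite ler_pdivrMr// -ler_pdivrMl//.
rewrite mulrC ltW// (lt_le_trans HN)// ler_nat.
exact: leqW.
Qed.

Lemma mollify_cvg x : mollify n x @[n --> \oo] --> f x.
Proof.
apply/cvgrPdist_le => e /mollify_uniform_cvg[N HN].
by exists N => // n /= Nn; rewrite distrC; exact: HN.
Qed.

End mollification.

(** * Lévy operators *)

Section real_lemmas.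
Variable R : realType.

(** Lets dominated convergence, a statement on sequences, prove continuity. *)
Lemma sequential_continuous (V : normedModType R) (F : V -> R) (x : V) :
  (forall u : nat -> V, (forall n, `|u n - x| <= n.+1%:R^-1) ->
     F (u n) @[n --> \oo] --> F x) ->
  {for x, continuous F}.
Proof.
move=> H; apply/cvgrPdist_lt => e e0; apply: contrapT => nH.
have /choice[u hu] (n : nat) : exists y : V,
    `|y - x| <= n.+1%:R^-1 /\ ~ `|F x - F y| < e.
  apply: contrapT => /forallNP h; apply: nH; apply/nbhs_ballP.
  exists n.+1%:R^-1 => //= y; rewrite -ball_normE /= distrC => xy.
  by apply: contrapT => Fy; apply: (h y); split => //; exact: ltW.
have /cvgrPdist_lt/(_ _ e0)[N _ HN] := H u (fun n => (hu n).1).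
by apply: (hu N).2; apply: HN => /=.
Qed.

Lemma derive_lipschitz_bound (V : normedModType R) (g : V -> R) (K : R) (x v : V) :
  (forall y z, `|g y - g z| <= K * `|y - z|) -> derivable g x v ->
  `|'D_v g x| <= K * `|v|.
Proof.
move=> gK dg.
have cl : closed [set r : R | `|r| <= K * `|v|] := @closed_ball_norm R R _.
apply: (closed_cvg (F := (0 : R)^') _ cl _ _ dg).
near=> h => /=.
have h0 : h != 0 by near: h; exact: nbhs_dnbhs_neq.
rewrite /GRing.scale /= normrM normfV ler_pdivrMl ?normr_gt0//.
apply: (le_trans (gK _ _)); rewrite addrK normrZ.
by rewrite mulrCA.
Unshelve. all: by end_near. Qed.

End real_lemmas.

Section levy_operator.
Variables (R : realType) (d : nat).
Variable nu : {measure set 'rV[R]_d -> \bar R}.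
Hypothesis Hnu : symmetric_levy_measure nu.
Implicit Types (x y : 'rV[R]_d) (f g : 'rV[R]_d -> R).

Lemma measurable_levy_weight : measurable_fun setT (@levy_weight R d).
Proof.
apply: measurable_minr; first exact: measurable_cst.
have -> : (fun y : 'rV[R]_d => enorm y ^+ 2) = fun y => \sum_i y 0 i * y 0 i.
  apply/funext => y; rewrite sqr_sqrtr//; apply: sumr_ge0 => i _.
  by rewrite -expr2 sqr_ge0.
apply: measurable_sum => i; apply: continuous_measurable_rV.
by apply: contM; exact: coord_continuous.
Qed.

Lemma levy_weight_int : nu.-integrable setT (EFin \o @levy_weight R d).
Proof.
apply/integrableP; split; first by apply/measurable_EFinP; exact: measurable_levy_weight.
have [_ _ _] := Hnu; apply: le_lt_trans; rewrite le_eqVlt; apply/orP; left.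
apply/eqP; apply: eq_integral => y _ /=.
by rewrite ger0_norm// levy_weight_ge0.
Qed.

Definition levy_mass : R := \int[nu]_y levy_weight y.

Lemma levy_mass_ge0 : 0 <= levy_mass.
Proof. by apply: Rintegral_ge0 => y _; exact: levy_weight_ge0. Qed.

Lemma levy_symmetric_int (g : 'rV[R]_d -> R) : nu.-integrable setT (EFin \o g) ->
  nu.-integrable setT (EFin \o (fun y => g (- y))) /\
  \int[nu]_y g (- y) = \int[nu]_y g y.
Proof.
apply: Rintegral_preserved => [|A mA].
  apply: continuous_measurable_rV_rV => y; exact: opp_continuous.
have [_ _ /(_ A mA) -> _] := Hnu; congr (nu _); apply/seteqP; split => y /=.
  by exists (- y); rewrite ?opprK.
by move=> [z Az <-]; rewrite opprK.
Qed.

Lemma cont_second_diff f x : continuous f -> continuous (second_diff f x).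
Proof.
move=> cf; apply: contB; first exact: cst_continuous.
have -> : (fun y => (f (x + y) + f (x - y)) / 2) =
          (fun y => 2^-1 * (f (x + y) + f (x - y))).
  by apply/funext => y; rewrite mulrC.
by apply: contZ; apply: contD; [exact: cont_addr|exact: cont_subr].
Qed.

Lemma weight_bounded_int (G : 'rV[R]_d -> R) (M : R) : measurable_fun setT G ->
  (forall y, `|G y| <= M * levy_weight y) -> nu.-integrable setT (EFin \o G).
Proof.
move=> mG GM; apply: (Rint_le measurableT mG (fun y _ => GM y)).
apply: RintZ => //; exact: levy_weight_int.
Qed.

Lemma weight_bounded_le (G : 'rV[R]_d -> R) (M : R) : measurable_fun setT G ->
  (forall y, `|G y| <= M * levy_weight y) -> `|\int[nu]_y G y| <= M * levy_mass.
Proof.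
move=> mG GM; rewrite /levy_mass -RintegralZl//; last exact: levy_weight_int.
apply: Rintegral_norm_le => //; first exact: weight_bounded_int GM.
by apply: RintZ => //; exact: levy_weight_int.
Qed.

Section second_diff_bounded.
Variables (f : 'rV[R]_d -> R) (M : R).
Hypotheses (cf : continuous f) (fM : second_diff_bound M f).

Lemma measurable_second_diff x : measurable_fun setT (second_diff f x).
Proof. by apply: continuous_measurable_rV; exact: cont_second_diff. Qed.

Lemma levy_op_int x : nu.-integrable setT (EFin \o second_diff f x).
Proof. exact: weight_bounded_int (measurable_second_diff x) (fM x). Qed.

Lemma levy_op_bound x : `|levy_op nu f x| <= M * levy_mass.
Proof. exact: weight_bounded_le (measurable_second_diff x) (fM x). Qed.

Lemma levy_opZ (a : R) x : levy_op nu (fun z => f z * a) x = a * levy_op nu f x.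
Proof.
rewrite /levy_op -RintegralZl//; last exact: levy_op_int.
by apply: eq_Rintegral => y _; field.
Qed.

(** Dominated convergence under the uniform bound by the Lévy weight. *)
Lemma levy_op_cvg (f_ : nat -> 'rV[R]_d -> R) (x_ : nat -> 'rV[R]_d) x :
  (forall n, continuous (f_ n)) -> (forall n, second_diff_bound M (f_ n)) ->
  (forall y, second_diff (f_ n) (x_ n) y @[n --> \oo] --> second_diff f x y) ->
  levy_op nu (f_ n) (x_ n) @[n --> \oo] --> levy_op nu f x.
Proof.
move=> cf_ f_M f_f.
have [] := @Rdominated_cvg _ _ R nu setT measurableT
  (fun n => second_diff (f_ n) (x_ n)) (second_diff f x)
  (fun y => M * levy_weight y).
- by move=> n; apply: continuous_measurable_rV; exact: cont_second_diff.
- exact: measurable_second_diff.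
- exact: aeW.
- by apply: RintZ => //; exact: levy_weight_int.
- by apply: aeW => y n _; exact: f_M.
by [].
Qed.

Lemma levy_op_continuous : continuous (levy_op nu f).
Proof.
move=> x; apply: sequential_continuous => u ux.
apply: levy_op_cvg => // y.
have cvu z : f (u n + z) @[n --> \oo] --> f (x + z).
  apply: (@cvg_comp _ _ _ (fun n => u n + z) f _ (nbhs (x + z))); last exact: cf.
  apply/cvgrPdist_le => e e0; near=> n.
  rewrite opprD addrACA subrr addr0 distrC; apply: (le_trans (ux n)).
  apply: ltW; near: n; exact: (near_infty_natSinv_lt (PosNum e0)).
have := cvu 0; rewrite addr0; under eq_fun do rewrite addr0; move=> cvu0.
rewrite /second_diff; apply: cvgB => //; apply: cvgMl; exact: cvgD.
Unshelve. all: by end_near. Qed.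

End second_diff_bounded.

End levy_operator.

Section dilated_cutoffs.
Variables (R : realType) (d : nat).

Definition dilated_cutoff n (x : 'rV[R]_d) : R := cutoff (n.+1%:R^-1 *: x + 0).

Let n0 n : 0 <= n.+1%:R^-1 :> R. Proof. by rewrite invr_ge0. Qed.
Let n1 n : n.+1%:R^-1 <= 1 :> R. Proof. by rewrite invf_le1// ler1n. Qed.

Lemma dilated_cutoff_ge0 n x : 0 <= dilated_cutoff n x.
Proof. exact: cutoff_ge0. Qed.

Lemma dilated_cutoff_le1 n x : dilated_cutoff n x <= 1.
Proof. exact: cutoff_le1. Qed.

Lemma class_C_dilated_cutoff n k : class_C k (dilated_cutoff n).
Proof. exact: class_C_rV_affine (class_C_cutoff _ _ _). Qed.

Lemma dilated_cutoff0 n : vanishes_off (2 * n.+1%:R) (dilated_cutoff n).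
Proof.
move=> x hx; apply: cutoff0.
by rewrite addr0 normrZ ger0_norm// mulrC ltr_pdivlMr.
Qed.

Lemma dilated_cutoff_cvg x : dilated_cutoff n x @[n --> \oo] --> (1 : R).
Proof.
apply/cvgrPdist_le => e e0; exists (Num.truncn `|x|).+1 => // n /= xn.
rewrite /dilated_cutoff cutoff1; first by rewrite subrr normr0 ltW.
rewrite addr0 normrZ ger0_norm// mulrC ler_pdivrMr// mul1r.
by apply: ltW; apply: (lt_le_trans (truncnS_gt _)); rewrite ler_nat leqW.
Qed.

Lemma dilated_cutoff_lipschitz (K : R) : 0 <= K ->
  (forall x y : 'rV[R]_d, `|cutoff x - cutoff y| <= K * `|x - y|) ->
  forall n x y, `|dilated_cutoff n x - dilated_cutoff n y| <= K * `|x - y|.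
Proof.
move=> K0 HK n x y; apply: (le_trans (HK _ _)); rewrite !addr0 -scalerBr normrZ.
by rewrite ler_wpM2l// ger0_norm// ler_piMl.
Qed.

Lemma levy_weight_scale (a : R) (y : 'rV[R]_d) : 0 <= a <= 1 ->
  levy_weight (a *: y) <= levy_weight y.
Proof.
move=> /andP[a0 a1]; rewrite /levy_weight.
suff : enorm (a *: y) ^+ 2 <= enorm y ^+ 2.
  by move=> h; rewrite le_min !ge_min lexx/= h orbT.
rewrite lerXn2r ?nnegrE ?enorm_ge0// /enorm ler_wsqrtr//.
apply: ler_sum => i _; rewrite !mxE mulrACA -!expr2 ler_piMl ?sqr_ge0//.
exact: exprn_ile1.
Qed.

(** Dilation contracts the increments, hence all the bounds on the cutoffs are
    uniform in [n]. *)
Lemma dilated_cutoff_second_diff (M : R) : 0 <= M ->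
  second_diff_bound M (@cutoff R d) ->
  forall n, second_diff_bound M (dilated_cutoff n).
Proof.
move=> M0 HM n x y.
have -> : second_diff (dilated_cutoff n) x y =
          second_diff (@cutoff R d) (n.+1%:R^-1 *: x) (n.+1%:R^-1 *: y).
  by rewrite /second_diff /dilated_cutoff !addr0 scalerDr scalerBr.
apply: (le_trans (HM _ _)); rewrite ler_wpM2l//.
by apply: levy_weight_scale; rewrite n0 n1.
Qed.

Lemma norm_delta_le1 i : `|delta_mx 0 i : 'rV[R]_d| <= 1.
Proof.
apply: norm_le_coord => // j; rewrite mxE eqxx /=.
by case: (j == i); rewrite ?normr1 ?normr0.
Qed.

Lemma test_norms_le (psi : 'rV[R]_d -> R) (K : R) : 0 <= K ->
  (forall x v, derivable psi x v) -> (forall x, `|psi x| <= 1) ->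
  (forall x y, `|psi x - psi y| <= K * `|x - y|) ->
  Num.max (sup_norm psi) (grad_sup_norm psi) <= Num.max 1 (d%:R * K).
Proof.
move=> K0 dpsi psi1 psiK; rewrite ge_max !le_max; apply/andP; split.
  apply/orP; left; apply: ge_sup; first by exists `|psi 0|; exists 0.
  by move=> _ [x _ <-].
apply/orP; right; apply: ge_sup; first by exists (enorm (grad psi 0)); exists 0.
move=> _ [x _ <-]; apply: enorm_le_bound => // i; rewrite mxE.
apply: (le_trans (derive_lipschitz_bound psiK (dpsi _ _))).
by rewrite ler_piMr// norm_delta_le1.
Qed.

End dilated_cutoffs.

Lemma positive_on_cube (R : realType) (d : nat) (phi : 'rV[R]_d -> R) (r : R) :
  continuous phi -> (forall x, 0 < phi x) -> 0 <= r ->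
  exists2 kappa : R, 0 < kappa & forall x, `|x| <= r -> kappa <= phi x.
Proof.
move=> cphi phi_gt0 r0; have [|||z _ Hz] := @EVT_min_rV R d phi (cube r).
- by exists 0; rewrite /cube /= normr0.
- exact: compact_ball_rV.
- exact: continuous_subspaceT.
by exists (phi z) => // x xr; apply: Hz; rewrite inE.
Qed.

Section weight_function.
Variables (R : realType) (d : nat).
Variable nu : {measure set 'rV[R]_d -> \bar R}.
Hypothesis Hnu : symmetric_levy_measure nu.
Variables (phi : 'rV[R]_d -> R) (c : R).
Hypotheses (Cphi : class_C 2 phi) (phi_gt0 : forall x, 0 < phi x) (c0 : 0 <= c).
Hypothesis HL : forall x, `|levy_op nu phi x| <= c * phi x.
Hypothesis HB : forall psi : 'rV[R]_d -> R, Cc_infty setT psi -> forall x,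
     `|levy_form nu psi phi x| <=
       c * Num.max (sup_norm psi) (grad_sup_norm psi) * phi x.
Implicit Types x y : 'rV[R]_d.

Let cphi : continuous phi. Proof. exact: class_C_cont Cphi. Qed.
Let phi_ge0 x : 0 <= phi x. Proof. exact: ltW. Qed.

(** The far part of a jump measure is cut out smoothly by this weight. *)
Let tau y : R := 1 - cutoff y.

Let tau_ge0 y : 0 <= tau y. Proof. by rewrite subr_ge0 cutoff_le1. Qed.
Let tau_le1 y : tau y <= 1. Proof. by rewrite gerBl cutoff_ge0. Qed.
Let tau_near y : `|y| <= 1 -> tau y = 0.
Proof. by move=> /cutoff1; rewrite /tau => ->; rewrite subrr. Qed.
Let tau_far y : 2 < `|y| -> tau y = 1.
Proof. by move=> /cutoff0; rewrite /tau => ->; rewrite subr0. Qed.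
Let tauN y : tau (- y) = tau y. Proof. by rewrite /tau cutoffN. Qed.
Let tau_weight y : tau y <= levy_weight y.
Proof.
have [y1|y1] := leP `|y| 1; first by rewrite tau_near// levy_weight_ge0.
by rewrite levy_weight_far ?tau_le1// ltW.
Qed.
Let ctau : continuous tau.
Proof.
apply: contB; first exact: cst_continuous.
exact: class_C_cont (class_C_cutoff R d 0).
Qed.

(** The bilinear bound, tested with bumps vanishing near [x] and increasing to
    the indicator of the complement of a neighbourhood of [x], controls the
    average of [phi] under the far part of [nu]; in particular the average is
    finite, although [phi] is not assumed to be bounded. *)
Lemma far_average : exists2 C : R, 0 <= C & forall x,
  nu.-integrable setT (EFin \o (fun y => tau y * phi (x - y))) /\
  \int[nu]_y (tau y * phi (x - y)) <= C * phi x.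
Proof.
have [K K0 HK] := C1_lipschitz (class_C_cutoff R d 1) (@cutoff0 R d).
pose C := c * Num.max 1 (d%:R * (K + K)) + levy_mass nu.
have C0 : 0 <= C.
  rewrite addr_ge0 ?levy_mass_ge0// mulr_ge0// le_max ler01//.
exists C => // x.
pose psi n z : R := dilated_cutoff n z * tau (x - z).
have psi_ge0 n z : 0 <= psi n z by rewrite mulr_ge0// dilated_cutoff_ge0.
have psi_le1 n z : psi n z <= 1.
  by rewrite mulr_ile1// ?dilated_cutoff_ge0// dilated_cutoff_le1.
have Ctau k : class_C k (fun z => tau (x - z)).
  have -> : (fun z => tau (x - z)) = fun z => 1 + (-1) * cutoff ((-1) *: z + x).
    by apply/funext => z; rewrite /tau scaleN1r (addrC (- z)) mulN1r.
  apply: class_CD; first exact: class_C_cst.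
  apply: class_CM; first exact: class_C_cst.
  exact: class_C_rV_affine (class_C_cutoff _ _ _).
have Cpsi n k : class_C k (psi n).
  by apply: class_CM => //; exact: class_C_dilated_cutoff.
have psi0 n : vanishes_off (2 * n.+1%:R) (psi n).
  exact: vanishes_offM (@dilated_cutoff0 R d n).
have psi_test n : Cc_infty setT (psi n).
  by split => //; exact: vanishes_off_compact (psi0 n).
have tauK y z : `|tau (x - y) - tau (x - z)| <= K * `|y - z|.
  rewrite /tau opprB [_ - _ + _]addrC addrA subrK distrC.
  apply: (le_trans (HK _ _)).
  have -> : x - y - (x - z) = z - y by rewrite opprB addrC addrA subrK.
  by rewrite distrC.
have psiK n y z : `|psi n y - psi n z| <= (K + K) * `|y - z|.
  have -> : psi n y - psi n z =
    dilated_cutoff n y * (tau (x - y) - tau (x - z)) +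
    (dilated_cutoff n y - dilated_cutoff n z) * tau (x - z).
    rewrite /psi; move: (tau (x - y)) (tau (x - z)) (dilated_cutoff n y) => a b p.
    by ring.
  apply: (le_trans (ler_normD _ _)); rewrite !normrM mulrDl lerD//.
    rewrite ger0_norm ?dilated_cutoff_ge0//.
    apply: (le_trans _ (tauK y z)).
    by rewrite ler_piMl// dilated_cutoff_le1.
  rewrite [X in _ * X]ger0_norm//.
  apply: (le_trans _ (dilated_cutoff_lipschitz K0 HK n y z)).
  by rewrite ler_piMr.
have psix n : psi n x = 0 by rewrite /psi subrr tau_near ?normr0// mulr0.
have psiE n y : psi n (x - y) = dilated_cutoff n (x - y) * tau y.
  by rewrite /psi subKr.

have cphix : continuous (fun y => phi (x - y)) by exact: cont_subr.
have I1 n : nu.-integrable setT (EFin \o (fun y => psi n (x - y))).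
  apply: (weight_bounded_int Hnu (M := 1)).
    apply: continuous_measurable_rV.
    exact: (cont_subr (class_C_cont (Cpsi n 0%N))).
  move=> y; rewrite mul1r ger0_norm// psiE; apply: le_trans (tau_weight y).
  by rewrite ler_piMl// dilated_cutoff_le1.
have I2 n : nu.-integrable setT (EFin \o (fun y => psi n (x - y) * phi (x - y))).
  have cpp : continuous (fun z => psi n z * phi z).
    by apply: contM => //; exact: class_C_cont (Cpsi n 0%N).
  have [M M0 HM] := vanishes_off_bounded cpp (vanishes_offM phi (@psi0 n)).
  apply: (weight_bounded_int Hnu (M := M)).
    by apply: continuous_measurable_rV; exact: (cont_subr cpp).
  move=> y; have [y1|y1] := leP `|y| 1.
    by rewrite psiE tau_near// mulr0 mul0r normr0 mulr_ge0// levy_weight_ge0.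
  by rewrite levy_weight_far; [rewrite mulr1|exact: ltW].
have bound n : \int[nu]_y (psi n (x - y) * phi (x - y)) <= C * phi x.
  have E : levy_form nu (psi n) phi x = \int[nu]_y (psi n (x - y) * phi (x - y))
      - phi x * \int[nu]_y (psi n (x - y)).
    rewrite -RintegralZl// -RintegralB//; last exact: RintZ.
    by apply: eq_Rintegral => y _; rewrite psix; ring.
  have /(le_trans (ler_norm _)) := HB (psi_test n) x.
  rewrite E lerBlDr => /le_trans; apply; rewrite /C mulrDl lerD//.
    rewrite ler_wpM2r// ler_wpM2l//.
    apply: test_norms_le => //; first by rewrite addr_ge0.
      by move=> z v; case: (Cpsi n 1%N) => _ /(_ v)[].
    by move=> z; rewrite ger0_norm.
  rewrite mulrC ler_wpM2r//; apply: le_Rintegral => //; first exact: levy_weight_int.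
  move=> y _; rewrite psiE; apply: le_trans (tau_weight y).
  by rewrite ler_piMl// dilated_cutoff_le1.
have mpsi n : measurable_fun setT (fun y => psi n (x - y) * phi (x - y)).
  exact: Rint_measurable (I2 n).
have fatou : (\int[nu]_y (tau y * phi (x - y))%:E <= (C * phi x)%:E)%E.
  apply: (fatou_bound measurableT mpsi) => [n y _|y _|n].
  - by rewrite mulr_ge0.
  - under eq_fun do rewrite psiE -mulrA.
    have H : dilated_cutoff n (x - y) * (tau y * phi (x - y)) @[n --> \oo] -->
        1 * (tau y * phi (x - y)).
      by apply: cvgM; [exact: dilated_cutoff_cvg|exact: cvg_cst].
    by rewrite mul1r in H; exact: H.
  - have := bound n; rewrite -lee_fin /Rintegral fineK//.
    by apply: integrable_fin_num => //; exact: I2.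
have ctp : continuous (fun y => tau y * phi (x - y)) by exact: contM.
split.
  apply/integrableP; split.
    by apply/measurable_EFinP; exact: continuous_measurable_rV.
  apply: le_lt_trans (ltry (C * phi x)); apply: le_trans fatou.
  rewrite le_eqVlt; apply/orP; left; apply/eqP; apply: eq_integral => y _ /=.
  by rewrite ger0_norm// mulr_ge0.
rewrite -lee_fin /Rintegral fineK//.
apply/fin_numPlt; rewrite (le_lt_trans fatou) ?ltry// andbT.
apply: (@lt_le_trans _ _ 0%E) => //; apply: integral_ge0 => y _.
by rewrite lee_fin mulr_ge0.
Qed.

Let far_average_sym x :
  nu.-integrable setT (EFin \o (fun y => tau y * phi (x + y))) /\
  \int[nu]_y (tau y * phi (x + y)) = \int[nu]_y (tau y * phi (x - y)).
Proof.
have [C _ /(_ x)[I _]] := far_average.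
have [I' E] := levy_symmetric_int Hnu I; split; last first.
  by rewrite -E; apply: eq_Rintegral => y _; rewrite tauN opprK.
by apply: eq_integrable I' => // y _ /=; rewrite tauN opprK.
Qed.

(** Near the support the Lévy operator is bounded; far from it only the far
    part of [nu] is seen, where [f] is dominated by a multiple of [phi]. *)
Lemma levy_op_dominated (r : R) : 0 <= r -> exists2 C : R, 0 <= C &
  forall (f : 'rV[R]_d -> R) (M : R), 0 <= M -> continuous f ->
  vanishes_off r f -> (forall x, `|f x| <= M) -> second_diff_bound M f ->
  forall x, `|levy_op nu f x| <= C * M * phi x.
Proof.
move=> r0; have [CJ CJ0 HJ] := far_average.
have r20 : 0 <= r + 2 by rewrite addr_ge0.
have [k k0 Hk] := positive_on_cube cphi phi_gt0 r20.
exists ((levy_mass nu + CJ) / k).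
  by rewrite divr_ge0 ?addr_ge0 ?levy_mass_ge0// ltW.
move=> f M M0 cf f0 fM f2 x.
have [xr|xr] := leP `|x| (r + 2).
  apply: (le_trans (levy_op_bound Hnu cf f2 x)).
  have -> : (levy_mass nu + CJ) / k * M * phi x =
      (M * levy_mass nu + M * CJ) * (phi x / k) by ring.
  rewrite -[leLHS]mulr1; apply: ler_pM => //.
  - by rewrite mulr_ge0// levy_mass_ge0.
  - by rewrite lerDl mulr_ge0.
  - by rewrite ler_pdivlMr// mul1r Hk.
have fx : f x = 0 by apply: f0; apply: le_lt_trans xr; rewrite lerDl.
have hf z y : `|x| <= `|z| + `|y| -> `|f z| <= M / k * (tau y * phi z).
  move=> xzy; have [zr|zr] := leP `|z| r; last first.
    rewrite f0// normr0 mulr_ge0//; first by rewrite divr_ge0// ltW.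
    exact: mulr_ge0.
  rewrite tau_far ?mul1r; last first.
    rewrite -(ltrD2l r); apply: (lt_le_trans xr); apply: (le_trans xzy).
    by rewrite lerD2r.
  apply: (le_trans (fM z)); rewrite -mulrA ler_peMr// ler_pdivlMl// mulr1.
  by apply: Hk; apply: (le_trans zr); rewrite lerDl.
have [Ip Ep] := far_average_sym x.
have [Im Hm] := HJ x.
have Isum : nu.-integrable setT (EFin \o (fun y =>
    M / k / 2 * (tau y * phi (x + y) + tau y * phi (x - y)))).
  by apply: RintZ => //; exact: RintD.
apply: (@le_trans _ _ (\int[nu]_y
    (M / k / 2 * (tau y * phi (x + y) + tau y * phi (x - y))))).
  apply: Rintegral_norm_le => //; first exact: (levy_op_int Hnu cf f2 x).
  move=> y _; rewrite /second_diff fx sub0r normrN normrM [`|2^-1|]ger0_norm//.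
  rewrite mulrAC ler_wpM2r//; apply: (le_trans (ler_normD _ _)).
  rewrite mulrDr lerD//; apply: hf; first by rewrite -{1}(addrK y x) ler_normB.
  by rewrite -{1}(subrK y x) ler_normD.
rewrite RintegralZl//; last exact: RintD.
rewrite RintegralD// Ep.
set J := \int[nu]_y (tau y * phi (x - y)) in Hm *.
have -> : M / k / 2 * (J + J) = M / k * J by field; rewrite gt_eqF.
have -> : (levy_mass nu + CJ) / k * M * phi x =
    M / k * (levy_mass nu * phi x + CJ * phi x) by ring.
rewrite ler_wpM2l ?divr_ge0 ?(ltW k0)//; apply: (le_trans Hm).
by rewrite lerDr mulr_ge0// levy_mass_ge0.
Qed.

(** Localising [phi] around [x] makes the compactly supported estimates
    available for the increments [y] with [|y| <= 2]. *)
Let localised x z : R := phi z * cutoff (4^-1 *: z + (- (4^-1 *: x))).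

Let localised_C2 x : class_C 2 (localised x).
Proof. exact: (class_CM Cphi (class_C_rV_affine _ _ (class_C_cutoff R d 2))). Qed.

Let localised_vanish x : vanishes_off (8 + `|x|) (localised x).
Proof.
move=> z hz; rewrite /localised cutoff0 ?mulr0//.
rewrite -scalerBr normrZ ger0_norm ?invr_ge0// ltr_pdivlMl//.
have -> : 4 * 2 = 8 :> R by ring.
rewrite -(ltrD2r `|x|); apply: (lt_le_trans hz).
by rewrite -{1}(subrK x z) ler_normD.
Qed.

Let localisedE x y : `|y| <= 2 -> localised x (x + y) = phi (x + y).
Proof.
move=> y2; rewrite /localised cutoff1 ?mulr1// -scalerBr (addrC x) addrK normrZ.
by rewrite ger0_norm ?invr_ge0// ler_pdivrMl// mulr1 (le_trans y2)// ler_nat.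
Qed.

Let phi_second_diff_int x : nu.-integrable setT (EFin \o second_diff phi x).
Proof.
have [M M0 [_ HM]] := C2_second_diff_bound (localised_C2 x) (@localised_vanish x).
have [C _ /(_ x)[Im _]] := far_average.
have [Ip _] := far_average_sym x.
apply: (@Rint_le _ _ _ nu setT measurableT _ (fun y => (M + phi x) * levy_weight y +
    (tau y * phi (x + y) + tau y * phi (x - y)))).
- by apply: continuous_measurable_rV; exact: cont_second_diff.
- move=> y _; have [y2|y2] := leP `|y| 2.
    have -> : second_diff phi x y = second_diff (localised x) x y.
      rewrite /second_diff localisedE// localisedE ?normrN//.
      by have := @localisedE x 0; rewrite addr0 normr0 => ->.
    apply: (le_trans (HM x y)); rewrite mulrDl -addrA lerDl.
    by rewrite !addr_ge0 ?mulr_ge0// levy_weight_ge0.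
  rewrite levy_weight_far; last by rewrite ltW// (lt_trans _ y2)// ltr1n.
  rewrite tau_far// !mul1r mulr1 /second_diff ler_norml.
  have := phi_ge0 (x + y); have := phi_ge0 (x - y); have := phi_ge0 x => ? ? ?.
  by apply/andP; split; lra.
apply: RintD => //; last exact: RintD.
by apply: RintZ => //; exact: levy_weight_int.
Qed.

Let form_int (chi : 'rV[R]_d -> R) (K : R) x : 0 <= K -> continuous chi ->
  (forall z, 0 <= chi z <= 1) ->
  (forall y z, `|chi y - chi z| <= K * `|y - z|) ->
  nu.-integrable setT
    (EFin \o (fun y => (chi x - chi (x - y)) * (phi x - phi (x - y)))).
Proof.
move=> K0 cchi chi01 chiK.
have [L L0 HLx] := C1_lipschitz (class_CS (localised_C2 x)) (@localised_vanish x).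
have [C _ /(_ x)[Im _]] := far_average.
apply: (@Rint_le _ _ _ nu setT measurableT _ (fun y =>
    (K * L * 2 ^+ 2 + phi x) * levy_weight y + tau y * phi (x - y))).
- apply: continuous_measurable_rV; apply: contM; apply: contB;
    by [exact: cst_continuous|exact: cont_subr].
- move=> y _; rewrite normrM; have [y2|y2] := leP `|y| 2.
    have -> : phi x - phi (x - y) = localised x x - localised x (x - y).
      rewrite localisedE ?normrN//.
      by have := @localisedE x 0; rewrite addr0 normr0 => ->.
    apply: (@le_trans _ _ (K * L * 2 ^+ 2 * levy_weight y)).
      rewrite -(mulrA (K * L)).
      apply: (le_trans (ler_pM _ _ (chiK _ _) (HLx _ _))) => //.
      rewrite subKr mulrACA -expr2 ler_wpM2l ?mulr_ge0//.
      by apply: levy_weight_near => //; rewrite ler1n.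
    rewrite mulrDl -addrA lerDl addr_ge0 ?mulr_ge0// ?levy_weight_ge0//.
  rewrite levy_weight_far; last by rewrite ltW// (lt_trans _ y2)// ltr1n.
  rewrite tau_far// mul1r mulr1.
  apply: (@le_trans _ _ (phi x + phi (x - y))); last first.
    by rewrite lerD2r lerDr mulr_ge0// mulr_ge0.
  rewrite -[leRHS]mul1r; apply: ler_pM => //.
    have := chi01 x; have := chi01 (x - y) => /andP[? ?] /andP[? ?].
    by rewrite ler_norml; apply/andP; split; lra.
  rewrite ler_norml.
  have := phi_ge0 (x - y); have := phi_ge0 x => ? ?.
  by apply/andP; split; lra.
apply: RintD => //; apply: RintZ => //; exact: levy_weight_int.
Qed.

(** The product rule L(chi phi) = chi L phi + phi L chi - B(chi, phi) bounds each
    term by [phi], with constants that do not see the dilation. *)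
Lemma levy_op_cutoff_bound : exists2 C : R, 0 <= C &
  forall n x, `|levy_op nu (fun z => dilated_cutoff n z * phi z) x| <= C * phi x.
Proof.
have [K K0 HK] := C1_lipschitz (class_C_cutoff R d 1) (@cutoff0 R d).
have [M M0 [_ HM]] := C2_second_diff_bound (class_C_cutoff R d 2) (@cutoff0 R d).
have HMn := dilated_cutoff_second_diff M0 HM.
exists (c + M * levy_mass nu + c * Num.max 1 (d%:R * K)).
  rewrite !addr_ge0// mulr_ge0// ?levy_mass_ge0// le_max ler01//.
move=> n x; pose chi := @dilated_cutoff R d n.
have cchi : continuous chi := class_C_cont (class_C_dilated_cutoff R d n 0).
have chi01 z : 0 <= chi z <= 1.
  by rewrite dilated_cutoff_ge0 dilated_cutoff_le1.
have chiK := dilated_cutoff_lipschitz K0 HK n.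
have Im := form_int x K0 cchi chi01 chiK.
have [Ip Ep] := levy_symmetric_int Hnu Im.
have I1 := phi_second_diff_int x.
have I2 := levy_op_int Hnu cchi (HMn n) x.
have -> : levy_op nu (fun z => chi z * phi z) x =
   chi x * levy_op nu phi x + phi x * levy_op nu chi x - levy_form nu chi phi x.
  pose B y := (chi x - chi (x - y)) * (phi x - phi (x - y)).
  have -> : levy_form nu chi phi x = \int[nu]_y (2^-1 * (B y + B (- y))).
    rewrite RintegralZl//; last exact: RintD.
    rewrite RintegralD// Ep /levy_form -/B; by field.
  have -> : chi x * levy_op nu phi x = \int[nu]_y (chi x * second_diff phi x y).
    by rewrite RintegralZl.
  have -> : phi x * levy_op nu chi x = \int[nu]_y (phi x * second_diff chi x y).
    by rewrite RintegralZl.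
  rewrite -RintegralD//; [|exact: RintZ..].
  rewrite -RintegralB//; [|by apply: RintD => //; exact: RintZ|]; last first.
    by apply: RintZ => //; exact: RintD.
  apply: eq_Rintegral => y _; rewrite /second_diff /B opprK.
  move: (chi x) (chi (x + y)) (chi (x - y)) (phi x) (phi (x + y)) (phi (x - y)).
  by move=> a0 a1 a2 b0 b1 b2; field.
have chi_test : Cc_infty setT chi.
  split => //; first by move=> k; exact: class_C_dilated_cutoff.
  exact: vanishes_off_compact (@dilated_cutoff0 R d n).
have /andP[chi0 chi1] := chi01 x.
apply: (le_trans (ler_normB _ _)); rewrite mulrDl lerD//.
  apply: (le_trans (ler_normD _ _)); rewrite mulrDl lerD//.
    rewrite normrM (ger0_norm chi0); apply: le_trans (HL x).
    by rewrite ler_piMl.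
  rewrite normrM (ger0_norm (phi_ge0 x)) mulrC ler_wpM2r//.
  exact: (levy_op_bound Hnu cchi (HMn n) x).
apply: (le_trans (HB chi_test x)); rewrite ler_wpM2r// ler_wpM2l//.
apply: test_norms_le => //.
  by move=> z v; case: (class_C_dilated_cutoff R d n 1) => _ /(_ v)[].
by move=> z; have /andP[? ?] := chi01 z; rewrite ger0_norm.
Qed.

End weight_function.

(** * Functions of time with a weak derivative *)

Section exhaustion.
Variables (R : realType) (T : R).
Hypothesis T0 : 0 < T.

(** Distance to the ends of [ ]0, T[ ] of the [k]-th interval of an exhaustion; the
    shift by 3 keeps every interval nondegenerate. *)
Definition time_gap (k : nat) : R := T / k.+3%:R.

Lemma time_gap_gt0 k : 0 < time_gap k.
Proof. by rewrite divr_gt0. Qed.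

Lemma time_gap_lt k : time_gap k < T - time_gap k.
Proof.
rewrite ltrBrDr -mulrDr gtr_pMr// -mulr2n -[_ *+ 2]mulr_natl ltr_pdivrMr// mul1r.
by rewrite ltr_nat.
Qed.

Lemma time_gap_ltT k : T - time_gap k < T.
Proof. by rewrite gtrBl time_gap_gt0. Qed.

Lemma time_exhaustion t : 0 < t -> t < T ->
  exists k, time_gap k <= t <= T - time_gap k.
Proof.
move=> t0 tT; pose e := Num.min t (T - t).
have e0 : 0 < e by rewrite lt_min t0 subr_gt0.
exists (Num.truncn (T / e)).
have : time_gap (Num.truncn (T / e)) <= e.
  rewrite /time_gap ler_pdivrMr// -ler_pdivrMl// mulrC.
  apply: (le_trans (ltW (truncnS_gt (T / e)))); rewrite ler_nat.
  by rewrite leqW// leqW.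
by rewrite le_min => /andP[-> ?]; rewrite lerBrDl -lerBrDr.
Qed.

End exhaustion.

Section weak_derivative.
Variable R : realType.
Local Notation mu := (@lebesgue_measure R).

Definition step_rate (x : R) : R := 'D_1 (@smooth_step R) x.

Lemma is_derive_smooth_step (x : R) : is_derive x (1 : R) (@smooth_step R) (step_rate x).
Proof.
have [_ /(_ 1)[dS _]] := class_C_smooth_step R 1.
exact: derivableP (dS x).
Qed.

Lemma cont_step_rate : continuous step_rate.
Proof. by have [_ /(_ 1)[_]] := class_C_smooth_step R 1. Qed.

Lemma step_rate0 x : x < 0 \/ 1 < x -> step_rate x = 0.
Proof.
move=> hx; have : exists a : R, {near x, @smooth_step R =1 cst a}.
  case: hx => hx.
    exists 0; near=> y; rewrite smooth_step0// ltW//.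
    by near: y; exact: lt_nbhsl.
  exists 1; near=> y; rewrite smooth_step1// ltW//.
  by near: y; exact: lt_nbhsr.
by move=> [a ha]; rewrite /step_rate (near_eq_derive _ ha) derive_cst.
Unshelve. all: by end_near. Qed.

Lemma step_rate_bounded : exists2 B : R, 0 <= B & forall x, `|step_rate x| <= B.
Proof.
have cn : {within `[0, 1], continuous (fun x => `|step_rate x|)}.
  apply: continuous_subspaceT => x.
  apply: (continuous_comp (@cont_step_rate x)); exact: norm_continuous.
have [z _ Hz] := EVT_max (@ler01 R) cn.
exists `|step_rate z|; first exact: normr_ge0.
move=> x.
have [x0|x0] := ltP x 0; first by rewrite step_rate0 ?normr0//; left.
have [x1|x1] := ltP 1 x; first by rewrite step_rate0 ?normr0//; right.
by apply: Hz; rewrite in_itv /= x0 x1.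
Qed.

Variable dl : R.
Hypothesis dl0 : 0 < dl.

Definition ramp (s r : R) : R := smooth_step (dl^-1 * r + - (dl^-1 * s)).
Definition ramp_rate (s r : R) : R :=
  dl^-1 * step_rate (dl^-1 * r + - (dl^-1 * s)).

Lemma ramp_ge0 s r : 0 <= ramp s r. Proof. exact: smooth_step_ge0. Qed.
Lemma ramp_le1 s r : ramp s r <= 1. Proof. exact: smooth_step_le1. Qed.

Lemma ramp0 s r : r <= s -> ramp s r = 0.
Proof.
by move=> rs; rewrite /ramp smooth_step0// subr_le0 ler_wpM2l// invr_ge0 ltW.
Qed.

Lemma ramp1 s r : s + dl <= r -> ramp s r = 1.
Proof.
move=> rs; rewrite /ramp smooth_step1// -mulrBr ler_pdivlMl// mulr1.
by rewrite lerBrDl.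
Qed.

Lemma class_C_ramp s k : class_C k (ramp s).
Proof. exact: class_C_smooth_step_affine. Qed.

Lemma is_derive_ramp s (r : R) : is_derive r (1 : R) (ramp s) (ramp_rate s r).
Proof.
rewrite /ramp_rate mulrC.
apply: (@is_derive1_comp _ (@smooth_step R) (fun r => dl^-1 * r + - (dl^-1 * s))).
  exact: is_derive_smooth_step.
apply: is_derive_eq.
by rewrite subr0 /GRing.scale /= mulr1.
Qed.

Lemma ramp_rate0 s r : r < s \/ s + dl < r -> ramp_rate s r = 0.
Proof.
move=> h; rewrite /ramp_rate step_rate0 ?mulr0// -mulrBr.
case: h => h; [left|right].
  by rewrite pmulr_rlt0 ?invr_gt0// subr_lt0.
by rewrite ltr_pdivlMl// mulr1 ltrBrDl.
Qed.

Lemma cont_ramp_rate s : continuous (ramp_rate s).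
Proof. by apply: contZ; apply: cont_affine; exact: cont_step_rate. Qed.

Lemma ramp_rate_int s : \int[mu]_(r in `[s, s + dl]) ramp_rate s r = 1.
Proof.
have sdl : s < s + dl by rewrite ltrDl.
have cr : continuous (ramp s) := class_C_cont (class_C_ramp s 0).
rewrite /Rintegral (@continuous_FTC2 _ (ramp_rate s) (ramp s))//.
- by rewrite ramp1// ramp0//= subr0.
- by apply: continuous_subspaceT; exact: cont_ramp_rate.
- split.
  + by move=> r _; case: (is_derive_ramp s r).
  + by apply: cvg_at_right_filter; exact: cr.
  + by apply: cvg_at_left_filter; exact: cr.
- by move=> r _; rewrite derive1E; case: (is_derive_ramp s r).
Qed.

Lemma ramp_rate_bounded : exists2 B : R, 0 <= B &
  forall s r, `|ramp_rate s r| <= dl^-1 * B.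
Proof.
have [B B0 HB] := step_rate_bounded; exists B => // s r.
by rewrite normrM ger0_norm ?invr_ge0 ?(ltW dl0)// ler_wpM2l// invr_ge0 ltW.
Qed.

(** The rate of the ramp is an approximate identity, one-sided and continuous;
    its error at [s] is controlled by the mean oscillation at [s]. *)
Lemma ramp_rate_average (B : R) (A : R -> R) (s : R) : 0 <= B ->
  (forall x, `|step_rate x| <= B) -> mu.-integrable setT (EFin \o A) ->
  (`|\int[mu]_r (ramp_rate s r * A r) - A s|%:E <=
   (4 * B)%:E * davg A s (2 * dl))%E.
Proof.
move=> B0 HB IA; pose I := `[s, s + dl]%classic : set (measurableTypeR R).
have mI : measurable I by exact: measurable_itv.
have muI : (mu I < +oo)%E.
  by rewrite /I lebesgue_measure_itv/=; case: ifP; rewrite -?EFinB ltry.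
have mA : measurable_fun setT A := Rint_measurable IA.
have rB r : `|ramp_rate s r| <= dl^-1 * B.
  by rewrite normrM ger0_norm ?invr_ge0 ?(ltW dl0)// ler_wpM2l// invr_ge0 ltW.
have mr : measurable_fun setT (ramp_rate s).
  by apply: continuous_measurable_fun; exact: cont_ramp_rate.
have IrA : mu.-integrable setT (EFin \o (fun r => ramp_rate s r * A r)).
  apply: (@Rint_le _ _ _ mu setT measurableT _ (fun r => dl^-1 * B * `|A r|)).
  - exact: measurable_funM.
  - by move=> r _; rewrite normrM ler_wpM2r.
  - by apply: RintZ => //; exact: Rint_norm.
have Ir : mu.-integrable I (EFin \o ramp_rate s).
  apply: measurable_bounded_integrable => //.
  - exact: measurable_funTS.
  - exists (dl^-1 * B); split; first exact: num_real.
    by move=> x Bx r _ /=; apply: (le_trans (rB r)); exact: ltW.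
have IrAI : mu.-integrable I (EFin \o (fun r => ramp_rate s r * A r)).
  exact: integrableS IrA.
have E : \int[mu]_r (ramp_rate s r * A r) - A s =
         \int[mu]_(r in I) (ramp_rate s r * (A r - A s)).
  have -> : \int[mu]_r (ramp_rate s r * A r) =
            \int[mu]_(r in I) (ramp_rate s r * A r).
    rewrite [RHS]Rintegral_mkcond; apply: eq_Rintegral => r _.
    rewrite patchE; case: ifPn => //; rewrite notin_setE /I /= in_itv /=.
    move=> /negP; rewrite negb_and -!ltNge => /orP h.
    by rewrite ramp_rate0 ?mul0r.
  rewrite -[X in _ - X]mulr1 -(ramp_rate_int s) -/I -RintegralZl//.
  rewrite -RintegralB//; last exact: RintZ.
  by apply: eq_Rintegral => r _; rewrite mulrBr; congr (_ - _); rewrite mulrC.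
rewrite E.
have IAs : mu.-integrable I (EFin \o (fun r => A r - A s)).
  apply: RintB => //; first exact: integrableS IA.
  apply: measurable_bounded_integrable => //.
  exists `|A s|; split; first exact: num_real.
  by move=> x Bx r _ /=; exact: ltW.
have IrAs : mu.-integrable I (EFin \o (fun r => ramp_rate s r * (A r - A s))).
  apply: (@Rint_le _ _ _ mu I mI _ (fun r => dl^-1 * B * `|A r - A s|)).
  - apply: measurable_funM; first exact: measurable_funTS.
    exact: Rint_measurable IAs.
  - by move=> r _; rewrite normrM ler_wpM2r.
  - by apply: RintZ => //; exact: Rint_norm.
have IAsn := Rint_norm IAs.
apply: (@le_trans _ _ (\int[mu]_(r in I) (dl^-1 * B * `|A r - A s|))%:E).
  rewrite lee_fin; apply: Rintegral_norm_le => //; first exact: RintZ.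
  by move=> r _; rewrite normrM ler_wpM2r.
rewrite RintegralZl// /davg /iavg lebesgue_measure_ball; last first.
  by rewrite mulr_ge0// ltW.
have d40 : 0 < 2 * dl *+ 2 by rewrite mulrn_wgt0// mulr_gt0.
rewrite inver gt_eqF//= muleA -EFinM.
have -> : 4 * B * (2 * dl *+ 2)^-1 = dl^-1 * B.
  by rewrite -mulr_natl; field; rewrite gt_eqF.
rewrite EFinM lee_wpmul2l// ?lee_fin ?mulr_ge0 ?invr_ge0 ?(ltW dl0)//.
rewrite /Rintegral fineK; last exact: integrable_fin_num IAsn.
apply: (@ge0_subset_integral _ _ _ mu) => //.
- by apply: measurable_ball.
- apply/measurable_EFinP; apply: measurableT_comp => //.
  by apply: measurable_funB; [exact: measurable_funTS|exact: measurable_cst].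
move=> r; rewrite /I /= in_itv /= => /andP[sr rs].
rewrite /ball /= ltr_distlC; apply/andP; split; lra.
Qed.

End weak_derivative.

Section weak_derivative_increments.
Variable R : realType.
Local Notation mu := (@lebesgue_measure R).

Let dl k : R := k.+1%:R^-1.
Let dl0 k : 0 < dl k. Proof. by rewrite /dl invr_gt0. Qed.

Let dl_small (e : R) : 0 < e -> \forall k \near \oo, dl k < e.
Proof. by move=> e0; exact: (near_infty_natSinv_lt (PosNum e0)). Qed.

Lemma ramp_rate_cvg (A : R -> R) (s : R) : mu.-integrable setT (EFin \o A) ->
  lebesgue_pt A s ->
  \int[mu]_r (ramp_rate (dl k) s r * A r) @[k --> \oo] --> A s.
Proof.
move=> IA As; have [B B0 HB] := step_rate_bounded R.
apply/cvgrPdist_le => e e0.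
have B1 : 0 < 4 * B + 1 by rewrite ltr_wpDl// mulr_ge0.
have /fine_cvgP[fn /cvgrPdist_lt/(_ (e / (4 * B + 1)))] := As.
rewrite divr_gt0// => /(_ isT) cv.
have [c /= c0 Hc] := filterI fn cv.
near=> k; rewrite distrC -lee_fin.
apply: (le_trans (ramp_rate_average (dl0 k) s B0 HB IA)).
have d2 : 0 < 2 * dl k by rewrite mulr_gt0.
have [|//|/= fk] := Hc (2 * dl k).
  rewrite /ball /= sub0r normrN gtr0_norm// mulrC -ltr_pdivlMr//.
  by near: k; apply: dl_small; rewrite divr_gt0.
rewrite sub0r normrN => hk.
rewrite -(fineK fk) -EFinM lee_fin.
apply: (@le_trans _ _ ((4 * B + 1) * (e / (4 * B + 1)))).
  apply: ler_pM; rewrite ?mulr_ge0 ?lerDl//; first by rewrite fine_ge0// davg_ge0.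
  exact: le_trans (ler_norm _) (ltW hk).
by rewrite mulrCA divff ?mulr1// gt_eqF.
Unshelve. all: by end_near. Qed.

Variables (T : R) (a b : R -> R).
Hypotheses (Ia : forall e T', 0 < e -> e < T' -> T' < T ->
  mu.-integrable `[e, T'] (EFin \o a)).
Hypotheses (Ib : forall e T', 0 < e -> e < T' -> T' < T ->
  mu.-integrable `[e, T'] (EFin \o b)).
Hypothesis weak : forall eta : R -> R, (forall k, class_C k eta) ->
  forall e T', 0 < e -> e < T' -> T' < T -> (forall r, r < e \/ T' < r -> eta r = 0) ->
  \int[mu]_(r in `]0, T[) (derive1 eta r * a r - eta r * b r) = 0.

Let ramp_cvg (s r : R) : ramp (dl k) s r @[k --> \oo] --> (if s < r then 1 else 0 : R).
Proof.
case: ifPn => [sr|]; last first.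
  by rewrite -leNgt => rs; under eq_fun do rewrite ramp0//; exact: cvg_cst.
apply: cvg_near_cst; near=> k; apply: ramp1 => //.
have : dl k < r - s by near: k; apply: dl_small; rewrite subr_gt0.
by rewrite ltrBrDl => /ltW.
Unshelve. all: by end_near. Qed.

(** The identity is the weak formulation tested with the difference of two
    ramps, at times which are Lebesgue points of [a]. *)
Lemma weak_derivative_increment : exists2 N : set (measurableTypeR R),
  mu.-negligible N & forall s t, 0 < s -> s < t -> t < T -> ~ N s -> ~ N t ->
  a s - a t = \int[mu]_(r in `[s, t]) b r.
Proof.
have [T0|T0] := leP T 0.
  exists set0; first exact: negligible_set0.
  move=> s t s0 st tT; suff : 0 < 0 :> R by rewrite ltxx.
  exact: lt_le_trans (lt_trans s0 (lt_trans st tT)) T0.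
pose e n := time_gap T n.
have e0 n : 0 < e n by exact: time_gap_gt0.
have eT n : e n < T - e n by exact: time_gap_lt.
pose I n := `[e n, T - e n]%classic : set (measurableTypeR R).
have mI n : measurable (I n) by exact: measurable_itv.
have eT' n : T - e n < T by exact: time_gap_ltT.
have IA n : mu.-integrable setT (EFin \o (a \_ (I n))).
  have /integrable_mkcond := Ia (e0 n) (eT n) (eT' n).
  by move=> /(_ (mI n)); rewrite restrict_EFin.
have IB n : mu.-integrable setT (EFin \o (b \_ (I n))).
  have /integrable_mkcond := Ib (e0 n) (eT n) (eT' n).
  by move=> /(_ (mI n)); rewrite restrict_EFin.
pose N n := ~` [set x | lebesgue_pt (a \_ (I n)) x].
exists (\bigcup_n N n).
  apply: negligible_bigcup => n.
  exact: lebesgue_differentiation (open_integrable_locally openT (IA n)).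
move=> s t s0 st tT Ns Nt.
have m0 : 0 < Num.min s (T - t) by rewrite lt_min s0 subr_gt0.
have [n [es te]] : exists n, e n < s /\ t < T - e n.
  exists (Num.truncn (T / Num.min s (T - t))).
  set n := Num.truncn _.
  have : e n < Num.min s (T - t).
    rewrite /e /time_gap ltr_pdivrMr// -ltr_pdivrMl// mulrC.
    apply: (lt_le_trans (truncnS_gt _)); rewrite ler_nat; exact: leqW.
  by rewrite lt_min => /andP[-> h]; split => //; rewrite ltrBrDr -ltrBrDl.
pose A := a \_ (I n); pose B := b \_ (I n).
have ptA x : ~ (\bigcup_n N n) x -> lebesgue_pt A x.
  by move=> nx; apply: contrapT => h; apply: nx; exists n.
have inI r : s <= r <= t -> r \in I n.
  by move=> /andP[? ?]; rewrite inE /I /= in_itv /=; apply/andP; split; lra.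
have As : A s = a s by rewrite /A patchE inI// lexx ltW.
have At : A t = a t by rewrite /A patchE inI// lexx ltW.
pose eta k r := ramp (dl k) s r - ramp (dl k) t r.
have eta_le1 k r : `|eta k r| <= 1.
  have ? := ramp_ge0 (dl k) s r; have ? := ramp_ge0 (dl k) t r.
  have ? := ramp_le1 (dl k) s r; have ? := ramp_le1 (dl k) t r.
  by rewrite ler_norml; apply/andP; split; rewrite /eta; lra.
have Ceta k j : class_C j (eta k).
  have -> : eta k = fun r => ramp (dl k) s r + (-1) * ramp (dl k) t r.
    by apply/funext => r; rewrite mulN1r.
  apply: class_CD; first exact: class_C_ramp.
  by apply: class_CM; [exact: class_C_cst|exact: class_C_ramp].
have Deta k r : derive1 (eta k) r = ramp_rate (dl k) s r - ramp_rate (dl k) t r.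
  rewrite derive1E.
  have [ds <-] := is_derive_ramp (dl k) s r.
  have [dt <-] := is_derive_ramp (dl k) t r.
  exact: (deriveB ds dt).
have mrr k x : measurable_fun [set: measurableTypeR R] (ramp_rate (dl k) x).
  by apply: continuous_measurable_fun; exact: cont_ramp_rate.
have mA : measurable_fun [set: measurableTypeR R] A := Rint_measurable (IA n).
have mB : measurable_fun [set: measurableTypeR R] B := Rint_measurable (IB n).
have meta k : measurable_fun [set: measurableTypeR R] (eta k).
  by apply: continuous_measurable_fun; exact: class_C_cont (Ceta k 0%N).
have IrA k x : mu.-integrable setT (EFin \o (fun r => ramp_rate (dl k) x r * A r)).
  have [C C0 HC] := ramp_rate_bounded (dl0 k).
  apply: (@Rint_le _ _ _ mu setT measurableT _ (fun r => (dl k)^-1 * C * `|A r|)).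
  - exact: measurable_funM.
  - by move=> r _; rewrite normrM ler_wpM2r.
  - by apply: RintZ => //; exact: Rint_norm (IA n).
have IeB k : mu.-integrable setT (EFin \o (fun r => eta k r * B r)).
  apply: (@Rint_le _ _ _ mu setT measurableT _ (fun r => `|B r|)).
  - exact: measurable_funM.
  - by move=> r _; rewrite normrM ler_piMl.
  - exact: Rint_norm (IB n).
have key : \forall k \near \oo,
  \int[mu]_r (ramp_rate (dl k) s r * A r) - \int[mu]_r (ramp_rate (dl k) t r * A r)
  = \int[mu]_r (eta k r * B r).
  have Te : 0 < T - e n - t by rewrite subr_gt0.
  near=> k; have dk : dl k < T - e n - t by near: k; exact: dl_small.
  have z1 r : r < e n \/ T - e n < r -> eta k r = 0.
    case=> h; first by rewrite /eta !ramp0 ?subrr//; lra.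
    by rewrite /eta !ramp1 ?subrr//; have := dl0 k; lra.
  have := weak (Ceta k) (e0 n) (eT n) (eT' n) z1.
  rewrite -RintegralB//.
  suff -> : \int[mu]_(r in `]0, T[) (derive1 (eta k) r * a r - eta k r * b r) =
    \int[mu]_r (ramp_rate (dl k) s r * A r - ramp_rate (dl k) t r * A r
                - eta k r * B r).
    rewrite (RintegralB measurableT (RintB measurableT (IrA k s) (IrA k t)) (IeB k)).
    by move=> /eqP; rewrite subr_eq0 => /eqP.
  rewrite Rintegral_mkcond; apply: eq_Rintegral => r _.
  rewrite patchE /A /B !patchE.
  have [rI|rI] := boolP (r \in I n).
    rewrite mem_set; first by rewrite Deta mulrBl.
    move: rI; rewrite inE /I /= !in_itv /= => /andP[? ?].
    by have en := e0 n; have eTn := eT' n; apply/andP; split; lra.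
  rewrite !mulr0 !subr0; case: ifPn => // _.
  have h : r < e n \/ T - e n < r.
    move: rI; rewrite notin_setE /I /= in_itv /= => /negP.
    by rewrite negb_and -!ltNge => /orP.
  rewrite z1// mul0r subr0 Deta !ramp_rate0 ?subrr ?mul0r//.
  - by case: h => h; [left|right]; have := dl0 k; lra.
  - by case: h => h; [left|right]; have := dl0 k; lra.
have cX := ramp_rate_cvg (IA n) (ptA _ Ns).
have cY := ramp_rate_cvg (IA n) (ptA _ Nt).
have cZ : \int[mu]_r (eta k r * B r) @[k --> \oo] -->
    \int[mu]_r ((if s < r <= t then 1 else 0) * B r).
  apply: (@Rdominated_cvg _ _ R mu setT measurableT _ _ (fun r => `|B r|) _ _ _ _ _).2.
  - by move=> k; exact: measurable_funM.
  - apply: measurable_funM => //.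
    apply: measurable_fun_ifT => //.
    apply: (measurable_and) => //.
      exact: measurable_fun_ltr.
    exact: measurable_fun_ler.
  - apply: aeW => r _; apply: cvgMl.
    have -> : (if s < r <= t then 1 else 0 : R) =
        (if s < r then 1 else 0) - (if t < r then 1 else 0).
      have [sr|sr] /= := ltP s r; have [tr|tr] /= := ltP t r.
      + by rewrite subrr.
      + by rewrite subr0.
      + by exfalso; move: (lt_le_trans (lt_trans st tr) sr); rewrite ltxx.
      + by rewrite subr0.
    by apply: cvgB; exact: ramp_cvg.
  - exact: Rint_norm (IB n).
  - by apply: aeW => r k _; rewrite normrM ler_piMl.
have cXY : \int[mu]_r (ramp_rate (dl k) s r * A r) -
    \int[mu]_r (ramp_rate (dl k) t r * A r) @[k --> \oo] --> a s - a t.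
  by rewrite -As -At; apply: cvgB; [exact: cX|exact: cY].
have -> : a s - a t = \int[mu]_r ((if s < r <= t then 1 else 0) * B r).
  apply: (cvg_unique _ cXY) => //.
  apply: cvg_trans cZ; apply: near_eq_cvg.
  by apply: filterS key => k ->.
have Ist : mu.-integrable `]s, t] (EFin \o b).
  apply: integrableS (Ib (e0 n) (eT n) (eT' n)) => //.
  move=> r /=; rewrite !in_itv /= => /andP[? ?].
  by apply/andP; split; lra.
rewrite -Rintegral_itv_obnd_cbnd// [RHS]Rintegral_mkcond.
apply: eq_Rintegral => r _; rewrite patchE mem_setE in_itv /=.
case: ifPn => [/andP[sr rt]|_]; last by rewrite mul0r.
by rewrite mul1r /B patchE inI// rt ltW.
Unshelve. all: by end_near. Qed.

End weak_derivative_increments.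

(** * The Riesz representation theorem on R^d *)

Section Cc_functions.
Variables (R : realType) (d : nat).
Implicit Types f g h : 'rV[R]_d -> R.

Lemma Cc_rVP f : Cc f <-> continuous f /\ exists r : R, vanishes_off r f.
Proof.
split=> [[cf kf]|[cf [r fr]]].
  by split => //; have [r _ fr] := Cc_vanishes_off kf; exists r.
by split => //; exact: vanishes_off_compact fr.
Qed.

Lemma CcD f g : Cc f -> Cc g -> Cc (fun x => f x + g x).
Proof.
move=> /Cc_rVP[cf [r fr]] /Cc_rVP[cg [s gs]]; apply/Cc_rVP; split.
  exact: contD.
by exists (Num.max r s) => x; rewrite gt_max => /andP[/fr -> /gs ->]; rewrite addr0.
Qed.

Lemma CcM f g : Cc f -> continuous g -> Cc (fun x => f x * g x).
Proof.
move=> /Cc_rVP[cf [r fr]] cg; apply/Cc_rVP; split; first exact: contM.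
by exists r; exact: vanishes_offM.
Qed.

Lemma CcZ (a : R) f : Cc f -> Cc (fun x => a * f x).
Proof.
move=> /Cc_rVP[cf [r fr]]; apply/Cc_rVP; split; first exact: contZ.
by exists r => x /fr ->; rewrite mulr0.
Qed.

Lemma Cc_comp f (F : R -> R) : Cc f -> continuous F -> F 0 = 0 -> Cc (F \o f).
Proof.
move=> /Cc_rVP[cf [r fr]] cF F0; apply/Cc_rVP; split.
  by move=> x; apply: (continuous_comp (cf x)); exact: cF.
by exists r => x /fr /= ->.
Qed.

Lemma CcB f g : Cc f -> Cc g -> Cc (fun x => f x - g x).
Proof.
move=> Cf /(CcZ (-1)) /(CcD Cf); congr Cc.
by apply/funext => x; rewrite mulN1r.
Qed.

Lemma Cc0 : Cc (fun _ : 'rV[R]_d => 0 : R).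
Proof.
by apply/Cc_rVP; split; [exact: cst_continuous|exists 0].
Qed.

Lemma Cc_sum (F : nat -> 'rV[R]_d -> R) n : (forall i, Cc (F i)) ->
  Cc (fun x => \sum_(i < n) F i x).
Proof.
move=> CF; elim: n => [|n IH].
  by under eq_fun do rewrite big_ord0; exact: Cc0.
by under eq_fun do rewrite big_ord_recr; exact: CcD.
Qed.

Lemma Cc_dilated_cutoff n : Cc (@dilated_cutoff R d n).
Proof.
apply/Cc_rVP; split; first exact: class_C_cont (class_C_dilated_cutoff R d n 0).
by exists (2 * n.+1%:R); exact: dilated_cutoff0.
Qed.

(** Evaluating a positive functional on this majorant bounds the measure of the
    cube. *)
Lemma cutoff_on_cube (r : R) : exists n, forall x : 'rV[R]_d, `|x| <= r ->
  dilated_cutoff n x = 1.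
Proof.
exists (Num.truncn `|r|) => x xr; apply: cutoff1.
rewrite addr0 normrZ ger0_norm ?invr_ge0// ler_pdivrMl// mulr1.
apply: (le_trans xr); apply: (le_trans (ler_norm r)); apply: ltW.
exact: truncnS_gt.
Qed.

End Cc_functions.

Section continuous_lattice.
Variables (R : realType) (T : topologicalType).

Lemma contMax (f g : T -> R) : continuous f -> continuous g ->
  continuous (fun x => Num.max (f x) (g x)).
Proof.
move=> cf cg; have -> : (fun x => Num.max (f x) (g x)) =
    (fun x => 2^-1 * ((f x + g x) + `|f x - g x|)).
  by apply/funext => x; rewrite maxr_absE mulrC.
apply: contZ; apply: contD; first exact: contD.
move=> x; apply: (continuous_comp (contB cf cg (x := x))); exact: norm_continuous.
Qed.

Lemma contMin (f g : T -> R) : continuous f -> continuous g ->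
  continuous (fun x => Num.min (f x) (g x)).
Proof.
move=> cf cg; have -> : (fun x => Num.min (f x) (g x)) =
    (fun x => f x + g x - Num.max (f x) (g x)).
  apply/funext => x; apply/eqP; rewrite eq_sym subr_eq; apply/eqP.
  by rewrite -addr_max_min addrC.
by apply: contB; [exact: contD|exact: contMax].
Qed.

End continuous_lattice.

Section riesz.
Variables (R : realType) (d : nat).
Variable L : ('rV[R]_d -> R) -> R.
Hypothesis L_add : forall f g, Cc f -> Cc g -> L (fun x => f x + g x) = L f + L g.
Hypothesis L_scale : forall a f, Cc f -> L (fun x => a * f x) = a * L f.
Hypothesis L_ge0 : forall f, Cc f -> (forall x, 0 <= f x) -> 0 <= L f.
Implicit Types (f g h : 'rV[R]_d -> R) (A B E : set 'rV[R]_d).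
Implicit Type G : nat -> 'rV[R]_d -> R.

Let L_sub f g : Cc f -> Cc g -> L (fun x => f x - g x) = L f - L g.
Proof.
move=> Cf Cg; rewrite -mulN1r -(L_scale _ Cg) -(L_add Cf (CcZ _ Cg)).
by congr L; apply/funext => x; rewrite mulN1r.
Qed.

Let L_le f g : Cc f -> Cc g -> (forall x, f x <= g x) -> L f <= L g.
Proof.
move=> Cf Cg fg; rewrite -subr_ge0 -(L_sub Cg Cf); apply: L_ge0; first exact: CcB.
by move=> x; rewrite subr_ge0.
Qed.

Let L0 : L (fun=> 0) = 0.
Proof.
rewrite -[RHS](mul0r (L (fun=> 0))) -(L_scale 0 (@Cc0 R d)).
by congr L; apply/funext => x; rewrite mul0r.
Qed.

Let L_sum G n : (forall i, Cc (G i)) ->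
  L (fun x => \sum_(i < n) G i x) = \sum_(i < n) L (G i).
Proof.
move=> CG; elim: n => [|n IH].
  under eq_fun do rewrite big_ord0.
  by rewrite big_ord0 L0.
under eq_fun do rewrite big_ord_recr /=.
by rewrite (L_add (Cc_sum n CG) (CG n)) IH big_ord_recr.
Qed.

(** Dini's theorem makes the functional countably subadditive. *)
Let L_series g G : Cc g -> (forall k, Cc (G k)) -> (forall k x, 0 <= G k x) ->
  (forall x, (g x)%:E <= \sum_(k <oo) (G k x)%:E)%E ->
  ((L g)%:E <= \sum_(k <oo) (L (G k))%:E)%E.
Proof.
move=> Cg CG G0 gG; have /Cc_rVP[cg [r gr]] := Cg.
have [n kap] := @cutoff_on_cube R d r; set K := @dilated_cutoff R d n in kap.
have CK : Cc K by exact: Cc_dilated_cutoff.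
pose S N x := \sum_(i < N) G i x.
have CS N : Cc (S N) by exact: Cc_sum.
have S_mono N M x : (N <= M)%N -> S N x <= S M x.
  move=> NM; rewrite /S -(subnKC NM) big_split_ord /= lerDl.
  by apply: sumr_ge0 => i _.
have SL N : ((\sum_(i < N) L (G i))%:E <= \sum_(k <oo) (L (G k))%:E)%E.
  rewrite -sumEFin -(big_mkord xpredT (fun i => (L (G i))%:E)).
  by apply: nneseries_lim_ge => k _ _; rewrite lee_fin L_ge0.
apply/lee_addgt0Pr => e e0.
pose e' := e / (L K + 1).
have LK0 : 0 < L K + 1.
  rewrite ltr_wpDl// L_ge0// => x; exact: dilated_cutoff_ge0.
have e'0 : 0 < e' by rewrite divr_gt0.
have : \forall N \near \oo, [set x | `|x| <= r] `<=` (fun x => g x < S N x + e').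
  have /compact_near_coveringP ncov := @compact_ball_rV R d r.
  apply: (ncov _ \oo (fun N x => g x < S N x + e')) => x _.
  have [N gN] : exists N, g x < S N x + e'.
    apply: contrapT => /forallNP h.
    have : (\sum_(k <oo) (G k x)%:E <= (g x - e')%:E)%E.
      apply: lime_le; first by apply: is_cvg_nneseries => k _ _; rewrite lee_fin.
      apply: nearW => N; rewrite sumEFin lee_fin big_mkord.
      by have /negP := h N; rewrite -leNgt -/(S N x) lerBrDr.
    move=> /(le_trans (gG x)); rewrite lee_fin lerBrDl gerDr => /(lt_le_trans e'0).
    by rewrite ltxx.
  have cd : continuous (fun y => S N y + e' - g y).
    apply: contB => //; apply: contD; first by have /Cc_rVP[] := CS N.
    exact: cst_continuous.
  have : \forall y \near x, 0 < S N y + e' - g y.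
    have : 0 < S N x + e' - g x by rewrite subr_gt0.
    by move=> /lt_nbhsr/(cd x).
  move=> Hx; exists ([set y | 0 < S N y + e' - g y], [set M | (N <= M)%N]).
    by split => //=; exists N.
  move=> [y M] [/= hy NM]; rewrite subr_gt0 in hy.
  by apply: (lt_le_trans hy); rewrite lerD2r S_mono.
case=> N _ /(_ N (leqnn _)) HN.
have gS x : g x <= S N x + e' * K x.
  have [xr|xr] := leP `|x| r; first by rewrite kap// mulr1 ltW//; exact: HN.
  rewrite gr// addr_ge0//; first by apply: sumr_ge0 => i _.
  by apply: mulr_ge0; [exact: ltW|exact: dilated_cutoff_ge0].
have := L_le Cg (CcD (CS N) (CcZ e' CK)) gS.
rewrite L_add//; last exact: CcZ.
rewrite L_scale// L_sum// => h.
apply: (@le_trans _ _ ((\sum_(i < N) L (G i))%:E + e%:E)%E); last by rewrite leeD2r.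
rewrite -EFinD lee_fin; apply: (le_trans h); rewrite lerD2l.
rewrite /e' mulrAC -mulrA ler_piMr ?(ltW e0)// ler_pdivrMr// mul1r.
by rewrite lerDl.
Qed.

Let cover A : set (nat -> 'rV[R]_d -> R) := [set G |
  [/\ forall k, Cc (G k), forall k x, 0 <= G k x &
      forall x, A x -> (1 <= \sum_(k <oo) (G k x)%:E)%E]].

(** Covering by series of functions rather than by open sets makes countable
    subadditivity immediate and needs no partition of unity. *)
Definition riesz_outer A : \bar R :=
  ereal_inf [set (\sum_(k <oo) (L (G k))%:E)%E | G in cover A].

Let cover_sum_ge0 A G : cover A G -> (0 <= \sum_(k <oo) (L (G k))%:E)%E.
Proof.
by move=> [CG G0 _]; apply: nneseries_ge0 => k _ _; rewrite lee_fin L_ge0.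
Qed.

Let riesz_outer_ge0 A : (0 <= riesz_outer A)%E.
Proof.
apply: le_ereal_inf_tmp => _ [G cG <-]; exact: cover_sum_ge0 cG.
Qed.

Let single g k : 'rV[R]_d -> R := if k == 0%N then g else fun=> 0.

Let sum_single (F : ('rV[R]_d -> R) -> R) g : F (fun=> 0) = 0 -> 0 <= F g ->
  (\sum_(k <oo) (F (single g k))%:E = (F g)%:E)%E.
Proof.
move=> F0 Fg; rewrite nneseries_recl//; last first.
  by move=> [|k] _; rewrite lee_fin /single//= F0.
rewrite eseries0 ?adde0// => -[|k] //= _ _.
by rewrite /single /= F0.
Qed.

Lemma riesz_outer_le g A : Cc g -> (forall x, 0 <= g x) ->
  (forall x, A x -> 1 <= g x) -> (riesz_outer A <= (L g)%:E)%E.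
Proof.
move=> Cg g0 gA; apply: ereal_inf_lbound; exists (single g); last first.
  exact: (sum_single L0 (L_ge0 Cg g0)).
split=> [[|k]|[|k] x|x Ax] //=.
- exact: Cc0.
- by rewrite (sum_single (F := fun f => f x))// lee_fin gA.
Qed.

Lemma riesz_outer_ge g A : Cc g -> (forall x, 0 <= g x <= 1) ->
  (forall x, ~ A x -> g x = 0) -> ((L g)%:E <= riesz_outer A)%E.
Proof.
move=> Cg g01 gA; apply: le_ereal_inf_tmp => _ [G [CG G0 GA] <-].
apply: L_series => // x; have [Ax|Ax] := pselect (A x).
  by apply: le_trans (GA x Ax); rewrite lee_fin; have /andP[] := g01 x.
by rewrite gA//; apply: nneseries_ge0 => k _ _; rewrite lee_fin.
Qed.

Let riesz_outer0 : riesz_outer set0 = 0%E.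
Proof.
apply/eqP; rewrite eq_le riesz_outer_ge0 andbT -[leRHS]/(0%R)%:E -L0.
by apply: riesz_outer_le; first exact: Cc0.
Qed.

Let riesz_outer_mono : {homo riesz_outer : A B / A `<=` B >-> (A <= B)%E}.
Proof.
move=> A B AB; apply: ereal_inf_le_tmp => _ [G [CG G0 GB] <-]; exists G => //.
by split => // x /AB; exact: GB.
Qed.

Let riesz_outer_subadditive : sigma_subadditive riesz_outer.
Proof.
move=> A; have [[i ioo]|] := pselect (exists i, riesz_outer (A i) = +oo%E).
  rewrite (eseries_pinfty _ _ ioo) ?leey// => n _.
  by rewrite -ltNye (lt_le_trans _ (riesz_outer_ge0 _)).
rewrite -forallNE => Aoo.
apply/lee_addgt0Pr => e e0.
rewrite (le_trans _ (epsilon_trick _ _ (ltW e0)))//.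
have /choice[G HG] n : exists G, cover (A n) G /\
    (\sum_(k <oo) (L (G k))%:E <= riesz_outer (A n) + (e / (2 ^ n.+1)%:R)%:E)%E.
  have fA : riesz_outer (A n) \is a fin_num.
    rewrite ge0_fin_numE; last exact: riesz_outer_ge0.
    by rewrite ltey; apply/eqP; exact: Aoo.
  have en : 0 < e / (2 ^ n.+1)%:R by rewrite divr_gt0// ltr0n expn_gt0.
  have [_ [G cG <-] h] := lb_ereal_inf_adherent en fA.
  by exists G; split => //; exact: ltW.
have /card_esym/ppcard_eqP[b] := card_nat2.
pose GG k : 'rV[R]_d -> R := G (b k).1 (b k).2.
have double (F : nat -> nat -> \bar R) : (forall i j, 0 <= F i j)%E ->
    (\sum_(k <oo) F (b k).1 (b k).2 = \sum_(i <oo) \sum_(j <oo) F i j)%E.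
  move=> F0; rewrite nneseries_esumT//.
  rewrite [RHS]nneseries_esumT; last by move=> i; exact: nneseries_ge0.
  under [RHS]eq_esum do rewrite nneseries_esumT//.
  rewrite esum_esum//.
  rewrite (@reindex_esum _ _ _ [set: nat] _ b (fun p => F p.1 p.2))//.
  have -> : [set: nat] `*`` (fun=> [set: nat]) = [set: nat * nat].
    by apply/seteqP; split.
  by apply: bij.
apply: (@le_trans _ _ (\sum_(k <oo) (L (GG k))%:E)%E).
  apply: ereal_inf_lbound; exists GG => //; split.
  - by move=> k; have [[+ _ _] _] := HG (b k).1; exact.
  - by move=> k x; have [[_ + _] _] := HG (b k).1; exact.
  - move=> x [n _ Anx]; have [[_ Gn0 Gn1] _] := HG n.
    apply: (le_trans (Gn1 x Anx)).
    rewrite (double (fun i j => (G i j x)%:E)); last first.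
      by move=> i j; have [[_ + _] _] := HG i; rewrite lee_fin.
    pose F i := (\sum_(j <oo) (G i j x)%:E)%E.
    have F0 i : (0 <= F i)%E.
      apply: nneseries_ge0 => j _ _.
      by have [[_ + _] _] := HG i; rewrite lee_fin.
    apply: (@le_trans _ _ (\sum_(0 <= i < n.+1) F i)%E).
      by rewrite big_nat_recr//= leeDr// sume_ge0.
    exact: nneseries_lim_ge.
rewrite (double (fun i j => (L (G i j))%:E)); last first.
  by move=> i j; have [[CG G0 _] _] := HG i; rewrite lee_fin L_ge0.
apply: lee_nneseries => [n _ _|n _]; last by have [] := HG n.
by have [cG _] := HG n; exact: cover_sum_ge0 cG.
Qed.

(** Multiplying a cover by a clamp of [h] and by its complement splits it:
    sets lying at different heights of a continuous function add up. *)
Let riesz_outer_separated h (al be : R) A B E : continuous h -> al < be ->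
  A `<=` E -> B `<=` E -> (forall x, A x -> be <= h x) ->
  (forall x, B x -> h x <= al) ->
  (riesz_outer A + riesz_outer B <= riesz_outer E)%E.
Proof.
move=> ch ab AE BE Ah Bh; apply: le_ereal_inf_tmp => _ [G [CG G0 GE] <-].
pose a x : R := Num.min 1 (Num.max 0 ((h x - al) / (be - al))).
have ba : 0 < be - al by rewrite subr_gt0.
have a01 x : 0 <= a x <= 1.
  by rewrite /a le_min ler01 le_max lexx/= ge_min lexx.
have aA x : A x -> a x = 1.
  move=> /Ah hx; apply/min_idPl; rewrite le_max; apply/orP; right.
  by rewrite ler_pdivlMr// mul1r lerD2r.
have aB x : B x -> a x = 0.
  move=> /Bh hx; rewrite /a (max_idPl _) ?min_r//.
  by rewrite pmulr_lle0 ?invr_gt0// subr_le0.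
have ca : continuous a.
  apply: contMin; first exact: cst_continuous.
  apply: contMax; first exact: cst_continuous.
  have -> : (fun x => (h x - al) / (be - al)) = fun x => (be - al)^-1 * (h x - al).
    by apply/funext => x; rewrite mulrC.
  by apply: contZ; apply: contB => //; exact: cst_continuous.
have c1a : continuous (fun x => 1 - a x).
  by apply: contB => //; exact: cst_continuous.
have CG1 k : Cc (fun x => G k x * a x) by exact: CcM.
have CG2 k : Cc (fun x => G k x * (1 - a x)) by exact: CcM.
have G10 k x : 0 <= G k x * a x by have /andP[? _] := a01 x; exact: mulr_ge0.
have G20 k x : 0 <= G k x * (1 - a x).
  by have /andP[_ ?] := a01 x; rewrite mulr_ge0// subr_ge0.
have -> : (\sum_(k <oo) (L (G k))%:E =
    \sum_(k <oo) (L (fun x => G k x * a x))%:E +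
    \sum_(k <oo) (L (fun x => G k x * (1 - a x)))%:E)%E.
  rewrite -nneseriesD//; [|by move=> k _ _; rewrite lee_fin L_ge0..].
  apply: eq_eseriesr => k _; rewrite -EFinD -L_add//; congr (L _)%:E.
  by apply/funext => x; ring.
apply: leeD; apply: ereal_inf_lbound.
  exists (fun k x => G k x * a x) => //; split => // x Ax.
  by under eq_eseriesr do rewrite aA// mulr1; exact: GE (AE _ Ax).
exists (fun k x => G k x * (1 - a x)) => //; split => // x Bx.
by under eq_eseriesr do rewrite aB// subr0 mulr1; exact: GE (BE _ Bx).
Qed.

HB.instance Definition _ := isOuterMeasure.Build R 'rV[R]_d riesz_outer
  riesz_outer0 riesz_outer_ge0 riesz_outer_mono riesz_outer_subadditive.

(** Carathéodory's argument: the shells between consecutive levels of [h] are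
    separated two by two, hence their measures are summable. *)
Let positive_set_caratheodory h : continuous h ->
  riesz_outer.-caratheodory [set x | 0 < h x].
Proof.
move=> ch; apply: le_caratheodory_measurable => X.
set B := [set x | 0 < h x].
suff : (riesz_outer (X `&` B) + riesz_outer (X `&` ~` B) <= riesz_outer X)%E by [].
have [->|] := eqVneq (riesz_outer X) +oo%E; first by rewrite leey.
rewrite -ltey => Xoo.
pose lev k : R := k.+1%:R^-1.
have lev_gt0 k : 0 < lev k by rewrite /lev invr_gt0.
have lev_lt k : lev k.+1 < lev k by rewrite /lev ltf_pV2 ?posrE// ltr_nat.
pose A n := [set x | X x /\ lev n <= h x].
pose Sh k := [set x | [/\ X x, lev k.+1 <= h x & h x <= lev k]].
have even_odd b n : (\sum_(0 <= k < n) riesz_outer (Sh (k.*2 + b)%N) <=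
    riesz_outer X)%E.
  case: n => [|n]; first by rewrite big_nil.
  apply: (@le_trans _ _ (riesz_outer (A (n.*2.+1 + b)%N))); last first.
    by apply: riesz_outer_mono => x [].
  elim: n => [|n IH].
    rewrite big_nat1; apply: riesz_outer_mono => x [Xx h1 h2]; split => //.
  rewrite big_nat_recr//=.
  apply: (@le_trans _ _ (riesz_outer (A (n.*2.+1 + b)%N) +
      riesz_outer (Sh (n.+1.*2 + b)%N))%E).
    by rewrite leeD2r.
  apply: (riesz_outer_separated ch (lev_lt (n.*2.+1 + b)%N)).
  - move=> x [Xx hx]; split => //; apply: le_trans hx.
    by rewrite ltW// (lt_trans (lev_lt _))// lev_lt.
  - by move=> x [Xx h1 h2]; split => //.
  - by move=> x [].
  - by move=> x [].
have tail b : (\sum_(n <= k <oo) riesz_outer (Sh (k.*2 + b)%N))%E @[n --> \oo]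
    --> 0%E.
  apply: nneseries_tail_cvg => [|k _]; last exact: riesz_outer_ge0.
  apply: le_lt_trans Xoo; apply: lime_le.
    by apply: is_cvg_nneseries => k _ _; exact: riesz_outer_ge0.
  by apply: nearW => n; exact: even_odd.
have step n : (riesz_outer (X `&` B) + riesz_outer (X `&` ~` B) <= riesz_outer X +
    (\sum_(n <= k <oo) riesz_outer (Sh (k.*2 + 0)%N) +
     \sum_(n <= k <oo) riesz_outer (Sh (k.*2 + 1)%N)))%E.
  have XB : X `&` B `<=` A n.*2 `|` (\bigcup_k Sh ((k + n).*2 + 0)%N `|`
      \bigcup_k Sh ((k + n).*2 + 1)%N).
    move=> x [Xx Bx]; have [hA|hA] := leP (lev n.*2) (h x); first by left.
    have [j [hj1 hj2]] : exists j, lev (n.*2 + j).+1 <= h x /\ h x <= lev (n.*2 + j)%N.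
      have [m hm] : exists m, lev (n.*2 + m)%N <= h x.
        exists (Num.truncn (h x)^-1); rewrite /lev -[leRHS]invrK.
        rewrite lef_pV2 ?posrE ?invr_gt0//.
        apply: ltW; apply: (lt_le_trans (truncnS_gt _)); rewrite ler_nat.
        by rewrite ltnS leq_addl.
      elim: m hm => [|m IH] hm; first by move: hm; rewrite addn0 leNgt hA.
      have [hm'|hm'] := leP (lev (n.*2 + m)%N) (h x); first exact: IH.
      by exists m; rewrite -addnS; split => //; exact: ltW.
    right; rewrite -(odd_double_half j) in hj1 hj2.
    case: (odd j) hj1 hj2 => /=; rewrite ?add0n ?add1n => hj1 hj2.
      right; exists j./2 => //.
      have -> : ((j./2 + n).*2 + 1 = n.*2 + j./2.*2.+1)%N.
        by rewrite doubleD addn1 addnS addnC.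
      by split.
    left; exists j./2 => //.
    have -> : ((j./2 + n).*2 + 0 = n.*2 + j./2.*2)%N by rewrite doubleD addn0 addnC.
    by split.
  have cup b : (riesz_outer (\bigcup_k Sh ((k + n).*2 + b)%N) <=
      \sum_(n <= k <oo) riesz_outer (Sh (k.*2 + b)%N))%E.
    apply: (le_trans (riesz_outer_subadditive _)).
    rewrite -(nneseries_addn (f := fun k => riesz_outer (Sh (k.*2 + b)%N)))//.
  have H1 : (riesz_outer (X `&` B) <= riesz_outer (A n.*2) +
      (\sum_(n <= k <oo) riesz_outer (Sh (k.*2 + 0)%N) +
       \sum_(n <= k <oo) riesz_outer (Sh (k.*2 + 1)%N)))%E.
    apply: (le_trans (riesz_outer_mono XB)).
    apply: (le_trans (outer_measureU2 _ _ _)); rewrite leeD2l//.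
    by apply: (le_trans (outer_measureU2 _ _ _)); rewrite leeD.
  apply: (le_trans (leeD2r _ H1)); rewrite addeAC leeD2r//.
  apply: (riesz_outer_separated ch (lev_gt0 n.*2)).
  - by move=> x [].
  - by move=> x [].
  - by move=> x [].
  - by move=> x [_ /negP]; rewrite -leNgt.
have lim0 : (riesz_outer X +
    (\sum_(n <= k <oo) riesz_outer (Sh (k.*2 + 0)%N) +
     \sum_(n <= k <oo) riesz_outer (Sh (k.*2 + 1)%N)))%E @[n --> \oo]
    --> (riesz_outer X + (0 + 0))%E.
  apply: cvgeD; [|exact: cvg_cst|].
    by rewrite adde0 fin_num_adde_defl.
  by apply: cvgeD => //; exact: tail.
rewrite !adde0 in lim0.
have clim : cvgn (fun n => (riesz_outer X +
    (\sum_(n <= k <oo) riesz_outer (Sh (k.*2 + 0)%N) +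
     \sum_(n <= k <oo) riesz_outer (Sh (k.*2 + 1)%N)))%E).
  by apply/cvg_ex; exists (riesz_outer X).
rewrite -(cvg_lim _ lim0)//.
by apply: lime_ge => //; exact: nearW.
Qed.

(** The distance to the complement, truncated at 1 so that the infimum is never
    taken over an empty set. *)
Let open_positive_set (U : set 'rV[R]_d) : open U ->
  exists2 h : 'rV[R]_d -> R, continuous h & U = [set x | 0 < h x].
Proof.
move=> oU.
pose D x := [set (1 : R)] `|` [set `|x - y| | y in ~` U].
have lb0 x : lbound (D x) 0 by move=> _ [->|[y _ <-]].
have hD x : has_inf (D x) by split; [exists 1; left|exists 0].
exists (fun x => inf (D x)).
  have half x y : inf (D x) - inf (D y) <= `|x - y|.
    rewrite lerBlDl -lerBlDr; apply: lb_le_inf; first exact: (hD y).1.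
    move=> _ [->|[z Uz <-]]; rewrite lerBlDr.
      apply: (le_trans (ge_inf (hD x).2 _)); first by left.
      by rewrite lerDl.
    apply: (le_trans (ge_inf (hD x).2 _)); first by right; exists z.
    by rewrite [leRHS]addrC; exact: ler_distD.
  apply: (@lipschitz_continuous _ _ _ 1) => x y; rewrite mul1r.
  by rewrite ler_norml half andbT lerNl opprB distrC half.
apply/seteqP; split => x /=.
  move=> Ux; have : nbhs x U by exact: open_nbhs_nbhs.
  rewrite -nbhs_ballE => -[e /= e0 eU].
  apply: (@lt_le_trans _ _ (Num.min 1 e)); first by rewrite lt_min ltr01.
  apply: lb_le_inf; first exact: (hD x).1.
  move=> _ [->|[y Uy <-]]; first by rewrite ge_min lexx.
  rewrite ge_min; apply/orP; right; rewrite leNgt; apply/negP => xy.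
  by apply: Uy; apply: eU; rewrite -ball_normE.
move=> h0; apply: contrapT => Ux; move: h0; rewrite ltNge => /negP; apply.
apply: (ge_inf (hD x).2); right; exists x => //.
by rewrite subrr normr0.
Qed.

Let borel_caratheodory (A : set 'rV[R]_d) : measurable A ->
  riesz_outer.-caratheodory A.
Proof.
apply: smallest_sub.
  split.
  - exact: caratheodory_measurable_set0.
  - by move=> B mB; rewrite setTD; exact: caratheodory_measurable_setC.
  - by move=> F mF; exact: caratheodory_measurable_bigcup.
move=> U /open_positive_set[h ch ->]; exact: positive_set_caratheodory.
Qed.

Let riesz_sigma_additive :
  semi_sigma_additive (riesz_outer : set 'rV[R]_d -> \bar R).
Proof.
move=> F mF tF mcF.
apply: (@caratheodory_measure_sigma_additive R 'rV[R]_d riesz_outer) => //.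
  by move=> i; exact: borel_caratheodory.
exact: borel_caratheodory.
Qed.

HB.instance Definition _ := isMeasure.Build _ _ _
  (riesz_outer : set 'rV[R]_d -> \bar R)
  riesz_outer0 riesz_outer_ge0 riesz_sigma_additive.

Let mu : {measure set 'rV[R]_d -> \bar R} := riesz_outer.

Let riesz_cube (r : R) : (mu (cube r) < +oo)%E.
Proof.
have [n kap] := @cutoff_on_cube R d r.
apply: (@le_lt_trans _ _ (L (@dilated_cutoff R d n))%:E); last by rewrite ltry.
apply: riesz_outer_le => [|x|x xr].
- exact: Cc_dilated_cutoff.
- exact: dilated_cutoff_ge0.
- by rewrite kap.
Qed.

Let riesz_integrable g : Cc g -> mu.-integrable setT (EFin \o g).
Proof.
move=> /Cc_rVP[cg [r gr]]; apply: (vanishes_off_integrable _ cg gr).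
exact: riesz_cube.
Qed.

Let integral_fine g : Cc g ->
  (\int[mu]_x g x)%:E = (\int[mu]_x (g x)%:E)%E.
Proof. by move=> /riesz_integrable ig; rewrite fineK// integrable_fin_num. Qed.

Let integral_le g A : measurable A -> Cc g -> (forall x, 0 <= g x) ->
  (forall x, A x -> 1 <= g x) -> (mu A <= (\int[mu]_x g x)%:E)%E.
Proof.
move=> mA Cg g0 gA; rewrite integral_fine// -[A in mu A]setIT -integral_indic//.
have /Cc_rVP[cg _] := Cg; apply: ge0_le_integral => //.
- by apply/measurable_EFinP; exact: measurable_indic.
- by apply/measurable_EFinP; exact: continuous_measurable_rV.
- move=> x _; rewrite lee_fin indicE.
  by have [/set_mem/gA//|_] := boolP (x \in A); exact: g0.
Qed.

Let integral_ge g A : measurable A -> Cc g -> (forall x, 0 <= g x <= 1) ->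
  (forall x, ~ A x -> g x = 0) -> ((\int[mu]_x g x)%:E <= mu A)%E.
Proof.
move=> mA Cg g01 gA; rewrite integral_fine// -[A in mu A]setIT -integral_indic//.
have /Cc_rVP[cg _] := Cg; apply: ge0_le_integral => //.
- by move=> x _; rewrite lee_fin; have /andP[] := g01 x.
- by apply/measurable_EFinP; exact: continuous_measurable_rV.
- by apply/measurable_EFinP; exact: measurable_indic.
- move=> x _; rewrite lee_fin indicE.
  have [Ax|/negP Ax] := boolP (x \in A); first by have /andP[] := g01 x.
  by rewrite gA// => /mem_set.
Qed.

(** Comparing slices of height [de]: both the functional and the integral of the
    [k]-th slice lie between the measures of two consecutive superlevel sets,
    and these differences telescope. *)
Let riesz_slices g (de : R) (N : nat) : Cc g -> (forall x, 0 <= g x) -> 0 < de ->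
  (forall x, g x <= de * N%:R) ->
  `|L g - \int[mu]_x g x| <= de * fine (mu [set x | 0 < g x]).
Proof.
move=> Cg g0 de0 gN; have /Cc_rVP[cg [r gr]] := Cg.
pose A k := [set x | de * k%:R < g x].
have mA k : measurable (A k).
  have -> : A k = [set: 'rV[R]_d] `&` g @^-1` `]de * k%:R, +oo[.
    by rewrite setTI; apply/seteqP; split => x /=; rewrite in_itv/= andbT.
  by apply: (continuous_measurable_rV cg) => //; exact: measurable_itv.
have dek k : 0 <= de * k%:R by rewrite mulr_ge0// ltW.
have fA k : mu (A k) \is a fin_num.
  rewrite ge0_fin_numE//; apply: le_lt_trans (riesz_cube r).
  apply: riesz_outer_mono => x /= gx; rewrite /cube /= leNgt; apply/negP => /gr gx0.
  by move: gx; rewrite /A /= gx0 ltNge dek.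
pose a k := fine (mu (A k)).
pose c k x := Num.min (g x) (de * k%:R).
have Cc_c k : Cc (c k).
  apply: (Cc_comp (F := fun y => Num.min y (de * k%:R)) Cg).
    by apply: contMin; [move=> ?; exact: cvg_id|exact: cst_continuous].
  by rewrite min_l.
pose s k x := de^-1 * (c k.+1 x - c k x).
have Cs k : Cc (s k) by apply: CcZ; exact: CcB.
have ck k : de * k.+1%:R = de * k%:R + de by rewrite -natr1 mulrDr mulr1.
have s01 k x : 0 <= s k x <= 1.
  rewrite /s ler_pdivrMl// mulr1 mulr_ge0 ?invr_ge0 ?(ltW de0)//= /c ck.
    move: (g x) (de * k%:R) => y z.
    by rewrite /Order.min; case: ltP => ?; case: ltP => ?; lra.
  move: (g x) (de * k%:R) => y z.
  by rewrite /Order.min; case: ltP => ?; case: ltP => ?; lra.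
have sA0 k x : ~ A k x -> s k x = 0.
  move=> /negP; rewrite -leNgt => gx; rewrite /s /c ck !min_l ?subrr ?mulr0//.
  by apply: (le_trans gx); rewrite lerDl ltW.
have sA1 k x : A k.+1 x -> 1 <= s k x.
  rewrite /A /= ck => gx; rewrite /s /c ck !min_r ?(ltW gx)//; last first.
    by apply: ltW; apply: le_lt_trans gx; rewrite lerDl ltW.
  by rewrite addrAC subrr add0r mulVf// gt_eqF.
have sandwich (J : ('rV[R]_d -> R) -> R) k :
    (mu (A k.+1) <= (J (s k))%:E)%E -> ((J (s k))%:E <= mu (A k))%E ->
    a k.+1 <= J (s k) <= a k.
  move=> J1 J2; rewrite /a; apply/andP; split.
    by rewrite -lee_fin fineK.
  by rewrite -lee_fin fineK.
have s0 k x : 0 <= s k x by have /andP[] := s01 k x.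
have Lk k : a k.+1 <= L (s k) <= a k.
  apply: sandwich; first by apply: riesz_outer_le => //; exact: sA1.
  by apply: riesz_outer_ge => //; exact: sA0.
have Ik k : a k.+1 <= \int[mu]_x s k x <= a k.
  apply: (sandwich (fun f => \int[mu]_x f x)).
    by apply: integral_le => //; exact: sA1.
  by apply: integral_ge => //; exact: sA0.
have LsE k : L (s k) = de^-1 * (L (c k.+1) - L (c k)).
  by rewrite L_scale ?L_sub//; exact: CcB.
have IsE k : \int[mu]_x s k x = de^-1 * (\int[mu]_x c k.+1 x - \int[mu]_x c k x).
  rewrite RintegralZl//; last by apply: riesz_integrable; exact: CcB.
  by rewrite RintegralB//; exact: riesz_integrable.
have step k : `|L (c k) - \int[mu]_x c k x| <= de * (a 0%N - a k).
  elim: k => [|k IH].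
    have -> : c 0%N = fun=> 0.
      by apply/funext => x; rewrite /c mulr0 min_r.
    by rewrite L0 /Rintegral integral0 !subrr normr0 mulr0.
  have := Lk k; have := Ik k; rewrite LsE IsE.
  rewrite !ler_pdivlMl// !ler_pdivrMl//.
  move: IH; rewrite !ler_norml !mulrBr.
  move: (L (c k)) (L (c k.+1)) (\int[mu]_x c k x) (\int[mu]_x c k.+1 x).
  move: (de * a 0%N) (de * a k) (de * a k.+1) => w x y l l' i i'.
  move=> /andP[? ?] /andP[? ?] /andP[? ?]; apply/andP; split; lra.
have cN : c N = g by apply/funext => x; rewrite /c min_l.
have := step N; rewrite cN => /le_trans; apply.
rewrite ler_pM2l// /a /A mulr0 gerBl fine_ge0//.
Qed.

Let riesz_ge0 g : Cc g -> (forall x, 0 <= g x) -> L g = \int[mu]_x g x.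
Proof.
move=> Cg g0; have /Cc_rVP[cg [r gr]] := Cg.
have [M M0 gM] := vanishes_off_bounded cg gr.
set m := fine (mu [set x | 0 < g x]).
have m0 : 0 <= m by rewrite fine_ge0.
apply/eqP; rewrite -subr_eq0 -normr_le0; apply/ler_addgt0Pr => e e0.
rewrite add0r; pose de := e / (m + 1).
have de0 : 0 < de by rewrite divr_gt0// ltr_wpDl.
apply: le_trans (riesz_slices (N := (Num.truncn (M / de)).+1) Cg g0 de0 _) _.
  move=> x; apply: (le_trans (ler_norm _)); apply: (le_trans (gM x)).
  by rewrite -ler_pdivrMl// mulrC ltW// truncnS_gt.
rewrite -/m /de mulrAC -mulrA ler_piMr ?(ltW e0)// ler_pdivrMr ?ltr_wpDl//.
by rewrite mul1r lerDl.
Qed.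

(** Slices of vanishing height settle the nonnegative functions; the others follow
    by splitting into positive and negative parts. *)
Lemma riesz_representation : exists m : {measure set 'rV[R]_d -> \bar R},
  radon_on setT m /\ forall g, Cc g -> (\int[m]_x (g x)%:E = (L g)%:E)%E.
Proof.
exists mu; split => [K cK _|g Cg].
  have [r Kr] : exists r, K `<=` cube r.
    have [M [_ HM]] := compact_bounded cK.
    by exists (M + 1) => x Kx; apply: HM Kx; rewrite ltrDl.
  exact: le_lt_trans (riesz_outer_mono Kr) (riesz_cube r).
rewrite -integral_fine//; congr (_%:E).
have cid : continuous (fun y : R => y) by move=> ?; exact: cvg_id.
have Cp : Cc (fun x => Num.max (g x) 0).
  apply: (Cc_comp (F := fun y => Num.max y 0) Cg); last by rewrite maxxx.
  by apply: contMax => //; exact: cst_continuous.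
have Cn : Cc (fun x => Num.max (- g x) 0).
  apply: (Cc_comp (F := fun y => Num.max (- y) 0) Cg); last by rewrite oppr0 maxxx.
  apply: contMax; last exact: cst_continuous.
  exact: opp_continuous.
have gE : g = fun x => Num.max (g x) 0 - Num.max (- g x) 0.
  apply/funext => x; rewrite /Order.max oppr_lt0.
  by case: ltgtP => [?|?|->]; rewrite ?subr0 ?sub0r ?opprK ?subrr.
rewrite {1 2}gE L_sub// RintegralB//; [|exact: riesz_integrable..].
by rewrite !riesz_ge0// => x; rewrite le_max lexx orbT.
Qed.

End riesz.

(** * A measurable representative of the solution *)

Section representative.
Variables (R : realType) (d : nat) (T : R) (u : 'rV[R]_d * R -> R).
Variable phi : 'rV[R]_d -> R.
Hypotheses (T0 : 0 < T) (Lu : L1loc T u) (u0 : ae_nonneg T u).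
Hypotheses (cphi : continuous phi) (phi0 : forall x, 0 < phi x).
Hypothesis u_phi : forall e T', 0 < e -> e < T' -> T' < T ->
  (\int[@lebesgue_measure R]_(t in `[e, T']) \int[@lebesgue_rV R d]_x
     (`|u (x, t)| * phi x)%:E < +oo)%E.

Let leb : {sigma_finite_measure set 'rV[R]_d -> \bar R} := @lebesgue_rV R d.
Let lam : {sigma_finite_measure set (measurableTypeR R) -> \bar R} :=
  @lebesgue_measure R.
Let cyl : set ('rV[R]_d * measurableTypeR R) := cylinder T.

Let measurable_cyl : measurable cyl.
Proof. by apply: measurableX => //; exact: measurable_itv. Qed.

(** Local integrability is a statement on compact sets only; the cylinder is a
    countable union of such sets. *)
Lemma L1loc_measurable : measurable_fun cyl u.
Proof.
pose K (k : nat) : set ('rV[R]_d * measurableTypeR R) :=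
  cube k%:R `*` `[time_gap T k, T - time_gap T k].
have mK k : measurable (K k).
  by apply: measurableX; [exact: measurable_cube|exact: measurable_itv].
have -> : cyl = \bigcup_k K k.
  apply/seteqP; split => [[x t] [_ /=]|[x t] [k _ [_ /=]]]; rewrite !in_itv /=.
    move=> /andP[t0 tT]; have [k /andP[k1 k2]] := time_exhaustion t0 tT.
    exists (maxn k (Num.truncn `|x|).+1) => //; split => /=.
      rewrite /cube /=; apply: (le_trans (ltW (truncnS_gt _))).
      by rewrite ler_nat leq_maxr.
    have gl : time_gap T (maxn k (Num.truncn `|x|).+1) <= time_gap T k.
      rewrite /time_gap ler_pM2l// lef_pV2 ?posrE// ler_nat !ltnS.
      exact: leq_maxl.
    rewrite in_itv /= (le_trans gl k1)/=; apply: (le_trans k2).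
    by rewrite lerD2l lerN2.
  move=> /andP[k1 k2]; split => //=; rewrite in_itv /=.
  rewrite (lt_le_trans (time_gap_gt0 T0 k) k1).
  exact: le_lt_trans k2 (time_gap_ltT T0 k).
apply/measurable_fun_bigcup => // k.
apply: (Rint_measurable (mu := (leb \x lam)%E)).
apply: Lu.
  apply: compact_setX; first exact: compact_ball_rV.
  exact: segment_compact.
move=> [x t] [_ /=]; rewrite in_itv /= => /andP[k1 k2]; split => //=.
rewrite in_itv /= (lt_le_trans (time_gap_gt0 T0 k) k1).
exact: le_lt_trans k2 (time_gap_ltT T0 k).
Qed.

Let v (z : 'rV[R]_d * measurableTypeR R) : R := ((fun z => `|u z|) \_ cyl) z.

Let v_ge0 z : 0 <= v z.
Proof. by rewrite /v patchE; case: ifP. Qed.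

Let measurable_v : measurable_fun setT v.
Proof.
apply/measurable_restrict => //; rewrite setTI.
by apply: measurableT_comp L1loc_measurable; exact: normr_measurable.
Qed.

Let v_in x t : 0 < t -> t < T -> v (x, t) = `|u (x, t)|.
Proof.
by move=> t0 tT; rewrite /v patchE mem_set//; split => //=; rewrite in_itv /= t0.
Qed.

Let measurable_phi2 : measurable_fun setT
  (fun z : 'rV[R]_d * measurableTypeR R => phi z.1).
Proof.
by apply: measurableT_comp; [exact: continuous_measurable_rV|exact: measurable_fst].
Qed.

Let mass t : \bar R := (\int[leb]_x (v (x, t) * phi x)%:E)%E.

Let mass_ge0 t : (0 <= mass t)%E.
Proof. by apply: integral_ge0 => x _; rewrite lee_fin mulr_ge0// ltW. Qed.

Let measurable_mass : measurable_fun [set: measurableTypeR R] mass.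
Proof.
have := @measurable_fun_fubini_tonelli_G _ _ 'rV[R]_d (measurableTypeR R) R leb
  (fun z => (v z * phi z.1)%:E).
apply.
  by apply/measurable_EFinP; exact: measurable_funM.
by move=> z; rewrite lee_fin mulr_ge0// ltW.
Qed.

Let good : set (measurableTypeR R) := [set t | (mass t < +oo)%E].

Let measurable_good : measurable good.
Proof. by rewrite -[good]setTI; exact: emeasurable_fun_infty_o. Qed.

Let mass_integrable e T' : 0 < e -> e < T' -> T' < T ->
  lam.-integrable `[e, T'] mass.
Proof.
move=> e0 eT' T'T; apply/integrableP; split.
  exact: measurable_funTS.
apply: le_lt_trans (u_phi e0 eT' T'T).
under eq_integral => t _ do rewrite gee0_abs//.
rewrite le_eqVlt; apply/orP; left; apply/eqP; apply: eq_integral => t.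
rewrite inE /= in_itv /= => /andP[et tT']; rewrite /mass.
apply: eq_integral => x _; rewrite v_in//.
  exact: lt_le_trans et.
exact: le_lt_trans T'T.
Qed.

Let good_ae : lam.-negligible (`]0, T[ `\` good).
Proof.
have H k : lam.-negligible (`[time_gap T k, T - time_gap T k] `\` good).
  have := integrable_ae (mu := lam) (measurable_itv _) (mass_integrable (time_gap_gt0 T0 k)
    (time_gap_lt T0 k) (time_gap_ltT T0 k)).
  apply: negligibleS => t [tk ngood] /= /(_ tk); apply/negP.
  by rewrite ge0_fin_numE//; apply/negP.
apply: negligibleS (negligible_bigcup H) => t [].
rewrite /= in_itv /= => /andP[t0 tT] ng.
have [k hk] := time_exhaustion t0 tT.
by exists k => //; split => //=; rewrite in_itv.
Qed.

(** Tonelli turns the almost everywhere sign in space-time into an almost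
    everywhere sign on almost every time slice. *)
Let slices_ae : exists2 N : set (measurableTypeR R), lam.-negligible N &
  forall t, 0 < t -> t < T -> ~ N t ->
    {ae leb, forall x, 0 <= u (x, t)}.
Proof.
have [A [mA A0 hA]] := u0.
have mA1 : measurable_fun setT (fun z : 'rV[R]_d * measurableTypeR R => (\1_A z : R)%:E).
  by apply/measurable_EFinP; exact: measurable_indic.
have A1 z : (0 <= (\1_A z : R)%:E)%E by rewrite lee_fin.
have : (\int[lam]_t fubini_G leb (fun z => (\1_A z : R)%:E) t = 0)%E.
  have <- := @fubini_tonelli2 _ _ 'rV[R]_d (measurableTypeR R) R leb lam
    (fun z => (\1_A z : R)%:E) mA1 A1.
  by rewrite integral_indic// setIT; exact: A0.
have mG := @measurable_fun_fubini_tonelli_G _ _ 'rV[R]_d (measurableTypeR R) R leb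
  (fun z => (\1_A z : R)%:E) mA1 A1.
have G0 t : (0 <= fubini_G leb (fun z => (\1_A z : R)%:E) t)%E.
  by apply: integral_ge0 => x _.
move=> G_eq0; have : (\int[lam]_t `|fubini_G leb (fun z => (\1_A z : R)%:E) t| = 0)%E.
  by under eq_integral => t _ do rewrite gee0_abs//.
move=> /(ae_eq_integral_abs lam measurableT mG).1 G_ae.
exists [set t | ~ fubini_G leb (fun z => (\1_A z : R)%:E) t = 0%E].
  by apply: negligibleS G_ae => t /= h /(_ I).
move=> t t0 tT /contrapT; rewrite /fubini_G.
have mAt : measurable [set x | A (x, t)].
  have := measurable_ysection t mA; congr (measurable _).
  by apply/seteqP; split => x; rewrite /ysection /= in_setE.
have -> : (\int[leb]_x (\1_A (x, t) : R)%:E)%E = leb [set x | A (x, t)].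
  transitivity (\int[leb]_x (\1_[set x | A (x, t)] x : R)%:E)%E.
    by apply: eq_integral => x _; rewrite !indicE -[RHS]/((x \in [set x | A (x, t)])%:R%:E).
  by rewrite integral_indic// setIT.
move=> hA0; exists [set x | A (x, t)]; split => // x /= ux; apply: hA => /= h.
by apply: ux; apply: h; split => //=; rewrite in_itv /= t0.
Qed.

(** Discarding the times of infinite mass costs a null set and makes the spatial
    integrals against multiples of [phi] finite at every time. *)
Lemma good_representative : exists w : 'rV[R]_d * measurableTypeR R -> R,
  [/\ measurable_fun setT w, forall z, 0 <= w z,
    forall t, leb.-integrable setT (EFin \o (fun x => w (x, t) * phi x)),
    forall e T', 0 < e -> e < T' -> T' < T -> lam.-integrable `[e, T']
      (EFin \o (fun t => \int[leb]_x (w (x, t) * phi x))) &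
    exists2 N : set (measurableTypeR R), lam.-negligible N &
      forall t, 0 < t -> t < T -> ~ N t -> {ae leb, forall x, w (x, t) = u (x, t)}].
Proof.
exists (fun z => v z * \1_good z.2).
have w0 z : 0 <= v z * \1_good z.2 by rewrite mulr_ge0.
have mw : measurable_fun setT
    (fun z : 'rV[R]_d * measurableTypeR R => v z * \1_good z.2).
  apply: measurable_funM => //.
  by apply: measurableT_comp; [exact: measurable_indic|exact: measurable_snd].
have mwphi : measurable_fun setT
    (fun z : 'rV[R]_d * measurableTypeR R => v z * \1_good z.2 * phi z.1).
  exact: measurable_funM.
have mwphit t : measurable_fun setT (fun x => v (x, t) * \1_good t * phi x).
  exact: (measurableT_comp mwphi (pair2_measurable t)).
have wphi0 x t : 0 <= v (x, t) * \1_good t * phi x by rewrite mulr_ge0// ltW.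
have le_mass t : (\int[leb]_x (v (x, t) * \1_good t * phi x)%:E <= mass t)%E.
  apply: ge0_le_integral => //.
  - by move=> x _; rewrite lee_fin.
  - by apply/measurable_EFinP.
  - have mvphi : measurable_fun setT
      (fun z : 'rV[R]_d * measurableTypeR R => v z * phi z.1).
      exact: measurable_funM.
    by apply/measurable_EFinP; exact: (measurableT_comp mvphi (pair2_measurable t)).
  - move=> x _; rewrite lee_fin ler_pM2r// ler_piMr//.
have Iw t : leb.-integrable setT (EFin \o (fun x => v (x, t) * \1_good t * phi x)).
  apply/integrableP; split; first by apply/measurable_EFinP.
  under eq_integral => x _ do rewrite /= ger0_norm//.
  have [gt|/negP gt] := boolP (t \in good).
    by apply: (le_lt_trans (le_mass t)); exact: set_mem gt.
  rewrite integral0_eq ?ltry// => x _.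
  by rewrite indicE memNset ?mulr0 ?mul0r// => /mem_set.
split => //.
  move=> e T' e0 eT' T'T.
  have mass_le t : ((\int[leb]_x (v (x, t) * \1_good t * phi x))%:E <= mass t)%E.
    rewrite /Rintegral fineK; first exact: le_mass.
    exact: integrable_fin_num (Iw t).
  have m0 t : 0 <= \int[leb]_x (v (x, t) * \1_good t * phi x).
    by apply: Rintegral_ge0.
  apply: le_integrable (mass_integrable e0 eT' T'T) => //.
    apply/measurable_EFinP; apply: measurable_funTS.
    apply: measurableT_comp; first exact: fine_measurable.
    apply: (@measurable_fun_fubini_tonelli_G _ _ 'rV[R]_d (measurableTypeR R) R leb
      (fun z => (v z * \1_good z.2 * phi z.1)%:E)) => //.
      by apply/measurable_EFinP.
    by move=> [x t]; rewrite lee_fin.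
  by move=> t _ /=; rewrite ger0_norm// gee0_abs.
have [N N0 HN] := slices_ae.
exists (N `|` (`]0, T[ `\` good)); first exact: negligibleU.
move=> t t0 tT /not_orP[Nt ng]; have := HN t t0 tT Nt.
apply: filterS => x ux /=; rewrite v_in// ger0_norm// indicE mem_set ?mulr1//.
by apply: contrapT => h; apply: ng; split => //=; rewrite in_itv /= t0.
Qed.

End representative.

(** * Spatial averages of the solution as functions of time *)

Section pairing.
Variables (R : realType) (d : nat) (T : R) (phi : 'rV[R]_d -> R).
Variable w : 'rV[R]_d * measurableTypeR R -> R.

Let leb : {sigma_finite_measure set 'rV[R]_d -> \bar R} := @lebesgue_rV R d.
Let lam : {sigma_finite_measure set (measurableTypeR R) -> \bar R} :=
  @lebesgue_measure R.

(** Averages against [f] make sense at every time once [f] is dominated by a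
    multiple of the weight [phi]. *)
Definition pairing (f : 'rV[R]_d -> R) (t : R) : R := \int[leb]_x (w (x, t) * f x).

Hypotheses (cphi : continuous phi) (phi0 : forall x, 0 < phi x).
Hypotheses (mw : measurable_fun setT w) (w0 : forall z, 0 <= w z).
Hypothesis Iw : forall t, leb.-integrable setT (EFin \o (fun x => w (x, t) * phi x)).
Hypothesis Im : forall e T', 0 < e -> e < T' -> T' < T ->
  lam.-integrable `[e, T'] (EFin \o pairing phi).
Implicit Types (f g : 'rV[R]_d -> R) (C : R).

Let measurable_wf f t : continuous f -> measurable_fun setT (fun x => w (x, t) * f x).
Proof.
move=> cf; apply: measurable_funM; last exact: continuous_measurable_rV.
exact: (measurableT_comp mw (pair2_measurable t)).
Qed.

Lemma pairing_norm f C x t : `|f x| <= C * phi x ->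
  `|w (x, t) * f x| <= C * (w (x, t) * phi x).
Proof.
by move=> fC; rewrite normrM ger0_norm// mulrCA ler_wpM2l.
Qed.

Lemma pairing_int f C t : continuous f -> (forall x, `|f x| <= C * phi x) ->
  leb.-integrable setT (EFin \o (fun x => w (x, t) * f x)).
Proof.
move=> cf fC.
apply: (@Rint_le _ _ _ leb setT measurableT _ (fun x => C * (w (x, t) * phi x))).
- exact: measurable_wf.
- by move=> x _; exact: pairing_norm.
- exact: RintZ.
Qed.

Lemma pairing_le f C t : continuous f -> (forall x, `|f x| <= C * phi x) ->
  `|pairing f t| <= C * pairing phi t.
Proof.
move=> cf fC; rewrite /pairing -RintegralZl//.
apply: Rintegral_norm_le => //.
- exact: pairing_int fC.
- exact: RintZ.
- by move=> x _; exact: pairing_norm.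
Qed.

Lemma pairing_ge0 f t : (forall x, 0 <= f x) -> 0 <= pairing f t.
Proof. by move=> f0; apply: Rintegral_ge0 => x _; exact: mulr_ge0. Qed.

Lemma pairingB f g C D t : continuous f -> continuous g ->
  (forall x, `|f x| <= C * phi x) -> (forall x, `|g x| <= D * phi x) ->
  pairing (fun x => f x - g x) t = pairing f t - pairing g t.
Proof.
move=> cf cg fC gD; rewrite /pairing -RintegralB//.
- by congr Rintegral; apply/funext => x; rewrite mulrBr.
- exact: pairing_int fC.
- exact: pairing_int gD.
Qed.

Lemma pairingD f g C D t : continuous f -> continuous g ->
  (forall x, `|f x| <= C * phi x) -> (forall x, `|g x| <= D * phi x) ->
  pairing (fun x => f x + g x) t = pairing f t + pairing g t.
Proof.
move=> cf cg fC gD; rewrite /pairing -RintegralD//.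
- by congr Rintegral; apply/funext => x; rewrite mulrDr.
- exact: pairing_int fC.
- exact: pairing_int gD.
Qed.

Lemma pairingZ f C a t : continuous f -> (forall x, `|f x| <= C * phi x) ->
  pairing (fun x => a * f x) t = a * pairing f t.
Proof.
move=> cf fC; rewrite /pairing -RintegralZl//; last exact: pairing_int fC.
by congr Rintegral; apply/funext => x; rewrite mulrCA.
Qed.

Let measurable_pairing_ge0 f : continuous f -> (forall x, 0 <= f x) ->
  measurable_fun [set: measurableTypeR R] (pairing f).
Proof.
move=> cf f0; apply: measurableT_comp; first exact: fine_measurable.
apply: (@measurable_fun_fubini_tonelli_G _ _ 'rV[R]_d (measurableTypeR R) R leb
  (fun z => (w z * f z.1)%:E)).
  apply/measurable_EFinP; apply: measurable_funM => //.
  by apply: measurableT_comp; [exact: continuous_measurable_rV|exact: measurable_fst].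
by move=> [x t]; rewrite lee_fin mulr_ge0.
Qed.

(** Adding a multiple of [phi] makes the integrand nonnegative, where Tonelli's
    theorem applies. *)
Lemma measurable_pairing f C : continuous f -> (forall x, `|f x| <= C * phi x) ->
  measurable_fun [set: measurableTypeR R] (pairing f).
Proof.
move=> cf fC.
have cCphi : continuous (fun x => C * phi x) by exact: contZ.
have Cphi_le x : `|C * phi x| <= `|C| * phi x.
  by rewrite normrM (ger0_norm (ltW (phi0 x))).
have -> : pairing f = fun t =>
    pairing (fun x => f x + C * phi x) t - C * pairing phi t.
  apply/funext => t; rewrite (pairingD (C := C) (D := `|C|))//.
  by rewrite (pairingZ (C := 1))// ?addrK// => x; rewrite mul1r ger0_norm// ltW.
apply: measurable_funB.
  apply: measurable_pairing_ge0; first exact: contD.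
  by move=> x; have := fC x; rewrite ler_norml => /andP[+ _]; rewrite lerNl -subr_ge0 opprK addrC.
apply: measurable_funM; first exact: measurable_cst.
by apply: measurable_pairing_ge0 => // x; exact: ltW.
Qed.

Lemma pairing_time_int f C e T' : continuous f -> (forall x, `|f x| <= C * phi x) ->
  0 < e -> e < T' -> T' < T -> lam.-integrable `[e, T'] (EFin \o pairing f).
Proof.
move=> cf fC e0 eT' T'T.
have mI : measurable (`[e, T'] : set (measurableTypeR R)) by exact: measurable_itv.
apply: (@Rint_le _ _ _ lam _ mI _ (fun t => C * pairing phi t)).
- by apply: measurable_funTS; exact: measurable_pairing fC.
- by move=> t _; exact: pairing_le.
- by apply: RintZ => //; exact: Im.
Qed.

Lemma pairing_cvg (F : nat -> 'rV[R]_d -> R) f C t :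
  (forall n, continuous (F n)) -> continuous f ->
  (forall n x, `|F n x| <= C * phi x) ->
  (forall x, F n x @[n --> \oo] --> f x) ->
  pairing (F n) t @[n --> \oo] --> pairing f t.
Proof.
move=> cF cf FC Ff.
apply: (@Rdominated_cvg _ _ _ leb setT measurableT
  (fun n x => w (x, t) * F n x) (fun x => w (x, t) * f x)
  (fun x => C * (w (x, t) * phi x)) _ _ _ _ _).2.
- by move=> n; exact: measurable_wf.
- exact: measurable_wf.
- by apply: aeW => x _; exact: cvgMr (Ff x).
- exact: RintZ.
- by apply: aeW => x n _; exact: pairing_norm.
Qed.

Lemma pairing_time_cvg (F : nat -> 'rV[R]_d -> R) f C s t :
  (forall n, continuous (F n)) -> continuous f ->
  (forall n x, `|F n x| <= C * phi x) ->
  (forall x, F n x @[n --> \oo] --> f x) -> 0 < s -> s < t -> t < T ->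
  \int[lam]_(r in `[s, t]) pairing (F n) r @[n --> \oo] -->
  \int[lam]_(r in `[s, t]) pairing f r.
Proof.
move=> cF cf FC Ff s0 st tT.
have fC x : `|f x| <= C * phi x.
  rewrite -(cvg_lim _ (cvg_norm (Ff x)))//; apply: limr_le; last exact: nearW.
  by apply/cvg_ex; exists `|f x|; exact: cvg_norm.
have mI : measurable (`[s, t] : set (measurableTypeR R)) by exact: measurable_itv.
apply: (@Rdominated_cvg _ _ _ lam _ mI (fun n => pairing (F n)) (pairing f)
  (fun r => C * pairing phi r) _ _ _ _ _).2.
- by move=> n; apply: measurable_funTS; exact: measurable_pairing (FC n).
- by apply: measurable_funTS; exact: measurable_pairing fC.
- by apply: aeW => r _; exact: pairing_cvg FC Ff.
- by apply: RintZ => //; exact: Im.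
- by apply: aeW => r n _; exact: pairing_le.
Qed.

End pairing.

(** * Essential limits at time zero *)

Section essential_limit.
Variable R : realType.

Let lam : {sigma_finite_measure set (measurableTypeR R) -> \bar R} :=
  @lebesgue_measure R.
Implicit Types (N : set (measurableTypeR R)) (f g : R -> R) (k l : R).

Lemma time_outside_null (b : R) (N : set (measurableTypeR R)) : 0 < b -> lam.-negligible N ->
  exists t, [/\ 0 < t, t < b & ~ N t].
Proof.
move=> b0 [A [mA A0 NA]]; apply: contrapT => H.
have : (lam [set` `]0%R, b[] <= lam A)%E.
  apply: le_measure; rewrite ?inE//.
  move=> t /=; rewrite in_itv /= => /andP[t0 tb]; apply: NA.
  by apply: contrapT => Nt; apply: H; exists t.
have := lebesgue_measure_itv `]0, b[; rewrite /= lte_fin b0 => ->.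
by rewrite A0 sube0 lee_fin leNgt b0.
Qed.

Definition near0_off N : set_system R := within (~` N) (0 : R)^'+.

Lemma near0_offP N (P : R -> Prop) b : 0 < b ->
  (forall t, 0 < t -> t < b -> ~ N t -> P t) -> near0_off N P.
Proof.
move=> b0 HP; have := nbhs_right_lt b0; rewrite /near0_off /within /=.
move=> H; have H' := nbhs_right_gt (0 : R).
by apply: filterS2 H H' => t tb t0 Nt; exact: HP.
Qed.

Lemma near0_off_ex N (P : R -> Prop) : near0_off N P ->
  exists2 b, 0 < b & forall t, 0 < t -> t < b -> ~ N t -> P t.
Proof.
move=> [b /= b0 H]; exists b => // t t0 tb Nt; apply: H => //.
by rewrite /= sub0r normrN gtr0_norm.
Qed.

Lemma near0_off_proper N : lam.-negligible N -> ProperFilter (near0_off N).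
Proof.
move=> negN.
have FF : Filter (near0_off N) by rewrite /near0_off; apply: within_filter.
apply: (Build_ProperFilter _ FF) => /near0_off_ex[b b0 H].
have [t [t0 tb Nt]] := time_outside_null b0 negN.
exact: H Nt.
Qed.

Definition ess_cvg f l : Prop :=
  exists2 N, lam.-negligible N & f @ near0_off N --> l.

Lemma near0_off_cvgS N N' f l : N `<=` N' -> f @ near0_off N --> l ->
  f @ near0_off N' --> l.
Proof.
move=> NN' Nf A /Nf /near0_off_ex[b b0 H]; apply: (near0_offP b0) => t t0 tb Nt.
by apply: H => // /NN'.
Qed.

Lemma ess_cvg2 f g k l : ess_cvg f k -> ess_cvg g l ->
  exists N, [/\ lam.-negligible N, f @ near0_off N --> k & g @ near0_off N --> l].
Proof.
move=> [N negN fk] [N' negN' gl]; exists (N `|` N'); split.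
- exact: negligibleU.
- by apply: near0_off_cvgS fk; left.
- by apply: near0_off_cvgS gl; right.
Qed.

Lemma ess_cvg_unique f k l : ess_cvg f k -> ess_cvg f l -> k = l.
Proof.
move=> fk fl; have [N [negN {}fk {}fl]] := ess_cvg2 fk fl.
have PF := near0_off_proper negN.
exact: (@cvg_unique _ (@norm_hausdorff _ _) _ _ _ _ fk fl).
Qed.

Lemma ess_cvgD f g k l : ess_cvg f k -> ess_cvg g l ->
  ess_cvg (fun t => f t + g t) (k + l).
Proof.
move=> fk gl; have [N [negN {}fk {}gl]] := ess_cvg2 fk gl.
have PF := near0_off_proper negN.
by exists N => //; exact: cvgD.
Qed.

Lemma ess_cvgZ a f l : ess_cvg f l -> ess_cvg (fun t => a * f t) (a * l).
Proof.
move=> [N negN fl]; have PF := near0_off_proper negN.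
by exists N => //; apply: cvgMr.
Qed.

Lemma ess_cvg_ge f l k b N : ess_cvg f l -> 0 < b -> lam.-negligible N ->
  (forall t, 0 < t -> t < b -> ~ N t -> k <= f t) -> k <= l.
Proof.
move=> [N' negN' fl] b0 negN kf.
have {}fl : f @ near0_off (N' `|` N) --> l.
  by apply: near0_off_cvgS fl; left.
have PF := near0_off_proper (negligibleU negN' negN).
apply: (ler_cvg_to (cvg_cst k) fl); apply: (near0_offP b0) => t t0 tb /not_orP[_].
exact: kf.
Qed.

Lemma ess_cvg_le f l k b N : ess_cvg f l -> 0 < b -> lam.-negligible N ->
  (forall t, 0 < t -> t < b -> ~ N t -> f t <= k) -> l <= k.
Proof.
move=> fl b0 negN fk; rewrite -lerN2 -[- l]mulN1r.
apply: (ess_cvg_ge (ess_cvgZ (-1) fl) b0 negN) => t t0 tb Nt.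
by rewrite mulN1r lerN2 fk.
Qed.

Lemma ess_cvg_cauchy f N : lam.-negligible N ->
  (forall e, 0 < e -> exists2 b, 0 < b & forall s t, 0 < s -> s < t -> t < b ->
    ~ N s -> ~ N t -> `|f s - f t| <= e) ->
  exists l, ess_cvg f l.
Proof.
move=> negN Hf; have PF := near0_off_proper negN.
have : cvg (f @ near0_off N).
  apply: cauchy_cvg; apply: cauchy_exP => e e0.
  have e20 : 0 < e / 2 by rewrite divr_gt0.
  have [b b0 Hb] := Hf _ e20.
  have [t [t0 tb Nt]] := time_outside_null b0 negN.
  exists (f t); apply: (near0_offP t0) => s s0 st Ns.
  rewrite /ball /= /ball_ distrC; apply: (le_lt_trans (Hb s t s0 st tb Ns Nt)).
  by rewrite ltr_pdivrMr// ltr_pMr// ltr1n.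
by move=> /cvg_ex[l fl]; exists l, N.
Qed.

End essential_limit.

(** * The evolution of the averages *)

Section evolution.
Variables (R : realType) (d : nat).
Variable nu : {measure set 'rV[R]_d -> \bar R}.
Hypothesis Hnu : symmetric_levy_measure nu.
Variables (T : R) (phi : 'rV[R]_d -> R) (c : R) (u : 'rV[R]_d * R -> R).
Hypothesis T0 : 0 < T.
Hypotheses (Cphi : class_C 2 phi) (phi0 : forall x, 0 < phi x) (c0 : 0 <= c).
Hypothesis HL : forall x, `|levy_op nu phi x| <= c * phi x.
Hypothesis HB : forall psi : 'rV[R]_d -> R, Cc_infty setT psi -> forall x,
     `|levy_form nu psi phi x| <=
       c * Num.max (sup_norm psi) (grad_sup_norm psi) * phi x.
Hypothesis Hu : very_weak_solution nu T u.
Variables (w : 'rV[R]_d * measurableTypeR R -> R) (N0 : set (measurableTypeR R)).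

Let leb : {sigma_finite_measure set 'rV[R]_d -> \bar R} := @lebesgue_rV R d.
Let lam : {sigma_finite_measure set (measurableTypeR R) -> \bar R} :=
  @lebesgue_measure R.

Hypotheses (mw : measurable_fun setT w) (w0 : forall z, 0 <= w z).
Hypothesis Iw : forall t, leb.-integrable setT (EFin \o (fun x => w (x, t) * phi x)).
Hypothesis Im : forall e T', 0 < e -> e < T' -> T' < T ->
  lam.-integrable `[e, T'] (EFin \o pairing w phi).
Hypothesis negN0 : lam.-negligible N0.
Hypothesis wu : forall t, 0 < t -> t < T -> ~ N0 t ->
  {ae leb, forall x, w (x, t) = u (x, t)}.
Implicit Types (f g : 'rV[R]_d -> R) (M r : R).

Let cphi : continuous phi. Proof. exact: class_C_cont Cphi. Qed.
Let a := pairing w.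

Let slice_measurable (k : 'rV[R]_d * measurableTypeR R -> \bar R) :
  measurable_fun setT k ->
  measurable_fun [set: measurableTypeR R] (fun t => \int[leb]_x k (x, t))%E.
Proof.
move=> mk.
have -> : (fun t => \int[leb]_x k (x, t))%E =
    (fun t => \int[leb]_x (k^\+)%E (x, t) - \int[leb]_x (k^\-)%E (x, t))%E.
  by apply/funext => t; rewrite [LHS]integralE; congr (_ - _)%E;
    apply: eq_integral => x _; rewrite ?funeposE ?funenegE.
have slice (l : 'rV[R]_d * measurableTypeR R -> \bar R) : measurable_fun setT l ->
    (forall z, 0 <= l z)%E ->
    measurable_fun [set: measurableTypeR R] (fun t => \int[leb]_x l (x, t))%E.
  exact: measurable_fun_fubini_tonelli_G.
apply: emeasurable_funB.
  apply: (slice (k^\+)%E); first exact: measurable_funepos.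
  by move=> z; exact: funepos_ge0.
apply: (slice (k^\-)%E); first exact: measurable_funeneg.
by move=> z; exact: funeneg_ge0.
Qed.

(** A positive continuous weight dominates bounded functions supported in a fixed
    cube, uniformly. *)
Lemma dominated_of_vanishes_off r : 0 <= r -> exists2 K : R, 0 <= K &
  forall f M, 0 <= M -> vanishes_off r f -> (forall x, `|f x| <= M) ->
    forall x, `|f x| <= K * M * phi x.
Proof.
move=> r0; have [k k0 Hk] := positive_on_cube cphi phi0 r0.
exists k^-1; first by rewrite invr_ge0 ltW.
move=> f M M0 fr fM x; have [xr|xr] := leP `|x| r; last first.
  by rewrite fr// normr0 !mulr_ge0 ?invr_ge0 ?(ltW k0)// ltW.
apply: (le_trans (fM x)); rewrite mulrAC -mulrC ler_peMr// ler_pdivlMl// mulr1.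
exact: Hk.
Qed.

Let test_function f r (eta : R -> R) (e T' : R) :
  (forall k, class_C k f) -> vanishes_off r f ->
  (forall k, class_C k eta) -> 0 < e -> T' < T ->
  (forall s, s < e \/ T' < s -> eta s = 0) ->
  Cc_infty (cylinder T) (fun z : 'rV[R]_d * R => f z.1 * eta z.2).
Proof.
move=> Cf fr Ceta e0 T'T eta0.
pose K := [set x : 'rV[R]_d | `|x| <= r] `*` `[e, T'].
have cK : compact K by apply: compact_setX; [exact: compact_ball_rV|exact: segment_compact].
have sK : supp (fun z : 'rV[R]_d * R => f z.1 * eta z.2) `<=` K.
  rewrite /supp [X in _ `<=` X](iffLR (closure_id K)); last first.
    by apply: compact_closed => //; exact: norm_hausdorff.
  apply: closure_subset => -[x s] /= fe; split => /=.
    by rewrite leNgt; apply/negP => /fr xr; rewrite xr mul0r eqxx in fe.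
  rewrite in_itv /= !leNgt; apply/andP; split; apply/negP => h.
    by rewrite eta0 ?mulr0 ?eqxx// in fe; left.
  by rewrite eta0 ?mulr0 ?eqxx// in fe; right.
split.
- move=> k; apply: class_CM.
    apply: (@class_C_affine R ('rV[R]_d * R)%type 'rV[R]_d k f fst fst) => //.
    by move=> x; exact: cvg_fst.
  apply: (@class_C_affine R ('rV[R]_d * R)%type R k eta snd snd) => //.
  by move=> x; exact: cvg_snd.
- apply: subclosed_compact cK sK; exact: closed_closure.
- move=> z /sK [_ /=]; rewrite in_itv /= => /andP[z1 z2]; split => //=.
  by rewrite in_itv /= (lt_le_trans e0 z1) (le_lt_trans z2 T'T).
Qed.

Let Lu : L1loc T u := Hu.1.

Let slice_u t : 0 < t -> t < T -> measurable_fun setT (fun x => u (x, t)).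
Proof.
move=> t0 tT.
have mcyl : measurable (cylinder T : set ('rV[R]_d * measurableTypeR R)).
  by apply: measurableX => //; exact: measurable_itv.
have mU : measurable_fun setT (u \_ (cylinder T : set ('rV[R]_d * measurableTypeR R))).
  by apply/measurable_restrict => //; rewrite setTI; exact: L1loc_measurable.
have -> : (fun x => u (x, t)) = (fun x =>
    (u \_ (cylinder T : set ('rV[R]_d * measurableTypeR R))) (x, t)).
  by apply/funext => x; rewrite patchE mem_set//; split => //=; rewrite in_itv /= t0.
exact: (measurableT_comp mU (pair2_measurable t)).
Qed.

Let slice_integral f C t : 0 < t -> t < T -> ~ N0 t -> continuous f ->
  (forall x, `|f x| <= C * phi x) -> (\int[leb]_x (u (x, t) * f x)%:E = (a f t)%:E)%E.
Proof.
move=> t0 tT Nt cf fC; have mf := continuous_measurable_rV cf.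
have I := pairing_int mw w0 Iw t cf fC.
transitivity (\int[leb]_x (w (x, t) * f x)%:E)%E.
  apply: ae_eq_integral => //.
  - by apply/measurable_EFinP; exact: measurable_funM (slice_u t0 tT) mf.
  - by case/integrableP: I.
  - by apply: filterS (wu t0 tT Nt) => x wux _; rewrite /= wux.
by rewrite /a /pairing /Rintegral fineK//; exact: integrable_fin_num I.
Qed.

(** Testing with the products [f(x) eta(t)] and integrating in space first reduces
    the equation to a weak ordinary differential identity. *)
Lemma weak_formulation_pairing f r (eta : R -> R) (e T' C C' : R) :
  (forall k, class_C k f) -> vanishes_off r f ->
  (forall x, `|f x| <= C * phi x) -> (forall x, `|levy_op nu f x| <= C' * phi x) ->
  (forall k, class_C k eta) -> 0 < e -> T' < T ->
  (forall s, s < e \/ T' < s -> eta s = 0) ->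
  \int[lam]_(t in `]0, T[)
    (derive1 eta t * a f t - eta t * a (levy_op nu f) t) = 0.
Proof.
move=> Cf fr fC LfC Ceta e0 T'T eta0.
have Hw := Hu.2.
have [_] := Hw _ (test_function Cf fr Ceta e0 T'T eta0).
have cf := class_C_cont (Cf 0%N).
have [M M0 [fM f2]] := C2_second_diff_bound (Cf 2%N) fr.
have cLf : continuous (levy_op nu f) by exact: levy_op_continuous f2.
have ceta' : continuous (derive1 eta).
  have -> : derive1 eta = 'D_1 eta by apply/funext => t; rewrite derive1E.
  by have [_ /(_ 1)[_ h]] := Ceta 1%N; exact: h.
have meta : measurable_fun [set: measurableTypeR R] eta.
  exact: (continuous_measurable_fun (class_C_cont (Ceta 0%N))).
have meta' : measurable_fun [set: measurableTypeR R] (derive1 eta).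
  exact: (continuous_measurable_fun ceta').
have deta t : derivable eta t 1 by have [_ /(_ 1)[h _]] := Ceta 1%N; exact: h.
pose h x t := derive1 eta t * f x - eta t * levy_op nu f x.
have -> : (\int[lebesgue_measure]_(t in `]0%R, T[) \int[lebesgue_rV (n:=d)]_x
    (u (x, t) * (derive1 (fun s => f (x, s).1 * eta (x, s).2) t -
      levy_op nu (fun z => f (z, t).1 * eta (z, t).2) x))%:E)%E =
  (\int[lam]_(t in `]0%R, T[) \int[leb]_x (u (x, t) * h x t)%:E)%E.
  apply: eq_integral => t _; apply: eq_integral => x _ /=.
  congr (_ * (_ - _))%:E; last exact: levy_opZ f2 _ _.
  under eq_fun do rewrite mulrC.
  by rewrite derive1Mr// mulrC.
pose U := u \_ (cylinder T : set ('rV[R]_d * measurableTypeR R)).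
have mcyl : measurable (cylinder T : set ('rV[R]_d * measurableTypeR R)).
  by apply: measurableX => //; exact: measurable_itv.
have mU : measurable_fun setT U.
  by apply/measurable_restrict => //; rewrite setTI; exact: L1loc_measurable.
have mh : measurable_fun setT
    (fun z : 'rV[R]_d * measurableTypeR R => h z.1 z.2).
  have mfst g : continuous g -> measurable_fun setT
      (fun z : 'rV[R]_d * measurableTypeR R => g z.1).
    move=> cg; apply: measurableT_comp; last exact: measurable_fst.
    exact: continuous_measurable_rV.
  have msnd (g : R -> R) : measurable_fun [set: measurableTypeR R] g ->
      measurable_fun setT (fun z : 'rV[R]_d * measurableTypeR R => g z.2).
    by move=> mg; apply: measurableT_comp mg _; exact: measurable_snd.
  apply: measurable_funB; apply: measurable_funM.
  - exact: (msnd _ meta').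
  - exact: mfst.
  - exact: (msnd _ meta).
  - exact: mfst.
have uU x t : 0 < t -> t < T -> u (x, t) = U (x, t).
  move=> t0 tT; rewrite /U patchE mem_set//; split => //=.
  by rewrite in_itv /= t0.
have mI : measurable (`]0, T[ : set (measurableTypeR R)) by exact: measurable_itv.
have -> : (\int[lam]_(t in `]0%R, T[) \int[leb]_x (u (x, t) * h x t)%:E =
  \int[lam]_(t in `]0%R, T[)
    (derive1 eta t * a f t - eta t * a (levy_op nu f) t)%:E)%E.
  apply: ae_eq_integral => //.
  - apply: (@eq_measurable_fun _ _ _ _ _ (fun t => \int[leb]_x (U (x, t) * h x t)%:E)%E).
      move=> t; rewrite inE /= in_itv /= => /andP[t0 tT].
      by apply: eq_integral => x _; rewrite uU.
    apply: measurable_funTS.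
    apply: (slice_measurable (k := fun z => (U z * h z.1 z.2)%:E)).
    by apply/measurable_EFinP; exact: measurable_funM.
  - apply/measurable_EFinP; apply: measurable_funTS; apply: measurable_funB.
      by apply: (measurable_funM meta'); exact: measurable_pairing fC.
    by apply: (measurable_funM meta); exact: measurable_pairing LfC.
  - apply: negligibleS negN0 => t /= /not_implyP[].
    rewrite in_itv /= => /andP[t0 tT]; apply: contra_notP => Nt.
    have C1 x : `|derive1 eta t * f x| <= (`|derive1 eta t| * C) * phi x.
      by rewrite normrM -mulrA ler_wpM2l.
    have C2 x : `|eta t * levy_op nu f x| <= (`|eta t| * C') * phi x.
      by rewrite normrM -mulrA ler_wpM2l.
    have c1 : continuous (fun x => derive1 eta t * f x) by exact: contZ.
    have c2 : continuous (fun x => eta t * levy_op nu f x) by exact: contZ.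
    rewrite -(pairingZ mw w0 Iw _ _ cf fC) -(pairingZ mw w0 Iw _ _ cLf LfC).
    rewrite -(pairingB mw w0 Iw _ c1 c2 C1 C2).
    apply: (slice_integral (C := `|derive1 eta t| * C + `|eta t| * C')) => //.
      exact: contB.
    by move=> x; rewrite mulrDl; apply: (le_trans (ler_normB _ _)); exact: lerD.
by rewrite /Rintegral => ->.
Qed.

Let smooth_increment f r M C C' : (forall k, class_C k f) -> vanishes_off r f ->
  second_diff_bound M f ->
  (forall x, `|f x| <= C * phi x) -> (forall x, `|levy_op nu f x| <= C' * phi x) ->
  exists2 N : set (measurableTypeR R), lam.-negligible N &
    forall s t, 0 < s -> s < t -> t < T -> ~ N s -> ~ N t ->
    a f s - a f t = \int[lam]_(q in `[s, t]) a (levy_op nu f) q.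
Proof.
move=> Cf fr f2 fC LfC; have cf := class_C_cont (Cf 0%N).
apply: weak_derivative_increment.
- by move=> e T' e0 eT' T'T; exact: pairing_time_int fC e0 eT' T'T.
- move=> e T' e0 eT' T'T; apply: pairing_time_int LfC e0 eT' T'T => //.
  exact: levy_op_continuous f2.
- move=> eta Ceta e T' e0 eT' T'T eta0.
  exact: weak_formulation_pairing Cf fr fC LfC Ceta e0 T'T eta0.
Qed.

(** The evolution identity extends from smooth functions by mollification; this is
    needed because [phi] is only of class C^2. *)
Lemma pairing_increment f r M : 0 <= r -> 0 <= M -> continuous f ->
  vanishes_off r f -> (forall x, `|f x| <= M) -> second_diff_bound M f ->
  exists2 N : set (measurableTypeR R), lam.-negligible N &
    forall s t, 0 < s -> s < t -> t < T -> ~ N s -> ~ N t ->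
    a f s - a f t = \int[lam]_(q in `[s, t]) a (levy_op nu f) q.
Proof.
move=> r0 M0 cf fr fM f2.
have r20 : 0 <= r + 2 by rewrite addr_ge0.
have [K K0 HK] := dominated_of_vanishes_off r20.
have [C C0 HC] := levy_op_dominated Hnu Cphi phi0 c0 HB r20.
pose F := mollify f.
have CF n k : class_C k (F n) by exact: class_C_mollify cf fr n k.
have cF n : continuous (F n) by exact: class_C_cont (CF n 0%N).
have Fr n : vanishes_off (r + 2) (F n) by exact: vanishes_off_mollify.
have FM n x : `|F n x| <= M by exact: mollify_bounded cf fr n M fM x.
have F2 n : second_diff_bound M (F n) by exact: (mollify_second_diff cf fr n f2).
have Ff x : F n x @[n --> \oo] --> f x by exact: (mollify_cvg cf fr).
have FK n x : `|F n x| <= K * M * phi x by exact: HK.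
have LFC n x : `|levy_op nu (F n) x| <= C * M * phi x by exact: HC.
have LFf x : levy_op nu (F n) x @[n --> \oo] --> levy_op nu f x.
  apply: (levy_op_cvg Hnu cf cF F2) => y.
  by apply: cvgB => //; apply: cvgMl; exact: cvgD.
have cLF n : continuous (levy_op nu (F n)) by exact: levy_op_continuous (F2 n).
have cLf : continuous (levy_op nu f) by exact: levy_op_continuous f2.
have /choice[N HN] : forall n, exists N : set (measurableTypeR R),
    lam.-negligible N /\
    forall s t, 0 < s -> s < t -> t < T -> ~ N s -> ~ N t ->
    a (F n) s - a (F n) t = \int[lam]_(q in `[s, t]) a (levy_op nu (F n)) q.
  move=> n; have [N negN HN] := smooth_increment (CF n) (Fr n) (F2 n) (FK n) (LFC n).
  by exists N.
exists (\bigcup_n N n); first by apply: negligible_bigcup => n; case: (HN n).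
move=> s t s0 st tT Ns Nt.
have lhs : a (F n) s - a (F n) t @[n --> \oo] --> a f s - a f t.
  by apply: cvgB; exact: pairing_cvg FK Ff.
have rhs : \int[lam]_(q in `[s, t]) a (levy_op nu (F n)) q @[n --> \oo] -->
    \int[lam]_(q in `[s, t]) a (levy_op nu f) q.
  exact: pairing_time_cvg LFC LFf s0 st tT.
have E : (fun n => a (F n) s - a (F n) t) =
    (fun n => \int[lam]_(q in `[s, t]) a (levy_op nu (F n)) q).
  apply/funext => n; apply: (HN n).2 => // h.
    by apply: Ns; exists n.
  by apply: Nt; exists n.
by rewrite E in lhs; exact: (cvg_unique _ lhs rhs).
Qed.

(** Testing with [phi] itself, through its truncations [chi_n phi], for which the
    constant does not depend on [n]; both sides pass to the limit by dominated
    convergence. *)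
Lemma mass_increment : exists2 C, 0 <= C &
  exists2 N : set (measurableTypeR R), lam.-negligible N &
    forall s t, 0 < s -> s < t -> t < T -> ~ N s -> ~ N t ->
    a phi s <= a phi t + C * \int[lam]_(q in `[s, t]) a phi q.
Proof.
have [C C0 HC] := levy_op_cutoff_bound Hnu Cphi phi0 c0 HL HB.
exists C => //.
pose F n x := dilated_cutoff n x * phi x.
have CF n : class_C 2 (F n) by exact: (class_CM (class_C_dilated_cutoff R d n 2) Cphi).
have cF n : continuous (F n) by exact: class_C_cont (CF n).
have Fr n : vanishes_off (2 * n.+1%:R) (F n).
  by apply: vanishes_offM; exact: dilated_cutoff0.
have r0 n : (0 : R) <= 2 * n.+1%:R by [].
have Fphi n x : `|F n x| <= 1 * phi x.
  rewrite mul1r ger0_norm; last by rewrite mulr_ge0 ?dilated_cutoff_ge0// ltW.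
  by rewrite ler_piMl ?dilated_cutoff_le1// ltW.
have /choice[N HN] : forall n, exists N : set (measurableTypeR R),
    lam.-negligible N /\
    forall s t, 0 < s -> s < t -> t < T -> ~ N s -> ~ N t ->
    a (F n) s <= a (F n) t + C * \int[lam]_(q in `[s, t]) a phi q.
  move=> n; have [M M0 [FM F2]] := C2_second_diff_bound (CF n) (Fr n).
  have [N negN HN] := pairing_increment (r0 n) M0 (cF n) (Fr n) FM F2.
  exists N; split => // s t s0 st tT Ns Nt.
  have cLF : continuous (levy_op nu (F n)) by exact: levy_op_continuous F2.
  have mI : measurable (`[s, t] : set (measurableTypeR R)) by exact: measurable_itv.
  rewrite -lerBlDl HN// -RintegralZl//; last exact: Im.
  apply: (le_trans (ler_norm _)); apply: Rintegral_norm_le => //.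
  - exact: pairing_time_int (HC n) s0 st tT.
  - by apply: RintZ => //; exact: Im.
  - by move=> q _; exact: pairing_le (HC n).
exists (\bigcup_n N n); first by apply: negligible_bigcup => n; case: (HN n).
move=> s t s0 st tT Ns Nt.
have Fcvg x : F n x @[n --> \oo] --> phi x.
  by rewrite -[phi x]mul1r; apply: cvgMl; exact: dilated_cutoff_cvg.
have lim q : a (F n) q @[n --> \oo] --> a phi q by exact: pairing_cvg Fphi Fcvg.
apply: (ler_cvg_to (lim s) (cvgD (lim t) (cvg_cst _))).
apply: nearW => n; apply: (HN n).2 => // h.
  by apply: Ns; exists n.
by apply: Nt; exists n.
Qed.

Let mass_ge0 t : 0 <= a phi t.
Proof. by apply: pairing_ge0 => // x; exact: ltW. Qed.

Let mass_integral_le s t D N : 0 < s -> s < t -> t < T -> lam.-negligible N ->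
  0 <= D -> (forall q, s <= q -> q <= t -> ~ N q -> a phi q <= D) ->
  \int[lam]_(q in `[s, t]) a phi q <= D * (t - s).
Proof.
move=> s0 st tT negN D0 HD.
have mI : measurable (`[s, t] : set (measurableTypeR R)) by exact: measurable_itv.
have Ic : lam.-integrable `[s, t] (EFin \o (fun=> D)).
  apply: continuous_compact_integrable; first exact: segment_compact.
  exact: cst_continuous.
have Is : lam.-integrable `[s, t] (EFin \o a phi) by exact: Im.
apply: (@le_trans _ _ (\int[lam]_(q in `[s, t]) D)).
  have fI := integrable_fin_num mI Is; have fc := integrable_fin_num mI Ic.
  rewrite -lee_fin /Rintegral !fineK//; apply: ae_ge0_le_integral => //.
  - by move=> q _; rewrite lee_fin.
  - by case/integrableP: Is.
  - apply: negligibleS negN => q /= /not_implyP[]; rewrite in_itv/= => /andP[sq qt].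
    by apply: contra_notP => Nq; rewrite lee_fin; exact: HD.
rewrite Rintegral_cst// le_eqVlt; apply/orP; left; apply/eqP; congr (_ * _).
by have := lebesgue_measure_itv `[s, t]; rewrite /= lte_fin st => ->.
Qed.

(** Grönwall's inequality backwards in time: on a short interval the integral of
    the mass absorbs itself. *)
Lemma mass_bounded : exists t0 M, [/\ 0 < t0, t0 < T, 0 <= M &
  exists2 N : set (measurableTypeR R), lam.-negligible N &
    forall s, 0 < s -> s < t0 -> ~ N s -> a phi s <= M].
Proof.
have [C C0 [N negN HN]] := mass_increment.
(* below this time the mass absorbs half of its own integral: C * t0 <= 1/2 *)
pose b := Num.min T (2 * (C + 1))^-1.
have b0 : 0 < b by rewrite lt_min T0 invr_gt0 mulr_gt0// ltr_wpDl.
have [t0 [t00 t0b Nt0]] := time_outside_null b0 negN.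
move: t0b; rewrite lt_min => /andP[t0T t0C].
have Ct0 : C * t0 <= 2^-1.
  have C1 : 0 < C + 1 by rewrite ltr_wpDl.
  have : t0 * (C + 1) <= 2^-1.
    by rewrite -ler_pdivlMr// -invfM ltW.
  by apply: le_trans; rewrite mulrC ler_pM2l// lerDl.
exists t0, (2 * a phi t0); split => //; first exact: mulr_ge0.
exists N => // s s0 st0 Ns.
pose G := \int[lam]_(q in `[s, t0]) a phi q.
have G0 : 0 <= G by apply: Rintegral_ge0.
have GE : G <= (a phi t0 + C * G) * (t0 - s).
  apply: (mass_integral_le s0 st0 t0T negN) => [|q sq qt0 Nq].
    by rewrite addr_ge0// mulr_ge0.
  move: qt0; rewrite le_eqVlt => /predU1P[->|qt0]; first by rewrite lerDl mulr_ge0.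
  have q0 : 0 < q by exact: lt_le_trans sq.
  apply: (le_trans (HN q t0 q0 qt0 t0T Nq Nt0)); rewrite lerD2l ler_wpM2l//.
  have Is : lam.-integrable `[s, t0] (EFin \o a phi) by exact: Im.
  have Iq : lam.-integrable `[q, t0] (EFin \o a phi) by exact: Im.
  rewrite -lee_fin /G /Rintegral !fineK ?integrable_fin_num//.
  apply: ge0_subset_integral => //.
  - by case/integrableP: Is.
  - by move=> y _; rewrite lee_fin.
  - by apply: subset_itvr; rewrite bnd_simp.
have {}GE : G <= t0 * (a phi t0 + C * G).
  apply: (le_trans GE); rewrite mulrC ler_wpM2r//; last by rewrite gerBl ltW.
  by rewrite addr_ge0// mulr_ge0.
have := HN s t0 s0 st0 t0T Ns Nt0; rewrite -/G.
move: GE Ct0 G0 (mass_ge0 t0) (ltW t00) C0; move: (a phi s) (a phi t0) G => x y g.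
move=> *; nra.
Qed.

(** * The initial trace *)

Let Cc_dominated psi : Cc psi -> exists C, forall x, `|psi x| <= C * phi x.
Proof.
move=> /Cc_rVP[cpsi [r psir]]; have [M M0 psiM] := vanishes_off_bounded cpsi psir.
have [K _ HK] := dominated_of_vanishes_off (normr_ge0 r).
exists (K * M) => x; apply: HK => // y yr; apply: psir.
exact: le_lt_trans (ler_norm r) yr.
Qed.

(** Smooth averages are Lipschitz near time zero because the mass is bounded
    there, and uniform approximation passes the Cauchy property on to every
    continuous test function. *)
Let pairing_ess_cvg psi : Cc psi -> exists l, ess_cvg (a psi) l.
Proof.
move=> Cpsi; have /Cc_rVP[cpsi [r' psir']] := Cpsi.
pose r := `|r'|; have psir : vanishes_off r psi.
  by move=> y yr; apply: psir'; exact: le_lt_trans (ler_norm r') yr.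
have r0 : 0 <= r + 2 by rewrite addr_ge0// normr_ge0.
have [CP HCP] := Cc_dominated Cpsi.
have [K K0 HK] := dominated_of_vanishes_off r0.
have [C C0 HC] := levy_op_dominated Hnu Cphi phi0 c0 HB r0.
have [t0 [M [t00 t0T M0 [N1 negN1 HM]]]] := mass_bounded.
pose F := mollify psi.
have CF n k : class_C k (F n) by exact: class_C_mollify cpsi psir n k.
have cF n : continuous (F n) by exact: class_C_cont (CF n 0%N).
have Fr n : vanishes_off (r + 2) (F n) by exact: vanishes_off_mollify.
have /choice[N HN] : forall n, exists N : set (measurableTypeR R),
    lam.-negligible N /\ exists2 D, 0 <= D & (forall x, `|F n x| <= K * D * phi x) /\
    forall s t, 0 < s -> s < t -> t < t0 -> ~ (N1 `|` N) s -> ~ (N1 `|` N) t ->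
    `|a (F n) s - a (F n) t| <= D * (t - s).
  move=> n; have [D D0 [FD F2]] := C2_second_diff_bound (CF n 2%N) (Fr n).
  have [N negN HN] := pairing_increment r0 D0 (cF n) (Fr n) FD F2.
  have LFD := HC _ _ D0 (cF n) (Fr n) FD F2.
  exists N; split => //; exists (Num.max D (C * D * M)); first by rewrite le_max D0.
  split => [x|s t s0 st tt0 /not_orP[N1s Ns] /not_orP[N1t Nt]].
    apply: HK => //; first by rewrite le_max D0.
    by move=> y; rewrite le_max FD.
  have tT : t < T by exact: lt_trans t0T.
  rewrite HN//; have cLF : continuous (levy_op nu (F n)).
    exact: levy_op_continuous F2.
  have mI : measurable (`[s, t] : set (measurableTypeR R)) by exact: measurable_itv.
  have Is : lam.-integrable `[s, t] (EFin \o a phi) by exact: Im.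
  apply: (@le_trans _ _ (C * D * \int[lam]_(q in `[s, t]) a phi q)).
    rewrite -RintegralZl//; apply: Rintegral_norm_le => //.
    - exact: pairing_time_int LFD s0 st tT.
    - exact: RintZ.
    - by move=> q _; exact: pairing_le LFD.
  apply: (@le_trans _ _ (C * D * M * (t - s))).
    rewrite -[leRHS]mulrA ler_wpM2l ?mulr_ge0//.
    apply: (mass_integral_le s0 st tT negN1 M0) => q sq qt N1q; apply: HM => //.
      exact: lt_le_trans sq.
    exact: le_lt_trans tt0.
  by rewrite ler_wpM2r ?subr_ge0 ?(ltW st)// le_max lexx orbT.
apply: (@ess_cvg_cauchy _ _ (N1 `|` \bigcup_n N n)).
  by apply: negligibleU => //; apply: negligible_bigcup => n; case: (HN n).
move=> e e0; pose e' := e / (3 * (K * M + 1)).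
have KM1 : 0 < K * M + 1 by rewrite ltr_wpDl// mulr_ge0.
have e'0 : 0 < e' by rewrite divr_gt0// mulr_gt0.
have [n /(_ n (leqnn n)) Fn] := mollify_uniform_cvg cpsi psir e'0.
have [_ [D D0 [FD Fst]]] := HN n.
have D1 : 0 < 3 * (D + 1) by rewrite mulr_gt0// ltr_wpDl.
exists (Num.min t0 (e / (3 * (D + 1)))); first by rewrite lt_min t00 divr_gt0.
move=> s t s0 st; rewrite lt_min => /andP[tt0 te] Ns Nt.
have N1s : ~ N1 s by move=> h; apply: Ns; left.
have N1t : ~ N1 t by move=> h; apply: Nt; left.
have approx q : 0 < q -> q < t0 -> ~ N1 q -> `|a (F n) q - a psi q| <= e / 3.
  move=> q0 qt0 N1q; have cB : continuous (fun x => F n x - psi x) by exact: contB.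
  have Bphi x : `|F n x - psi x| <= K * e' * phi x.
    apply: (HK (fun x => F n x - psi x) _ (ltW e'0)) => // y yr.
    rewrite (Fr n y yr) psir ?subr0//; apply: lt_trans yr.
    by rewrite ltrDl.
  rewrite -(pairingB mw w0 Iw q (cF n) cpsi FD HCP).
  apply: (le_trans (pairing_le mw w0 Iw q cB Bphi)).
  apply: (@le_trans _ _ (K * e' * M)).
    by apply: ler_wpM2l; [rewrite mulr_ge0// ltW|exact: HM].
  have -> : K * e' * M = e / 3 * (K * M / (K * M + 1)).
    by rewrite /e'; field; rewrite gt_eqF.
  rewrite ler_piMr ?divr_ge0 ?(ltW e0)// ler_pdivrMr// mul1r.
  by rewrite lerDl.
have s't0 : s < t0 by exact: lt_trans tt0.
have t'0 : 0 < t by exact: lt_trans st.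
have As := approx s s0 s't0 N1s; have At := approx t t'0 tt0 N1t.
have Fst' : `|a (F n) s - a (F n) t| <= e / 3.
  apply: le_trans (Fst s t s0 st tt0 _ _) _.
  - by move=> [//|h]; apply: Ns; right; exists n.
  - by move=> [//|h]; apply: Nt; right; exists n.
  apply: (@le_trans _ _ ((D + 1) * t)).
    by apply: ler_pM; rewrite ?subr_ge0 ?(ltW st)// ?lerDl// gerBl ltW.
  rewrite mulrC -ler_pdivlMr ?ltr_wpDl//; apply: (le_trans (ltW te)).
  by rewrite invfM mulrA.
move: As At Fst'; rewrite !ler_norml.
move: (a (F n) s) (a (F n) t) (a psi s) (a psi t) => x y x' y'.
by move=> /andP[? ?] /andP[? ?] /andP[? ?]; apply/andP; split; lra.
Qed.

Lemma initial_trace_exists : exists mu0 : {measure set 'rV[R]_d -> \bar R},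
  [/\ radon_on setT mu0, initial_trace u mu0 & (\int[mu0]_x (phi x)%:E < +oo)%E].
Proof.
have /choice[L HL'] : forall psi, exists l, Cc psi -> ess_cvg (a psi) l.
  move=> psi; have [/pairing_ess_cvg[l hl]|h] := pselect (Cc psi).
    by exists l.
  by exists 0.
have cCc (psi : 'rV[R]_d -> R) : Cc psi -> continuous psi by case.
have L_add f g : Cc f -> Cc g -> L (fun x => f x + g x) = L f + L g.
  move=> Cf Cg; apply: (ess_cvg_unique (HL' _ (CcD Cf Cg))).
  have [C fC] := Cc_dominated Cf; have [D gD] := Cc_dominated Cg.
  have -> : a (fun x => f x + g x) = fun t => a f t + a g t.
    apply/funext => t.
    exact: (pairingD mw w0 Iw t (cCc _ Cf) (cCc _ Cg) fC gD).
  by apply: ess_cvgD; exact: HL'.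
have L_scale k f : Cc f -> L (fun x => k * f x) = k * L f.
  move=> Cf; apply: (ess_cvg_unique (HL' _ (CcZ k Cf))).
  have [C fC] := Cc_dominated Cf.
  have -> : a (fun x => k * f x) = fun t => k * a f t.
    by apply/funext => t; exact: (pairingZ mw w0 Iw k t (cCc _ Cf) fC).
  by apply: ess_cvgZ; exact: HL'.
have L_ge0 f : Cc f -> (forall x, 0 <= f x) -> 0 <= L f.
  move=> Cf f0; apply: (ess_cvg_ge (HL' _ Cf) T0 (negligible_set0 lam)).
  by move=> t _ _ _; exact: pairing_ge0.
have [mu0 [rmu0 Lmu0]] := riesz_representation L_add L_scale L_ge0.
exists mu0; split => //.
  move=> psi Cpsi; rewrite Lmu0//.
  have [N negN lim] := HL' _ Cpsi; have [C psiC] := Cc_dominated Cpsi.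
  exists (N `|` N0); first exact: negligibleU.
  have PF := near0_off_proper (negligibleU negN negN0).
  have lim' : (a psi t)%:E @[t --> near0_off (N `|` N0)] --> (L psi)%:E.
    by apply: cvg_EFin; [exact: nearW|apply: near0_off_cvgS lim; left].
  apply: cvg_trans lim'; apply: near_eq_cvg.
  apply: (near0_offP T0) => t t0 tT /not_orP[_ N0t].
  rewrite -(slice_integral t0 tT N0t (cCc _ Cpsi) psiC).
  by apply: eq_integral => x _; rewrite mulrC.
have [t0 [M [t00 t0T M0 [N1 negN1 HM]]]] := mass_bounded.
pose F n x := dilated_cutoff n x * phi x.
have CcF n : Cc (F n).
  by apply: CcM cphi; exact: Cc_dilated_cutoff.
have F0 n x : 0 <= F n x by rewrite mulr_ge0 ?dilated_cutoff_ge0// ltW.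
have Fphi n x : `|F n x| <= 1 * phi x.
  by rewrite mul1r ger0_norm// ler_piMl ?dilated_cutoff_le1// ltW.
apply: (@le_lt_trans _ _ M%:E); last by rewrite ltry.
apply: (@fatou_bound _ _ _ mu0 setT measurableT F phi M).
- by move=> n; apply: continuous_measurable_rV; exact: cCc.
- by move=> n x _; exact: F0.
- move=> x _; rewrite -[phi x]mul1r; apply: cvgMl; exact: dilated_cutoff_cvg.
move=> n; rewrite Lmu0// lee_fin.
apply: (ess_cvg_le (HL' _ (CcF n)) t00 negN1) => t t'0 tt0 N1t.
apply: (le_trans (ler_norm _)).
apply: (le_trans (pairing_le mw w0 Iw t (cCc _ (CcF n)) (Fphi n))).
by rewrite mul1r HM.
Qed.

End evolution.

Theorem theorem4p11 (R : realType) (d : nat)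
    (nu : {measure set 'rV[R]_d -> \bar R}) (T : R)
    (P : R -> 'rV[R]_d -> R) (phi : 'rV[R]_d -> R) (c : R)
    (u : 'rV[R]_d * R -> R) :
  (0 < d)%N ->
  symmetric_levy_measure nu ->
  0 < T ->
  heat_kernel nu P ->
  (forall t, 0 < t -> continuous (P t)) ->
  (forall t x, 0 < t -> 0 < P t x) ->
  class_C 2 phi ->
  1 < c ->
  (forall x, c^-1 * P 1 x <= phi x <= c * P 1 x) ->
  (forall x, `|levy_op nu phi x| <= c * phi x) ->
  (forall psi : 'rV[R]_d -> R, Cc_infty setT psi -> forall x,
     `|levy_form nu psi phi x| <=
       c * Num.max (sup_norm psi) (grad_sup_norm psi) * phi x) ->
  L1loc_weighted (P 1) T u ->
  ae_nonneg T u ->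
  very_weak_solution nu T u ->
  exists mu0 : {measure set 'rV[R]_d -> \bar R},
    [/\ radon_on setT mu0,
        initial_trace u mu0 &
        (\int[mu0]_x (P 1 x)%:E < +oo)%E].
Proof.
move=> d0 Hnu T0 _ cP P0 Cphi c1 phiP HL HB uP u0 Hu.
have c0 : 0 < c by exact: lt_trans c1.
have cphi := class_C_cont Cphi.
have phi0 x : 0 < phi x.
  have /andP[+ _] := phiP x; apply: lt_le_trans.
  by rewrite mulr_gt0 ?invr_gt0// P0.
have cP1 : continuous (P 1) by exact: cP.
have P10 x : 0 < P 1 x by exact: P0.
have [w [mw w0 IwP ImP [N0 negN0 wu]]] := good_representative T0 Hu.1 u0 cP1 P10 uP.
have phi_le x : `|phi x| <= c * P 1 x.
  by rewrite gtr0_norm//; have /andP[] := phiP x.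
have Iw t := pairing_int mw w0 IwP t cphi phi_le.
have Im e T' := pairing_time_int cP1 P10 mw w0 IwP ImP cphi phi_le (e := e) (T' := T').
have [mu0 [rmu0 trace phi_fin]] := initial_trace_exists Hnu T0 Cphi phi0 (ltW c0)
  HL HB Hu mw w0 Iw Im negN0 wu.
exists mu0; split => //.
apply: (@le_lt_trans _ _ (\int[mu0]_x (c * phi x)%:E)%E).
  apply: ge0_le_integral => //.
  - by move=> x _; rewrite lee_fin ltW// P0.
  - by apply/measurable_EFinP; exact: continuous_measurable_rV.
  - by apply/measurable_EFinP; apply: continuous_measurable_rV; exact: contZ.
  - move=> x _; rewrite lee_fin; have /andP[+ _] := phiP x.
    by rewrite ler_pdivrMl.
under eq_integral do rewrite EFinM.
rewrite ge0_integralZl//.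
- by rewrite lte_mul_pinfty// lee_fin ltW.
- by apply/measurable_EFinP; exact: continuous_measurable_rV.
- by move=> x _; rewrite lee_fin ltW.
- by rewrite lee_fin ltW.
Qed.
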